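(* For fixed $d \ge 1$, as $n \to \infty$ the expected number $\mathcal{G}_{d,n}$ of generators after $n$ observations in dimension $d$ satisfies $$\mathcal{G}_{d,n} = (\ln n)^{d-1} \sum_{j=0}^{d-1} a_{d,j} (\ln n)^{-j} + O\big(n^{-1}(\ln n)^{d-1}\big),$$ where $$a_{d,j} := \sum_{k=0}^{j} \binom{d}{d-j+k} \frac{(-1)^k \Gamma^{(k)}(d-j+k)}{k!\,(d-1-j)!},$$ and $\Gamma^{(k)}$ denotes the $k$-th derivative of the Gamma function. In particular $a_{d,0}=1$.
   Context: Let $X^{(1)}, X^{(2)}, \dots$ be i.i.d. random vectors uniformly distributed on $[0,1)^d$. For $x,y\in\mathbb{R}^d$, $x \prec y$ means $x_j<y_j$ for all $j$ and $x \le y$ means $x_j \le y_j$ for all $j$. After $n$ observations, the record-setting region is $S_n := \{x \in [0,1)^d : x \not\prec X^{(i)} \text{ for all } i \in [n]\}$; its generators are the minimal elements of $S_n$ with respect to $\le$. $\mathcal{G}_{d,n}$ is the expected number of generators of $S_n$. *)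

(* Defs.v *)
From Stdlib Require Import Reals Lra Lia List Arith ClassicalEpsilon.
Open Scope R_scope.

(* Points of R^d are represented as functions nat -> R whose coordinates
   j >= d vanish (so that R^d points are in bijection with these functions). *)
Definition is_pt (d : nat) (x : nat -> R) : Prop :=
  forall j, (d <= j)%nat -> x j = 0.

Definition sprec (d : nat) (x y : nat -> R) : Prop :=
  forall j, (j < d)%nat -> x j < y j.

Definition wle (d : nat) (x y : nat -> R) : Prop :=
  forall j, (j < d)%nat -> x j <= y j.

Definition in_S (d n : nat) (X : nat -> nat -> R) (x : nat -> R) : Prop :=
  is_pt d x /\ (forall j, (j < d)%nat -> 0 <= x j < 1) /\
  (forall i, (i < n)%nat -> ~ sprec d x (X i)).

Definition is_generator (d n : nat) (X : nat -> nat -> R) (x : nat -> R) : Prop :=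
  in_S d n X x /\ (forall y, in_S d n X y -> wle d y x -> y = x).

(* Number of generators (it is finite; epsilon picks the cardinality). *)
Definition gen_count (d n : nat) (X : nat -> nat -> R) : nat :=
  epsilon (inhabits 0%nat) (fun m => exists l : list (nat -> R),
     NoDup l /\ length l = m /\ (forall x, In x l <-> is_generator d n X x)).

Definition upd (z : nat -> R) (k : nat) (x : R) : nat -> R :=
  fun i => if Nat.eqb i k then x else z i.

Fixpoint iint (k : nat) (f : (nat -> R) -> R) (v : R) : Prop :=
  match k with
  | O => v = f (fun _ => 0)
  | S k' => exists g : R -> R,
      (forall x, 0 <= x <= 1 -> iint k' (fun z => f (upd z k' x)) (g x)) /\
      exists pr : Riemann_integrable g 0 1, RiemannInt pr = v
  end.

(* Expected number of generators G_{d,n}: X^{(i)}_j = z (i*d + j),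
   z uniform on the cube [0,1)^{dn}. *)
Definition Gdn (d n : nat) : R :=
  epsilon (inhabits 0) (iint (d * n)
    (fun z => INR (gen_count d n (fun i j => if (j <? d)%nat then z (i * d + j)%nat else 0)))).

Definition improper_int_0_inf (f : R -> R) (v : R) : Prop :=
  forall eps, eps > 0 -> exists a0 b0, a0 > 0 /\
    forall a b, 0 < a <= a0 -> b0 <= b ->
      exists pr : Riemann_integrable f a b, Rabs (RiemannInt pr - v) < eps.

Definition Gamma (s : R) : R :=
  epsilon (inhabits 0)
    (improper_int_0_inf (fun t => Rpower t (s - 1) * exp (- t))).

Fixpoint kth_deriv_pos (k : nat) (f : R -> R) (x v : R) : Prop :=
  match k with
  | O => v = f x
  | S k' => exists g : R -> R,
      (forall y, 0 < y -> derivable_pt_lim f y (g y)) /\ kth_deriv_pos k' g x v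
  end.

Definition Gamma_deriv (k : nat) (s : R) : R :=
  epsilon (inhabits 0) (kth_deriv_pos k Gamma s).

Definition a_coef (d j : nat) : R :=
  sum_f_R0 (fun k => C d (d - j + k) * ((-1) ^ k * Gamma_deriv k (INR (d - j + k)))
                     / (INR (fact k) * INR (fact (d - 1 - j)))) j.

(* Main.v *)
(** The points of [S_n] that are minimal are the [x] each of whose nonzero coordinates
    [x_j] equals [X^(i)_j] for an observation [i] exceeding [x] in all other
    coordinates, so generators are encoded by tuples in [{0..n}^d].  Away from ties, a
    tuple with [k] nonzero positions must use distinct observations, and conditionally on
    the chosen coordinates its probability is [Y^(k-1) (1-Y)^(n-k)], with [Y] a product of
    [k] independent uniforms.  Hence, with [n_(k) = n (n-1) ... (n-k+1)],
      [G_(d,n) = sum_k C(d,k) n_(k) / (k-1)! *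
                   int_0^1 p^(k-1) (1-p)^(n-k) (-ln p)^(k-1) dp].
    Substituting [p = e^u / n] and replacing [(1 - e^u/n)^(n-k)] by [exp (- e^u)] costs a
    relative error [O(1/n)]; expanding [(ln n - u)^(k-1)] then produces the derivatives
    [Gamma^(m)(k) = int u^m exp (k u - e^u) du] over the real line.

    The iterated Riemann integrals are handled through one class of functions, those of
    bounded variation in each coordinate uniformly in the others: it contains the
    indicators of coordinate comparisons, is stable under integration of a variable, and
    satisfies Fubini because grid averages converge with a uniform error. *)

Require Import Defs.
From Stdlib Require Import Reals Lra Lia List Arith ClassicalEpsilon FunctionalExtensionality PropExtensionality Permutation.
From Coquelicot Require Import Coquelicot.
Import ListNotations.
Open Scope R_scope.

(** [Gdn], [gen_count], [Gamma] and its derivatives are chosen by [epsilon], so each needs a proof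
    that the described object exists and is unique. For [iint] this means integrability of every
    slice at every stage, exceptional points included. The count is therefore written exactly at all
    points of the cube, ties too, by selecting one tuple per generator. Ties are discarded
    afterwards, one variable at a time, because a Riemann integral ignores changes at finitely many
    points.

    The order of integration matters: the observations are independent of each other only once the
    selected coordinates are fixed, so these must be moved outermost. The product [Y] enters through
    its power moments; the binomial expansion of its expectation is matched term by term with an
    explicit antiderivative on the real line.

    One dominating function, [1 / (1 + u^2)], serves for convergence, for differentiation under the
    integral sign and for the error terms, so each passage to the limit becomes an inequality with a
    constant. Besides the exponential approximation, replacing [n_(k)] by [n^k] costs another
    relative error [O(1/n)]. *)

(** * Finite sums and products over lists *)

Fixpoint lsum {A : Type} (f : A -> R) (l : list A) : R :=
  match l with nil => 0 | a :: l' => f a + lsum f l' end.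

Fixpoint lprod {A : Type} (f : A -> R) (l : list A) : R :=
  match l with nil => 1 | a :: l' => f a * lprod f l' end.

Lemma lsum_ext {A} (f g : A -> R) l :
  (forall a, In a l -> f a = g a) -> lsum f l = lsum g l.
Proof.
  induction l as [|a l IH]; simpl; intros H; auto.
  rewrite H, IH; auto.
Qed.

Lemma lprod_ext {A} (f g : A -> R) l :
  (forall a, In a l -> f a = g a) -> lprod f l = lprod g l.
Proof.
  induction l as [|a l IH]; simpl; intros H; auto.
  rewrite H, IH; auto.
Qed.

Lemma lsum_app {A} (f : A -> R) l1 l2 : lsum f (l1 ++ l2) = lsum f l1 + lsum f l2.
Proof. induction l1 as [|a l IH]; simpl; [ring | rewrite IH; ring]. Qed.

Lemma lsum_plus {A} (f g : A -> R) l : lsum (fun a => f a + g a) l = lsum f l + lsum g l.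
Proof. induction l as [|a l IH]; simpl; [ring | rewrite IH; ring]. Qed.

Lemma lsum_scal {A} (c : R) (f : A -> R) l : lsum (fun a => c * f a) l = c * lsum f l.
Proof. induction l as [|a l IH]; simpl; [ring | rewrite IH; ring]. Qed.

Lemma lsum_le {A} (f g : A -> R) l :
  (forall a, In a l -> f a <= g a) -> lsum f l <= lsum g l.
Proof.
  induction l as [|a l IH]; simpl; intros H; [lra|].
  assert (f a <= g a) by auto. assert (lsum f l <= lsum g l) by auto. lra.
Qed.

Lemma lsum_abs {A} (f : A -> R) l : Rabs (lsum f l) <= lsum (fun a => Rabs (f a)) l.
Proof.
  induction l as [|a l IH]; simpl; [rewrite Rabs_R0; lra|].
  eapply Rle_trans; [apply Rabs_triang|]. lra.
Qed.

Lemma lsum_const {A} (c : R) (l : list A) : lsum (fun _ => c) l = INR (length l) * c.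
Proof.
  induction l as [|a l IH]; [simpl; ring|].
  cbn [lsum length]. rewrite S_INR, IH. ring.
Qed.

Lemma lsum_swap {A B} (f : A -> B -> R) l m :
  lsum (fun a => lsum (f a) m) l = lsum (fun b => lsum (fun a => f a b) l) m.
Proof.
  induction l as [|a l IH]; simpl.
  - rewrite lsum_const. ring.
  - rewrite IH, lsum_plus. ring.
Qed.

Lemma lsum_map {A B} (h : A -> B) (f : B -> R) l : lsum f (map h l) = lsum (fun a => f (h a)) l.
Proof. induction l as [|a l IH]; simpl; congruence. Qed.

Lemma seq_snoc a n : seq a (S n) = seq a n ++ [(a + n)%nat].
Proof. replace (S n) with (n + 1)%nat by lia. rewrite seq_app. reflexivity. Qed.

(** * Functions of bounded variation on the unit interval *)

(** A partition is an initial segment of an infinite nondecreasing sequence, so no index bounds have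
    to be carried along. [V] is any bound for the variation. *)
Definition bv (V : R) (g : R -> R) : Prop :=
  forall (p : nat -> R) (m : nat),
    (forall i, 0 <= p i <= 1) -> (forall i, p i <= p (S i)) ->
    lsum (fun i => Rabs (g (p (S i)) - g (p i))) (seq 0 m) <= V.

(** [v t] is the total variation of [g] on [[0,t]], a supremum over partitions. Any partition of
    [[0,s]] can be prolonged by the points [s] and [t], which adds at least [|g t - g s|] to its
    sum. *)
Lemma bv_majorant V g : bv V g ->
  exists v : R -> R, (forall t, 0 <= t <= 1 -> 0 <= v t <= V) /\
    forall s t, 0 <= s -> s <= t -> t <= 1 -> Rabs (g t - g s) <= v t - v s.
Proof.
  intros Hg.
  set (E := fun t r => exists (p : nat -> R) (m : nat),
    (forall i, 0 <= p i <= t) /\ (forall i, p i <= p (S i)) /\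
    r = lsum (fun i => Rabs (g (p (S i)) - g (p i))) (seq 0 m)).
  assert (HV : forall t, 0 <= t <= 1 -> is_upper_bound (E t) V).
  { intros t Ht r (p & m & H1 & H2 & ->). apply Hg; auto.
    intros i. specialize (H1 i). lra. }
  assert (H0 : forall t, 0 <= t -> E t 0).
  { intros t Ht. exists (fun _ => 0), 0%nat. repeat split; intros; try lra. }
  assert (HL : forall t, 0 <= t <= 1 -> is_lub (E t) (epsilon (inhabits 0) (is_lub (E t)))).
  { intros t Ht. apply epsilon_spec.
    destruct (completeness (E t)) as [x Hx].
    - exists V. auto.
    - exists 0. apply H0; lra.
    - exists x; exact Hx. }
  exists (fun t => epsilon (inhabits 0) (is_lub (E t))). split.
  - intros t Ht. destruct (HL t Ht) as [U L]. split.
    + apply U, H0; lra.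
    + apply L, HV, Ht.
  - intros s t Hs Hst Ht.
    destruct (HL t ltac:(lra)) as [U _]. destruct (HL s ltac:(lra)) as [_ L].
    set (vt := epsilon _ (is_lub (E t))) in *. set (vs := epsilon _ (is_lub (E s))) in *.
    assert (vs <= vt - Rabs (g t - g s)); [|lra].
    apply L. intros r (p & m & H1 & H2 & ->).
    (* The prolonged sequence: [p] up to index [m], then [s], then constantly [t]. *)
    set (q := fun i => if (i <=? m)%nat then p i else if (i =? S m)%nat then s else t).
    assert (Hq : E t (lsum (fun i => Rabs (g (q (S i)) - g (q i))) (seq 0 (S (S m))))).
    { exists q, (S (S m)). repeat split.
      - unfold q. destruct (i <=? m)%nat; [apply H1|]. destruct (i =? S m)%nat; lra.
      - unfold q. destruct (i <=? m)%nat; [pose proof (H1 i); lra|]. destruct (i =? S m)%nat; lra.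
      - intros i. unfold q. destruct (Nat.leb_spec i m), (Nat.leb_spec (S i) m); try lia; auto.
        + replace i with m by lia. rewrite Nat.eqb_refl. apply H1.
        + destruct (Nat.eqb_spec (S i) (S m)); try lia. destruct (i =? S m)%nat; lra. }
    apply U in Hq. rewrite seq_snoc, lsum_app, seq_snoc, lsum_app in Hq. simpl lsum in Hq.
    assert (Hqm : q m = p m) by (unfold q; rewrite Nat.leb_refl; auto).
    assert (Hq1 : q (S m) = s).
    { unfold q. destruct (Nat.leb_spec (S m) m); try lia. rewrite Nat.eqb_refl; auto. }
    assert (Hq2 : q (S (S m)) = t).
    { unfold q. destruct (Nat.leb_spec (S (S m)) m); try lia.
      destruct (Nat.eqb_spec (S (S m)) (S m)); try lia. auto. }
    rewrite Hqm, Hq1, Hq2 in Hq. pose proof (Rabs_pos (g s - g (p m))).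
    rewrite (lsum_ext _ (fun i => Rabs (g (p (S i)) - g (p i)))) in Hq; [lra|].
    intros i Hi. apply in_seq in Hi. unfold q.
    destruct (Nat.leb_spec i m), (Nat.leb_spec (S i) m); try lia. auto.
Qed.

(** Riemann's criterion with integrable functions in place of step functions. Approximating [phi]
    and [psi] by step functions turns the squeeze into the original criterion, the two approximation
    errors being added to the upper bound. *)
Lemma ex_RInt_squeeze (g : R -> R) (a b : R) : a <= b ->
  (forall eps, 0 < eps -> exists phi psi : R -> R,
     ex_RInt phi a b /\ ex_RInt psi a b /\
     (forall t, a <= t <= b -> Rabs (g t - phi t) <= psi t) /\ RInt psi a b < eps) ->
  ex_RInt g a b.
Proof.
  intros Hab H. apply ex_RInt_Reals_1. intros eps.
  assert (E : exists phi : StepFun a b, exists psi : StepFun a b,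
     (forall t, Rmin a b <= t <= Rmax a b -> Rabs (g t - phi t) <= psi t) /\
        Rabs (RiemannInt_SF psi) < eps).
  (* The criterion asks for the step functions as data, so a description principle extracts them
     from the bare existence statement. *)
  2:{ apply constructive_indefinite_description in E. destruct E as [phi E].
      apply constructive_indefinite_description in E. exists phi. exact E. }
  destruct eps as [eps Heps]. simpl.
  destruct (H (eps / 4)) as (phi & psi & H1 & H2 & H3 & H4); [lra|].
  apply ex_RInt_Reals_0 in H1. apply ex_RInt_Reals_0 in H2.
  destruct (H1 (mkposreal (eps/4) ltac:(lra))) as (f1 & e1 & A1 & B1). simpl in B1.
  rewrite (RInt_Reals _ _ _ H2) in H4. unfold RiemannInt in H4.
  destruct (RiemannInt_exists H2 RinvN RinvN_cv) as [x Hx].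
  (* Here [x] is the integral of [psi], less than [eps/4]; the tolerance [eps/4 - x] keeps the
     integral of the approximating step function below [eps/4] as well. *)
  destruct (Hx (eps/4 - x) ltac:(lra)) as [N1 HN1].
  assert (He4 : eps / 4 > 0) by lra. destruct (RinvN_cv He4) as [N2 HN2].
  set (N := max N1 N2). specialize (HN1 N ltac:(lia)). specialize (HN2 N ltac:(lia)).
  destruct (phi_sequence_prop RinvN H2 N) as (e2 & A2 & B2).
  set (f2 := phi_sequence RinvN H2 N) in *.
  unfold Rdist in HN1, HN2. apply Rabs_def2 in HN1. apply Rabs_def2 in HN2.
  rewrite Rmin_left, Rmax_right in * by lra.
  set (s1 := mkStepFun (StepFun_P28 1 e1 f2)).
  set (s2 := mkStepFun (StepFun_P28 1 s1 e2)).
  exists f1, s2. split.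
  - intros t Ht. simpl. specialize (A1 t Ht). specialize (A2 t Ht). specialize (H3 t Ht).
    apply Rabs_le_between in A1. apply Rabs_le_between in A2. apply Rabs_le_between in H3.
    apply Rabs_le. lra.
  - unfold s2. rewrite StepFun_P30. unfold s1. rewrite StepFun_P30.
    apply Rabs_def2 in B1. apply Rabs_def2 in B2.
    assert (P : 0 <= RiemannInt_SF s2).
    { replace 0 with (0 * (b - a)) by ring. rewrite <- StepFun_P18.
      apply StepFun_P37; auto. intros t Ht. simpl. unfold fct_cte.
      specialize (A1 t ltac:(lra)). specialize (A2 t ltac:(lra)). specialize (H3 t ltac:(lra)).
      pose proof (Rabs_pos (phi t - f1 t)). pose proof (Rabs_pos (g t - phi t)).
      apply Rabs_le_between in A2. lra. }
    unfold s2 in P. rewrite StepFun_P30 in P. unfold s1 in P. rewrite StepFun_P30 in P.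
    rewrite Rabs_pos_eq by lra. lra.
Qed.

Lemma is_RInt_glue (f g h : R -> R) a b c lf lg : a <= b <= c ->
  is_RInt f a b lf -> is_RInt g b c lg ->
  (forall t, a < t < b -> h t = f t) -> (forall t, b < t < c -> h t = g t) ->
  is_RInt h a c (lf + lg).
Proof.
  intros Habc Hf Hg H1 H2. apply (is_RInt_Chasles h a b c lf lg).
  - apply is_RInt_ext with f; auto. rewrite Rmin_left, Rmax_right by lra.
    intros; symmetry; auto.
  - apply is_RInt_ext with g; auto. rewrite Rmin_left, Rmax_right by lra.
    intros; symmetry; auto.
Qed.

Lemma is_RInt_cst (a b v : R) : is_RInt (fun _ => v) a b ((b - a) * v).
Proof. apply (is_RInt_const a b v). Qed.

(** On each of [N] equal cells [g] is replaced by its value at the left end. The error there is at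
    most the increment of the majorant [v], and these increments telescope, so the total error is at
    most [V / N]. *)
Lemma bv_ex_RInt V g : bv V g -> ex_RInt g 0 1.
Proof.
  intros Hg. destruct (bv_majorant V g Hg) as (v & Hv & Hgv).
  apply ex_RInt_squeeze; [lra|]. intros eps Heps.
  pose proof (Hv 0 ltac:(lra)) as Hv0.
  (* [V + 1] rather than [V] covers [V = 0]; the choice gives [V / N < eps]. *)
  destruct (archimed_cor1 (eps / (V + 1))) as (N & HN & HN0).
  { apply Rdiv_lt_0_compat; lra. }
  assert (PN : 0 < INR N) by (apply lt_0_INR; auto).
  set (p := fun m => INR m / INR N).
  assert (Hp : forall m, p (S m) = p m + / INR N) by (intros; unfold p; rewrite S_INR; field; lra).
  assert (Hi : 0 < / INR N) by (apply Rinv_0_lt_compat; auto).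
  assert (Hp0 : forall m, 0 <= p m) by (intros; unfold p; apply Rdiv_le_0_compat; auto; apply pos_INR).
  assert (Q : forall m, (m <= N)%nat -> exists (phi psi : R -> R) (lp l : R),
     is_RInt phi 0 (p m) lp /\ is_RInt psi 0 (p m) l /\
     (forall t, 0 <= t <= p m -> Rabs (g t - phi t) <= psi t) /\
     l = (v (p m) - v 0) * / INR N).
  { induction m as [|m IH]; intros Hm.
    - exists g, (fun _ => 0), 0, 0. replace (p 0%nat) with 0 by (unfold p; simpl; field; lra).
      repeat split.
      + exact (is_RInt_point (V := R_NormedModule) g 0).
      + exact (is_RInt_point (V := R_NormedModule) _ 0).
      + intros t _. rewrite Rminus_diag, Rabs_R0. lra.
      + ring.
    - destruct IH as (phi & psi & lp & l & H1 & H2 & H3 & H4); [lia|].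
      assert (Hp1 : p (S m) <= 1).
      { unfold p. apply Rmult_le_reg_r with (INR N); auto. unfold Rdiv. rewrite Rmult_assoc, Rinv_l, Rmult_1_r, Rmult_1_l by lra.
        apply le_INR; auto. }
      pose proof (Hp m) as Hpm. pose proof (Hp0 m) as Hpm0.
      exists (fun t => if Rle_dec t (p m) then phi t else g (p m)),
        (fun t => if Rle_dec t (p m) then psi t else v (p (S m)) - v (p m)),
        (lp + (p (S m) - p m) * g (p m)), (l + (p (S m) - p m) * (v (p (S m)) - v (p m))).
      repeat split.
      + apply is_RInt_glue with phi (fun _ => g (p m)) (p m); auto; try lra.
        * apply is_RInt_cst.
        * intros t Ht. destruct (Rle_dec t (p m)); lra.
        * intros t Ht. destruct (Rle_dec t (p m)); lra.
      + apply is_RInt_glue with psi (fun _ => v (p (S m)) - v (p m)) (p m); auto; try lra.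
        * apply is_RInt_cst.
        * intros t Ht. destruct (Rle_dec t (p m)); lra.
        * intros t Ht. destruct (Rle_dec t (p m)); lra.
      + intros t Ht. destruct (Rle_dec t (p m)).
        * apply H3; lra.
        * pose proof (Hgv (p m) t ltac:(lra) ltac:(lra) ltac:(lra)).
          pose proof (Hgv t (p (S m)) ltac:(lra) ltac:(lra) ltac:(lra)).
          pose proof (Rabs_pos (g (p (S m)) - g t)). lra.
      + rewrite H4, Hpm. ring. }
  destruct (Q N (le_n N)) as (phi & psi & lp & l & H1 & H2 & H3 & H4).
  replace (p N) with 1 in * by (unfold p; field; lra).
  exists phi, psi. repeat split; auto.
  - exists lp; auto.
  - exists l; auto.
  - rewrite (is_RInt_unique _ _ _ _ H2), H4. pose proof (Hv 1 ltac:(lra)).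
    apply Rle_lt_trans with (V * / INR N).
    + apply Rmult_le_compat_r; lra.
    + apply Rmult_lt_compat_l with (r := V + 1) in HN; [|lra].
      replace ((V + 1) * (eps / (V + 1))) with eps in HN by (field; lra). lra.
Qed.

Definition grid_avg (N : nat) (g : R -> R) : R :=
  / INR N * lsum (fun i => g (INR i / INR N)) (seq 0 N).

(** The same telescoping, now for the value of the integral. The error depends on [g] only through
    [V], which is the uniformity used for exchanging two integrals. *)
Lemma bv_grid V g N : bv V g -> (0 < N)%nat ->
  Rabs (RInt g 0 1 - grid_avg N g) <= V * / INR N.
Proof.
  intros Hg HN. pose proof (bv_ex_RInt V g Hg) as Ex.
  destruct (bv_majorant V g Hg) as (v & Hv & Hgv).
  assert (PN : 0 < INR N) by (apply lt_0_INR; auto).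
  assert (Hi : 0 < / INR N) by (apply Rinv_0_lt_compat; auto).
  set (p := fun m => INR m / INR N).
  assert (Hp : forall m, p (S m) = p m + / INR N) by (intros; unfold p; rewrite S_INR; field; lra).
  assert (Hp0 : forall m, 0 <= p m) by (intros; unfold p; apply Rdiv_le_0_compat; auto; apply pos_INR).
  assert (Q : forall m, (m <= N)%nat ->
     Rabs (RInt g 0 (p m) - / INR N * lsum (fun i => g (p i)) (seq 0 m)) <= (v (p m) - v 0) * / INR N).
  { induction m as [|m IH]; intros Hm.
    - replace (p 0%nat) with 0 by (unfold p; simpl; field; lra).
      rewrite RInt_point. simpl. unfold zero; simpl.
      replace (0 - / INR N * 0) with 0 by ring. rewrite Rabs_R0. lra.
    - assert (Hp1 : p (S m) <= 1).
      { unfold p. apply Rmult_le_reg_r with (INR N); auto. unfold Rdiv. rewrite Rmult_assoc, Rinv_l, Rmult_1_r, Rmult_1_l by lra.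
        apply le_INR; auto. }
      pose proof (Hp m) as Hpm. pose proof (Hp0 m) as Hpm0.
      specialize (IH ltac:(lia)). rewrite seq_snoc, lsum_app. simpl lsum.
      assert (E1 : ex_RInt g 0 (p (S m))) by (apply (ex_RInt_Chasles_1 (V := R_CompleteNormedModule)) with 1; auto; lra).
      assert (E2 : ex_RInt g 0 (p m)) by (apply (ex_RInt_Chasles_1 (V := R_CompleteNormedModule)) with (p (S m)); auto; lra).
      assert (E3 : ex_RInt g (p m) (p (S m))) by (apply (ex_RInt_Chasles_2 (V := R_CompleteNormedModule)) with 0; auto; lra).
      rewrite <- (RInt_Chasles (V := R_CompleteNormedModule) g 0 (p m) (p (S m))) by auto. unfold plus; simpl.
      assert (D : Rabs (RInt g (p m) (p (S m)) - / INR N * g (p m)) <= (v (p (S m)) - v (p m)) * / INR N).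
      { replace (RInt g (p m) (p (S m)) - / INR N * g (p m))
          with (RInt (fun t => g t - g (p m)) (p m) (p (S m))).
        2:{ rewrite (RInt_minus (V := R_CompleteNormedModule) g (fun _ => g (p m))); auto.
            2:{ apply ex_RInt_const. }
            rewrite RInt_const. unfold minus, plus, opp, scal; simpl. unfold mult; simpl.
            rewrite Hpm. ring. }
        replace ((v (p (S m)) - v (p m)) * / INR N) with ((p (S m) - p m) * (v (p (S m)) - v (p m))) by (rewrite Hpm; ring).
        apply abs_RInt_le_const; [lra| |].
        - apply (ex_RInt_minus (V := R_NormedModule) g (fun _ => g (p m))); auto. apply ex_RInt_const.
        - intros t Ht.
          pose proof (Hgv (p m) t ltac:(lra) ltac:(lra) ltac:(lra)).
          pose proof (Hgv t (p (S m)) ltac:(lra) ltac:(lra) ltac:(lra)).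
          pose proof (Rabs_pos (g (p (S m)) - g t)). lra. }
      apply Rabs_le_between in D. apply Rabs_le_between in IH. apply Rabs_le. lra. }
  specialize (Q N (le_n N)). unfold grid_avg.
  replace (p N) with 1 in Q by (unfold p; field; lra).
  eapply Rle_trans; [exact Q|]. pose proof (Hv 1 ltac:(lra)). pose proof (Hv 0 ltac:(lra)).
  apply Rmult_le_compat_r; lra.
Qed.

Lemma bv_nonneg V g : bv V g -> 0 <= V.
Proof. intros H. apply (H (fun _ => 0) 0%nat); intros; lra. Qed.

Lemma lsum_RInt {A} (f : A -> R -> R) (l : list A) a b :
  (forall i, In i l -> ex_RInt (f i) a b) ->
  is_RInt (fun t => lsum (fun i => f i t) l) a b (lsum (fun i => RInt (f i) a b) l).
Proof.
  induction l as [|i l IH]; intros H; simpl.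
  - pose proof (is_RInt_cst a b 0) as I. rewrite Rmult_0_r in I. exact I.
  - apply (is_RInt_plus (V := R_NormedModule) (f i) (fun t => lsum (fun i => f i t) l)).
    + apply (RInt_correct (V := R_CompleteNormedModule)); apply H; simpl; auto.
    + apply IH; intros; apply H; simpl; auto.
Qed.

(** The triangle inequality under the integral, then summation inside it. The bound [V] is
    preserved, so it does not grow when integrals are iterated. *)
Lemma bv_RInt V (f : R -> R -> R) :
  (forall s, 0 <= s <= 1 -> ex_RInt (f s) 0 1) -> (forall t, 0 <= t <= 1 -> bv V (fun s => f s t)) ->
  bv V (fun s => RInt (f s) 0 1).
Proof.
  intros E Hf p m Hp Hm.
  assert (E1 : forall i, ex_RInt (fun t => f (p (S i)) t - f (p i) t) 0 1).
  { intros i. apply (ex_RInt_minus (V := R_NormedModule)); apply E; apply Hp. }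
  assert (E2 : forall i, ex_RInt (fun t => Rabs (f (p (S i)) t - f (p i) t)) 0 1).
  { intros i. apply (ex_RInt_norm (fun t => f (p (S i)) t - f (p i) t)); auto. }
  apply Rle_trans with (lsum (fun i => RInt (fun t => Rabs (f (p (S i)) t - f (p i) t)) 0 1) (seq 0 m)).
  - apply lsum_le. intros i _.
    replace (RInt (f (p (S i))) 0 1 - RInt (f (p i)) 0 1) with (RInt (fun t => f (p (S i)) t - f (p i) t) 0 1).
    + apply abs_RInt_le; auto; lra.
    + apply (RInt_minus (V := R_CompleteNormedModule) (f (p (S i))) (f (p i))); apply E; apply Hp.
  - pose proof (lsum_RInt (fun i t => Rabs (f (p (S i)) t - f (p i) t)) (seq 0 m) 0 1 ltac:(intros; apply E2)) as I.
    rewrite <- (is_RInt_unique _ _ _ _ I).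
    replace V with (RInt (fun _ => V) 0 1) by (rewrite RInt_const; unfold scal; simpl; unfold mult; simpl; ring).
    apply RInt_le; [lra| | |].
    + eexists; exact I.
    + apply ex_RInt_const.
    + intros t Ht. apply (Hf t); auto; lra.
Qed.

(** Both iterated integrals lie within [2 V / N] of the same double grid average, whose two finite
    sums may be swapped. If they differed by [D > 0], a grid with [4 V / N < D] would give a
    contradiction. *)
Lemma bv_Fubini V (f : R -> R -> R) :
  (forall s, 0 <= s <= 1 -> bv V (f s)) -> (forall t, 0 <= t <= 1 -> bv V (fun s => f s t)) ->
  RInt (fun s => RInt (f s) 0 1) 0 1 = RInt (fun t => RInt (fun s => f s t) 0 1) 0 1.
Proof.
  intros H1 H2. pose proof (bv_nonneg _ _ (H1 0 ltac:(lra))) as HV.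
  assert (Q : forall h : R -> R -> R,
    (forall s, 0 <= s <= 1 -> bv V (h s)) -> (forall t, 0 <= t <= 1 -> bv V (fun s => h s t)) ->
    forall N, (0 < N)%nat ->
    Rabs (RInt (fun s => RInt (h s) 0 1) 0 1 -
      / INR N * lsum (fun i => / INR N * lsum (fun j => h (INR i / INR N) (INR j / INR N)) (seq 0 N)) (seq 0 N)) <= 2 * V * / INR N).
  { intros h A1 A2 N HN.
    assert (PN : 0 < INR N) by (apply lt_0_INR; auto).
    assert (Hi : 0 < / INR N) by (apply Rinv_0_lt_compat; auto).
    assert (B : bv V (fun s => RInt (h s) 0 1)).
    { apply bv_RInt; auto. intros s Hs. apply bv_ex_RInt with V; auto. }
    pose proof (bv_grid V _ N B HN) as G. unfold grid_avg in G.
    assert (D : Rabs (/ INR N * lsum (fun i => RInt (h (INR i / INR N)) 0 1) (seq 0 N) -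
       / INR N * lsum (fun i => / INR N * lsum (fun j => h (INR i / INR N) (INR j / INR N)) (seq 0 N)) (seq 0 N)) <= V * / INR N).
    { rewrite <- Rmult_minus_distr_l, Rabs_mult, (Rabs_pos_eq (/ INR N)) by lra.
      rewrite (Rmult_comm V). apply Rmult_le_compat_l; [lra|].
      match goal with |- Rabs (lsum ?f ?l - lsum ?g ?l) <= _ =>
        replace (lsum f l - lsum g l) with (lsum (fun i => f i + (-1) * g i) l) by (rewrite lsum_plus, lsum_scal; ring) end.
      eapply Rle_trans; [apply lsum_abs|].
      apply Rle_trans with (lsum (fun _ => V * / INR N) (seq 0 N)).
      - apply lsum_le. intros i Hi'. apply in_seq in Hi'.
        replace (RInt (h (INR i / INR N)) 0 1 + -1 * (/ INR N * lsum (fun j => h (INR i / INR N) (INR j / INR N)) (seq 0 N)))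
          with (RInt (h (INR i / INR N)) 0 1 - grid_avg N (h (INR i / INR N))) by (unfold grid_avg; ring).
        apply bv_grid; auto. apply A1. split.
        + apply Rdiv_le_0_compat; auto; apply pos_INR.
        + apply Rmult_le_reg_r with (INR N); auto. unfold Rdiv. rewrite Rmult_assoc, Rinv_l, Rmult_1_r, Rmult_1_l by lra.
          apply le_INR; lia.
      - rewrite lsum_const, length_seq. right. field. lra. }
    apply Rabs_le_between in D. apply Rabs_le_between in G. apply Rabs_le. lra. }
  apply Rminus_diag_uniq.
  destruct (Req_dec (RInt (fun s => RInt (f s) 0 1) 0 1 - RInt (fun t => RInt (fun s => f s t) 0 1) 0 1) 0) as [|Hne]; auto.
  exfalso. apply Rabs_pos_lt in Hne. set (D := Rabs _) in Hne.
  destruct (archimed_cor1 (D / (4 * V + 1))) as (N & HN & HN0).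
  { apply Rdiv_lt_0_compat; lra. }
  assert (PN : 0 < INR N) by (apply lt_0_INR; auto).
  assert (Hi : 0 < / INR N) by (apply Rinv_0_lt_compat; auto).
  pose proof (Q f H1 H2 N HN0) as Q1. pose proof (Q (fun t s => f s t) H2 H1 N HN0) as Q2.
  assert (Sw : lsum (fun i => / INR N * lsum (fun j => f (INR i / INR N) (INR j / INR N)) (seq 0 N)) (seq 0 N)
     = lsum (fun i => / INR N * lsum (fun j => f (INR j / INR N) (INR i / INR N)) (seq 0 N)) (seq 0 N)).
  { rewrite !lsum_scal, lsum_swap. reflexivity. }
  cbv beta in Q2. rewrite <- Sw in Q2.
  assert (D <= 4 * V * / INR N).
  { apply Rabs_le_between in Q1. apply Rabs_le_between in Q2. unfold D. apply Rabs_le. lra. }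
  apply Rmult_lt_compat_l with (r := 4 * V + 1) in HN; [|lra].
  replace ((4 * V + 1) * (D / (4 * V + 1))) with D in HN by (field; lra). lra.
Qed.

(** * Iterated integrals over coordinates of the cube *)

Definition cube (z : nat -> R) : Prop := forall i, 0 <= z i <= 1.

(** The sup bound accompanies the variation bound because the variation of a product involves
    both. *)
Definition nice (f : (nat -> R) -> R) : Prop :=
  exists V, forall z, cube z -> Rabs (f z) <= V /\ forall a, bv V (fun t => f (upd z a t)).

Definition I1 (a : nat) (f : (nat -> R) -> R) (z : nat -> R) : R :=
  RInt (fun t => f (upd z a t)) 0 1.

Definition ExL (l : list nat) (f : (nat -> R) -> R) : (nat -> R) -> R := fold_right I1 f l.

(** In [ExL] above, the head of the list is the outermost integral. The condition here concerns the
    cube only, where all the integrals are evaluated. *)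
Definition indep (a : nat) (f : (nat -> R) -> R) : Prop :=
  forall z t, cube z -> 0 <= t <= 1 -> f (upd z a t) = f z.

Lemma cube_upd z a t : cube z -> 0 <= t <= 1 -> cube (upd z a t).
Proof. intros Hz Ht i. unfold upd. destruct (i =? a)%nat; auto. Qed.

Lemma cube_0 : cube (fun _ => 0).
Proof. intros i. lra. Qed.

Lemma upd_same z a t s : upd (upd z a t) a s = upd z a s.
Proof. extensionality i. unfold upd. destruct (i =? a)%nat; auto. Qed.

Lemma upd_comm z a b t s : a <> b -> upd (upd z a t) b s = upd (upd z b s) a t.
Proof.
  intros H. extensionality i. unfold upd.
  destruct (Nat.eqb_spec i a), (Nat.eqb_spec i b); subst; congruence.
Qed.

Lemma upd_eq z a t : upd z a t a = t.
Proof. unfold upd. rewrite Nat.eqb_refl. auto. Qed.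

Lemma upd_neq z a t b : b <> a -> upd z a t b = z b.
Proof. intros H. unfold upd. apply Nat.eqb_neq in H. rewrite H. auto. Qed.

Lemma bv_ext V g h : (forall t, 0 <= t <= 1 -> g t = h t) -> bv V g -> bv V h.
Proof.
  intros E H p m Hp Hm. rewrite (lsum_ext _ (fun i => Rabs (g (p (S i)) - g (p i)))).
  - apply H; auto.
  - intros i _. rewrite !E; auto.
Qed.

Lemma bv_le V W g : V <= W -> bv V g -> bv W g.
Proof. intros L H p m Hp Hm. eapply Rle_trans; [apply H; auto | auto]. Qed.

Lemma bv_const c : bv 0 (fun _ => c).
Proof.
  intros p m _ _. right. rewrite (lsum_ext _ (fun _ => 0)).
  - rewrite lsum_const. ring.
  - intros. rewrite Rminus_diag, Rabs_R0. auto.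
Qed.

Lemma bv_plus V W g h : bv V g -> bv W h -> bv (V + W) (fun t => g t + h t).
Proof.
  intros Hg Hh p m Hp Hm. specialize (Hg p m Hp Hm). specialize (Hh p m Hp Hm).
  eapply Rle_trans; [|apply Rplus_le_compat; eassumption].
  rewrite <- lsum_plus. apply lsum_le. intros i _.
  eapply Rle_trans; [|apply Rabs_triang]. right. f_equal. ring.
Qed.

Lemma bv_mult V W B D g h : bv V g -> bv W h ->
  (forall t, 0 <= t <= 1 -> Rabs (g t) <= B) -> (forall t, 0 <= t <= 1 -> Rabs (h t) <= D) ->
  bv (D * V + B * W) (fun t => g t * h t).
Proof.
  intros Hg Hh HB HD p m Hp Hm. specialize (Hg p m Hp Hm). specialize (Hh p m Hp Hm).
  pose proof (HB 0 ltac:(lra)). pose proof (HD 0 ltac:(lra)).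
  pose proof (Rabs_pos (g 0)). pose proof (Rabs_pos (h 0)).
  apply Rle_trans with (D * lsum (fun i => Rabs (g (p (S i)) - g (p i))) (seq 0 m)
     + B * lsum (fun i => Rabs (h (p (S i)) - h (p i))) (seq 0 m)).
  - rewrite <- !lsum_scal, <- lsum_plus. apply lsum_le. intros i _.
    replace (g (p (S i)) * h (p (S i)) - g (p i) * h (p i))
      with (h (p (S i)) * (g (p (S i)) - g (p i)) + g (p i) * (h (p (S i)) - h (p i))) by ring.
    eapply Rle_trans; [apply Rabs_triang|]. rewrite !Rabs_mult.
    apply Rplus_le_compat; apply Rmult_le_compat_r; auto using Rabs_pos.
  - apply Rplus_le_compat; apply Rmult_le_compat_l; lra.
Qed.

Lemma bv_mono g : (forall s t, 0 <= s -> s <= t -> t <= 1 -> g s <= g t) ->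
  (forall t, 0 <= t <= 1 -> 0 <= g t <= 1) -> bv 1 g.
Proof.
  intros M B p m Hp Hm.
  assert (lsum (fun i => Rabs (g (p (S i)) - g (p i))) (seq 0 m) = g (p m) - g (p 0%nat)) as ->.
  { induction m as [|m IH]; [simpl; ring|]. rewrite seq_snoc, lsum_app, IH. simpl.
    rewrite Rabs_pos_eq; [ring|]. pose proof (Hp m). pose proof (Hp (S m)).
    pose proof (M (p m) (p (S m)) ltac:(lra) (Hm m) ltac:(lra)). lra. }
  pose proof (B _ (Hp m)). pose proof (B _ (Hp 0%nat)). lra.
Qed.

Lemma nice_ext f g : (forall z, cube z -> f z = g z) -> nice f -> nice g.
Proof.
  intros E (V & HV). exists V. intros z Hz. destruct (HV z Hz) as [H1 H2]. split.
  - rewrite <- E; auto.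
  - intros a. apply bv_ext with (fun t => f (upd z a t)); auto.
    intros t Ht. apply E, cube_upd; auto.
Qed.

Lemma nice_const c : nice (fun _ => c).
Proof.
  exists (Rabs c). intros z _. split; [lra|]. intros a.
  apply bv_le with 0; [apply Rabs_pos | apply bv_const].
Qed.

Lemma nice_plus f g : nice f -> nice g -> nice (fun z => f z + g z).
Proof.
  intros (V & HV) (W & HW). exists (V + W). intros z Hz.
  destruct (HV z Hz) as [A1 A2], (HW z Hz) as [B1 B2]. split.
  - eapply Rle_trans; [apply Rabs_triang|]. lra.
  - intros a. apply bv_plus; auto.
Qed.

Lemma nice_mult f g : nice f -> nice g -> nice (fun z => f z * g z).
Proof.
  intros (V & HV) (W & HW). exists (W * V + V * W). intros z Hz.
  assert (0 <= V /\ 0 <= W) as [PV PW].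
  { split; [pose proof (proj1 (HV z Hz)) | pose proof (proj1 (HW z Hz))].
    - pose proof (Rabs_pos (f z)); lra.
    - pose proof (Rabs_pos (g z)); lra. }
  split.
  - rewrite Rabs_mult. apply Rle_trans with (V * W).
    + apply Rmult_le_compat; auto using Rabs_pos; [apply HV | apply HW]; auto.
    + assert (0 <= W * V) by (apply Rmult_le_pos; auto). lra.
  - intros a. apply bv_mult; try (apply HV; auto); try (apply HW; auto).
    + intros t Ht. apply HV, cube_upd; auto.
    + intros t Ht. apply HW, cube_upd; auto.
Qed.

Lemma nice_lsum {A} (f : A -> (nat -> R) -> R) l :
  (forall i, In i l -> nice (f i)) -> nice (fun z => lsum (fun i => f i z) l).
Proof.
  induction l as [|i l IH]; intros H; simpl.
  - apply nice_const.
  - apply nice_plus; [apply H; simpl; auto | apply IH; intros; apply H; simpl; auto].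
Qed.

Lemma nice_lprod {A} (f : A -> (nat -> R) -> R) l :
  (forall i, In i l -> nice (f i)) -> nice (fun z => lprod (fun i => f i z) l).
Proof.
  induction l as [|i l IH]; intros H; simpl.
  - apply nice_const.
  - apply nice_mult; [apply H; simpl; auto | apply IH; intros; apply H; simpl; auto].
Qed.

Lemma nice_coord a : nice (fun z => z a).
Proof.
  exists 1. intros z Hz. split.
  - destruct (Hz a). rewrite Rabs_pos_eq; auto.
  - intros b. destruct (Nat.eq_dec a b) as [->|N].
    + apply bv_ext with (fun t => t); [intros; rewrite upd_eq; auto|]. apply bv_mono; auto.
    + apply bv_ext with (fun t => z a); [intros; rewrite upd_neq; auto|].
      apply bv_le with 0; [lra|apply bv_const].
Qed.

Lemma nice_slice f z a : nice f -> cube z -> ex_RInt (fun t => f (upd z a t)) 0 1.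
Proof. intros (V & HV) Hz. apply bv_ex_RInt with V. apply HV; auto. Qed.

Lemma nice_upd f a x : 0 <= x <= 1 -> nice f -> nice (fun z => f (upd z a x)).
Proof.
  intros Hx (V & HV). exists V. intros z Hz. split.
  - apply HV, cube_upd; auto.
  - intros b. destruct (Nat.eq_dec a b) as [->|N].
    + apply bv_ext with (fun _ => f (upd z b x)); [intros; rewrite upd_same; auto|].
      apply bv_le with 0; [|apply bv_const]. exact (bv_nonneg _ _ (proj2 (HV z Hz) b)).
    + apply bv_ext with (fun t => f (upd (upd z a x) b t)).
      * intros. rewrite upd_comm; auto.
      * apply HV, cube_upd; auto.
Qed.

Lemma I1_ext a f g z : cube z -> (forall z, cube z -> f z = g z) -> I1 a f z = I1 a g z.
Proof.
  intros Hz E. apply RInt_ext. rewrite Rmin_left, Rmax_right by lra.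
  intros t Ht. apply E, cube_upd; auto; lra.
Qed.

Lemma ExL_ext l f g z : cube z -> (forall z, cube z -> f z = g z) -> ExL l f z = ExL l g z.
Proof.
  revert z. induction l as [|a l IH]; intros z Hz E; simpl; auto.
  apply I1_ext; auto.
Qed.

Lemma nice_I1 a f : nice f -> nice (I1 a f).
Proof.
  intros Hf. pose proof Hf as (V & HV). exists V. intros z Hz. split.
  - replace V with ((1 - 0) * V) by ring. apply abs_RInt_le_const; [lra| |].
    + apply nice_slice; auto.
    + intros t Ht. apply HV, cube_upd; auto.
  - intros b. destruct (Nat.eq_dec a b) as [->|N].
    + apply bv_ext with (fun _ => I1 b f z).
      * intros. apply RInt_ext. intros. rewrite upd_same; auto.
      * apply bv_le with 0; [|apply bv_const]. exact (bv_nonneg _ _ (proj2 (HV z Hz) b)).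
    + apply (bv_RInt V (fun s t => f (upd (upd z b s) a t))).
      * intros. apply nice_slice; auto. apply cube_upd; auto.
      * intros t Ht. apply bv_ext with (fun s => f (upd (upd z a t) b s)).
        -- intros. rewrite upd_comm; auto.
        -- apply HV, cube_upd; auto.
Qed.

Lemma nice_ExL l f : nice f -> nice (ExL l f).
Proof. intros H. induction l; simpl; auto using nice_I1. Qed.

Lemma I1_plus a f g z : nice f -> nice g -> cube z ->
  I1 a (fun z => f z + g z) z = I1 a f z + I1 a g z.
Proof.
  intros Hf Hg Hz.
  apply (RInt_plus (V := R_CompleteNormedModule) (fun t => f (upd z a t)) (fun t => g (upd z a t)));
    apply nice_slice; auto.
Qed.

Lemma I1_mult_indep a f g z : nice g -> cube z -> indep a f ->
  I1 a (fun z => f z * g z) z = f z * I1 a g z.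
Proof.
  intros Hg Hz Hi. unfold I1.
  rewrite (RInt_ext _ (fun t => f z * g (upd z a t))).
  - apply (RInt_scal (V := R_CompleteNormedModule) (fun t => g (upd z a t))). apply nice_slice; auto.
  - rewrite Rmin_left, Rmax_right by lra. intros t Ht. rewrite Hi; auto; lra.
Qed.

Lemma I1_indep a f z : cube z -> indep a f -> I1 a f z = f z.
Proof.
  intros Hz Hi. unfold I1. rewrite (RInt_ext _ (fun _ => f z)).
  - rewrite RInt_const. unfold scal; simpl; unfold mult; simpl. ring.
  - rewrite Rmin_left, Rmax_right by lra. intros t Ht. rewrite Hi; auto; lra.
Qed.

Lemma I1_comm a b f z : nice f -> cube z -> I1 a (I1 b f) z = I1 b (I1 a f) z.
Proof.
  intros (V & HV) Hz. destruct (Nat.eq_dec a b) as [->|N]; auto.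
  unfold I1. rewrite (bv_Fubini V (fun s t => f (upd (upd z a s) b t))).
  - apply RInt_ext. intros t _. apply RInt_ext. intros s _. rewrite upd_comm; auto.
  - intros s Hs. apply HV, cube_upd; auto.
  - intros t Ht. apply bv_ext with (fun s => f (upd (upd z b t) a s)).
    + intros. rewrite upd_comm; auto.
    + apply HV, cube_upd; auto.
Qed.

Lemma ExL_perm l l' f z : Permutation l l' -> nice f -> cube z -> ExL l f z = ExL l' f z.
Proof.
  intros P Hf. revert z. induction P; intros z Hz; simpl; auto.
  - apply I1_ext; auto.
  - apply I1_comm; auto. apply nice_ExL; auto.
  - rewrite IHP1, IHP2; auto.
Qed.

Lemma ExL_app l l' f : ExL (l ++ l') f = ExL l (ExL l' f).
Proof. unfold ExL. apply fold_right_app. Qed.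

Lemma indep_I1 a b f : indep a f -> indep a (I1 b f).
Proof.
  intros H z t Hz Ht. apply RInt_ext. rewrite Rmin_left, Rmax_right by lra. intros s Hs.
  destruct (Nat.eq_dec a b) as [->|N].
  - rewrite upd_same; auto.
  - rewrite upd_comm by auto. apply H; auto. apply cube_upd; auto; lra.
Qed.

Lemma indep_ExL a l f : indep a f -> indep a (ExL l f).
Proof. intros H. induction l; simpl; auto using indep_I1. Qed.

Lemma indep_lprod {A} a (f : A -> (nat -> R) -> R) l :
  (forall i, In i l -> indep a (f i)) -> indep a (fun z => lprod (fun i => f i z) l).
Proof. intros H z t Hz Ht. apply lprod_ext. intros i Hi. apply H; auto. Qed.

Lemma ExL_indep l f z : cube z -> (forall a, In a l -> indep a f) -> ExL l f z = f z.
Proof.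
  revert z. induction l as [|a l IH]; intros z Hz H; simpl; auto.
  rewrite (I1_ext a (ExL l f) f) by (auto; intros; apply IH; auto; intros; apply H; simpl; auto).
  apply I1_indep; auto. apply H; simpl; auto.
Qed.

Lemma ExL_plus l f g z : nice f -> nice g -> cube z ->
  ExL l (fun z => f z + g z) z = ExL l f z + ExL l g z.
Proof.
  intros Hf Hg. revert z. induction l as [|a l IH]; intros z Hz; simpl; auto.
  rewrite (I1_ext a _ (fun z => ExL l f z + ExL l g z)) by auto.
  apply I1_plus; auto using nice_ExL.
Qed.

Lemma ExL_mult_indep l f g z : nice g -> cube z -> (forall a, In a l -> indep a f) ->
  ExL l (fun z => f z * g z) z = f z * ExL l g z.
Proof.
  intros Hg. revert z. induction l as [|a l IH]; intros z Hz Hi; simpl; auto.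
  rewrite (I1_ext a _ (fun z => f z * ExL l g z)).
  - apply I1_mult_indep; auto using nice_ExL. apply Hi; simpl; auto.
  - auto.
  - intros; apply IH; auto. intros; apply Hi; simpl; auto.
Qed.

Lemma ExL_scal l c f z : nice f -> cube z -> ExL l (fun z => c * f z) z = c * ExL l f z.
Proof.
  intros Hf Hz. apply (ExL_mult_indep l (fun _ => c) f z Hf Hz).
  intros a _ y t _ _. reflexivity.
Qed.

Lemma ExL_const l c z : cube z -> ExL l (fun _ => c) z = c.
Proof. intros Hz. apply (ExL_indep l (fun _ => c)); auto. intros a _ y t _ _. reflexivity. Qed.

Lemma ExL_lsum {A} l (f : A -> (nat -> R) -> R) m z : (forall i, In i m -> nice (f i)) -> cube z ->
  ExL l (fun z => lsum (fun i => f i z) m) z = lsum (fun i => ExL l (f i) z) m.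
Proof.
  intros Hf Hz. induction m as [|i m IH]; simpl.
  - apply ExL_const; auto.
  - rewrite ExL_plus; auto.
    + rewrite IH; auto. intros; apply Hf; simpl; auto.
    + apply Hf; simpl; auto.
    + apply nice_lsum. intros; apply Hf; simpl; auto.
Qed.

(** The product rule for independent factors: block [B i] is integrated out of [f i], and no other
    factor sees it. Coordinates outside all blocks may be shared by every factor, so this also
    expresses conditional independence. *)
Lemma ExL_flat_map_lprod {A} (B : A -> list nat) (f : A -> (nat -> R) -> R) (is : list A) z :
  NoDup is -> cube z -> (forall i, In i is -> nice (f i)) ->
  (forall i j, In i is -> In j is -> i <> j -> forall a, In a (B j) -> indep a (f i)) ->
  ExL (flat_map B is) (fun z => lprod (fun i => f i z) is) z = lprod (fun i => ExL (B i) (f i) z) is.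
Proof.
  intros ND. revert z. induction is as [|i is IH]; intros z Hz Hn Hi; simpl; auto.
  inversion ND as [|? ? Hni ND']; subst.
  rewrite ExL_app.
  rewrite (ExL_ext (B i) _ (fun z => lprod (fun j => ExL (B j) (f j) z) is * f i z)); auto.
  - rewrite ExL_mult_indep; auto.
    + ring.
    + apply Hn; simpl; auto.
    + intros a Ha. apply indep_lprod. intros j Hj. apply indep_ExL.
      apply (Hi j i); simpl; auto. congruence.
  - intros y Hy. rewrite ExL_mult_indep; auto.
    + rewrite IH; auto.
      * ring.
      * intros; apply Hn; simpl; auto.
      * intros j k Hj Hk; apply Hi; simpl; auto.
    + apply nice_lprod. intros; apply Hn; simpl; auto.
    + intros a Ha. apply in_flat_map in Ha. destruct Ha as (j & Hj & Ha).
      apply (Hi i j); simpl; auto. congruence.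
Qed.

Lemma ExL_upd l k f x z : ~ In k l -> 
  ExL l (fun z => f (upd z k x)) z = ExL l f (upd z k x).
Proof.
  revert z. induction l as [|a l IH]; intros z H; simpl; auto.
  apply RInt_ext. intros t _. rewrite IH.
  - rewrite upd_comm; auto. intros ->. apply H; simpl; auto.
  - intros Hk. apply H; simpl; auto.
Qed.

(** [iint] fixes its highest coordinate first, so that coordinate is the outermost integral, whence
    the reversed list. The base point [0] is the one at which [iint] evaluates when no variable is
    left. *)
Lemma iint_ExL k F : nice F -> iint k F (ExL (rev (seq 0 k)) F (fun _ => 0)).
Proof.
  revert F. induction k as [|k IH]; intros F HF.
  - reflexivity.
  - rewrite seq_snoc, rev_app_distr. simpl.
    exists (fun x => ExL (rev (seq 0 k)) F (upd (fun _ => 0) k x)). split.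
    + intros x Hx. rewrite <- ExL_upd.
      * apply IH, nice_upd; auto.
      * rewrite <- in_rev, in_seq. lia.
    + assert (E : ex_RInt (fun x => ExL (rev (seq 0 k)) F (upd (fun _ => 0) k x)) 0 1).
      { apply nice_slice; [apply nice_ExL; auto | apply cube_0]. }
      exists (ex_RInt_Reals_0 _ _ _ E). rewrite <- RInt_Reals. reflexivity.
Qed.

Lemma iint_unique k F v w : iint k F v -> iint k F w -> v = w.
Proof.
  revert F v w. induction k as [|k IH]; simpl; intros F v w.
  - congruence.
  - intros (g & Hg & prg & Eg) (h & Hh & prh & Eh). subst.
    rewrite <- !RInt_Reals. apply RInt_ext. rewrite Rmin_left, Rmax_right by lra.
    intros x Hx. apply (IH (fun z => F (upd z k x))); [apply Hg | apply Hh]; lra.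
Qed.

Lemma epsilon_iint k F : nice F -> epsilon (inhabits 0) (iint k F) = ExL (rev (seq 0 k)) F (fun _ => 0).
Proof.
  intros HF. apply iint_unique with k F.
  - apply epsilon_spec. eexists. apply iint_ExL; auto.
  - apply iint_ExL; auto.
Qed.

(** * Indicator functions *)

Definition indic (P : Prop) : R := if excluded_middle_informative P then 1 else 0.

Lemma indic_true (P : Prop) : P -> indic P = 1.
Proof. intros H. unfold indic. destruct excluded_middle_informative; tauto. Qed.

Lemma indic_false (P : Prop) : ~ P -> indic P = 0.
Proof. intros H. unfold indic. destruct excluded_middle_informative; tauto. Qed.

Lemma indic_range P : 0 <= indic P <= 1.
Proof. unfold indic. destruct excluded_middle_informative; lra. Qed.

Lemma indic_iff (P Q : Prop) : (P <-> Q) -> indic P = indic Q.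
Proof. intros H. replace Q with P; auto. apply propositional_extensionality; auto. Qed.

Lemma indic_le (P Q : Prop) : (P -> Q) -> indic P <= indic Q.
Proof. intros H. unfold indic. destruct excluded_middle_informative, excluded_middle_informative; try lra; tauto. Qed.

Lemma indic_and (P Q : Prop) : indic (P /\ Q) = indic P * indic Q.
Proof. unfold indic. repeat destruct excluded_middle_informative; try lra; tauto. Qed.

Lemma indic_not (P : Prop) : indic (~ P) = 1 + (-1) * indic P.
Proof. unfold indic. repeat destruct excluded_middle_informative; try lra; tauto. Qed.

Lemma indic_forall {A} (P : A -> Prop) l : indic (forall i, In i l -> P i) = lprod (fun i => indic (P i)) l.
Proof.
  induction l as [|a l IH]; simpl.
  - apply indic_true. tauto.
  - rewrite <- IH, <- indic_and. apply indic_iff. split.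
    + intros H. split; auto.
    + intros [H1 H2] i [->|Hi]; auto.
Qed.

Definition niceP (P : (nat -> R) -> Prop) : Prop := nice (fun z => indic (P z)).

Lemma niceP_iff (P Q : (nat -> R) -> Prop) : (forall z, P z <-> Q z) -> niceP P -> niceP Q.
Proof. intros H. apply nice_ext. intros; apply indic_iff; auto. Qed.

Lemma niceP_const (P : Prop) : niceP (fun _ => P).
Proof. exact (nice_const (indic P)). Qed.

Lemma niceP_and P Q : niceP P -> niceP Q -> niceP (fun z => P z /\ Q z).
Proof.
  intros HP HQ. apply nice_ext with (fun z => indic (P z) * indic (Q z)).
  - intros; symmetry; apply indic_and.
  - apply nice_mult; auto.
Qed.

Lemma niceP_not P : niceP P -> niceP (fun z => ~ P z).
Proof.
  intros HP. apply nice_ext with (fun z => 1 + (-1) * indic (P z)).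
  - intros; symmetry; apply indic_not.
  - apply nice_plus; [apply nice_const|]. apply nice_mult; auto. apply nice_const.
Qed.

Lemma niceP_or P Q : niceP P -> niceP Q -> niceP (fun z => P z \/ Q z).
Proof.
  intros HP HQ. apply niceP_iff with (fun z => ~ (~ P z /\ ~ Q z)).
  - intros z. tauto.
  - auto using niceP_not, niceP_and.
Qed.

Lemma niceP_forall {A} (P : A -> (nat -> R) -> Prop) l :
  (forall i, In i l -> niceP (P i)) -> niceP (fun z => forall i, In i l -> P i z).
Proof.
  intros H. apply nice_ext with (fun z => lprod (fun i => indic (P i z)) l).
  - intros; symmetry; apply indic_forall.
  - apply nice_lprod; auto.
Qed.

Lemma niceP_exists {A} (P : A -> (nat -> R) -> Prop) l :
  (forall i, In i l -> niceP (P i)) -> niceP (fun z => exists i, In i l /\ P i z).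
Proof.
  intros H. apply niceP_iff with (fun z => ~ (forall i, In i l -> ~ P i z)).
  - intros z. split.
    + intros N. destruct (classic (exists i, In i l /\ P i z)); auto.
      exfalso; apply N. intros i Hi Hp. eauto.
    + intros (i & Hi & Hp) N. apply (N i); auto.
  - apply niceP_not, niceP_forall. intros. apply niceP_not; auto.
Qed.

(** Along a coordinate line such a function is the parameter itself or a constant, so the comparison
    of two of them changes its truth value at most once. *)
Definition is_term (tau : (nat -> R) -> R) : Prop :=
  (exists a, tau = fun z => z a) \/ (exists c, tau = fun _ => c).

Lemma is_term_slice tau z a : is_term tau ->
  (forall t, tau (upd z a t) = t) \/ exists c, forall t, tau (upd z a t) = c.
Proof.
  intros [(b & ->)|(c & ->)].
  - destruct (Nat.eq_dec b a) as [->|N].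
    + left. intros. apply upd_eq.
    + right. exists (z b). intros. apply upd_neq; auto.
  - right. eauto.
Qed.

(** Each slice of the indicator is nondecreasing, except when the moving coordinate is on the left
    of a constant; there the complementary indicator is nondecreasing. *)
Lemma niceP_lt t1 t2 : is_term t1 -> is_term t2 -> niceP (fun z => t1 z < t2 z).
Proof.
  intros H1 H2. exists 1. intros z Hz. split.
  - pose proof (indic_range (t1 z < t2 z)). rewrite Rabs_pos_eq; lra.
  - intros a.
    destruct (is_term_slice t1 z a H1) as [E1|[c1 E1]], (is_term_slice t2 z a H2) as [E2|[c2 E2]].
    + apply bv_mono; [|intros; apply indic_range].
      intros s t _ _ _. apply indic_le. rewrite !E1, !E2. lra.
    + apply bv_ext with (fun t => 1 + (-1) * indic (~ t < c2)).
      * intros. rewrite E1, E2, indic_not. ring.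
      * apply bv_le with (0 + (1 * 0 + 1 * 1)); [lra|]. apply bv_plus; [apply bv_const|].
        apply bv_mult; [apply bv_const| | |].
        -- apply bv_mono; [|intros; apply indic_range]. intros s t _ Hst _. apply indic_le. lra.
        -- intros. rewrite Rabs_left; lra.
        -- intros. pose proof (indic_range (~ t < c2)). rewrite Rabs_pos_eq; lra.
    + apply bv_mono; [|intros; apply indic_range].
      intros s t _ Hst _. apply indic_le. rewrite !E1, !E2. lra.
    + apply bv_mono; [|intros; apply indic_range].
      intros s t _ _ _. apply indic_le. rewrite !E1, !E2. lra.
Qed.

Lemma niceP_le t1 t2 : is_term t1 -> is_term t2 -> niceP (fun z => t1 z <= t2 z).
Proof.
  intros H1 H2. apply niceP_iff with (fun z => ~ (t2 z < t1 z)).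
  - intros; lra.
  - apply niceP_not, niceP_lt; auto.
Qed.

Lemma niceP_eq t1 t2 : is_term t1 -> is_term t2 -> niceP (fun z => t1 z = t2 z).
Proof.
  intros H1 H2. apply niceP_iff with (fun z => t1 z <= t2 z /\ t2 z <= t1 z).
  - intros; lra.
  - apply niceP_and; apply niceP_le; auto.
Qed.

(** * Ties are negligible *)

Lemma is_RInt_finite_support (h : R -> R) (l : list R) a b : a <= b ->
  (forall t, a < t < b -> ~ In t l -> h t = 0) -> is_RInt h a b 0.
Proof.
  revert a b. induction l as [|p l IH]; intros a b Hab H.
  - apply is_RInt_ext with (fun _ => 0).
    + rewrite Rmin_left, Rmax_right by lra. intros; symmetry; apply H; auto.
    + pose proof (is_RInt_cst a b 0) as I. rewrite Rmult_0_r in I. exact I.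
  - destruct (Rlt_dec a p), (Rlt_dec p b).
    + replace 0 with (0 + 0) by ring.
      apply is_RInt_glue with h h p; auto; try lra; apply IH; try lra; intros t Ht Hl;
        apply H; try lra; intros [E|E]; auto; lra.
    + apply IH; auto. intros t Ht Hl. apply H; auto. intros [E|E]; auto; lra.
    + apply IH; auto. intros t Ht Hl. apply H; auto. intros [E|E]; auto; lra.
    + apply IH; auto. intros t Ht Hl. apply H; auto. intros [E|E]; auto; lra.
Qed.

Lemma RInt_ext_finite (f g : R -> R) (l : list R) a b : a <= b -> ex_RInt f a b -> ex_RInt g a b ->
  (forall t, a < t < b -> ~ In t l -> f t = g t) -> RInt f a b = RInt g a b.
Proof.
  intros Hab Hf Hg H. apply Rminus_diag_uniq.
  change (minus (RInt f a b) (RInt g a b) = 0). rewrite <- (RInt_minus (V := R_CompleteNormedModule)) by auto.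
  apply is_RInt_unique. apply is_RInt_finite_support with l; auto.
  intros t Ht Hl. rewrite H; auto. apply Rminus_diag.
Qed.

(** The values [0] and [1] are excluded together with ties: [0] is the value of the unselected
    coordinates of a candidate point, and [1] is missing from the half-open cube. *)
Definition generic (D : list nat) (z : nat -> R) : Prop :=
  (forall a, In a D -> z a <> 0 /\ z a <> 1) /\
  (forall a b, In a D -> In b D -> a <> b -> z a <> z b).

(** This stands in for the fact that ties form a null set. [D] collects the variables already fixed
    by outer integrals; the next variable has to avoid only [0], [1] and the finitely many values on
    [D], and finitely many points do not affect its integral. *)
Lemma ExL_ext_generic l D f g z : nice f -> nice g -> cube z -> NoDup (l ++ D) -> generic D z ->
  (forall z, cube z -> generic (l ++ D) z -> f z = g z) -> ExL l f z = ExL l g z.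
Proof.
  intros Hf Hg. revert D z. induction l as [|a l IH]; intros D z Hz ND HD E; simpl; auto.
  assert (P : Permutation (l ++ a :: D) ((a :: l) ++ D)) by (symmetry; apply Permutation_middle).
  apply RInt_ext_finite with (0 :: 1 :: map z D); [lra| | |].
  - apply nice_slice; auto using nice_ExL.
  - apply nice_slice; auto using nice_ExL.
  - intros t Ht Hl. apply (IH (a :: D)).
    + apply cube_upd; auto; lra.
    + eapply Permutation_NoDup; [symmetry; exact P | exact ND].
    + assert (Ha : ~ In a D).
      { inversion ND; subst. intros Ha. match goal with H : ~ In a _ |- _ => apply H end. apply in_or_app; auto. }
      assert (HU : forall b, In b D -> upd z a t b = z b) by (intros b Hb; apply upd_neq; congruence).
      assert (HM : forall b, In b D -> z b <> t).
      { intros b Hb Eb. apply Hl. right; right. rewrite <- Eb. apply in_map; auto. }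
      destruct HD as [G1 G2]. split.
      * intros b [<-|Hb].
        -- rewrite upd_eq. simpl in Hl. split; intros ->; tauto.
        -- rewrite HU; auto.
      * intros b c [<-|Hb] [<-|Hc] N; try congruence.
        -- rewrite upd_eq, HU; auto. intros Ec. apply (HM c); auto.
        -- rewrite upd_eq, HU; auto.
        -- rewrite !HU; auto.
    + intros y Hy [G1 G2]. apply E; auto.
      split; [intros b Hb; apply G1 | intros b c Hb Hc; apply G2];
        eapply Permutation_in; try eassumption; symmetry; exact P.
Qed.

(** * Generators in terms of coordinate comparisons *)

(** Provides the room by which a coordinate can be lowered without passing any observed value below
    it. *)
Lemma exists_max_below (u : nat -> R) (x : R) n : 0 < x ->
  exists y, 0 <= y < x /\ forall i, (i < n)%nat -> u i < x -> u i <= y.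
Proof.
  intros Hx. induction n as [|n (y & Hy & IH)].
  - exists 0. split; [lra|]. lia.
  - destruct (Rlt_dec (u n) x) as [L|L].
    + exists (Rmax y (u n)). split.
      * split; [eapply Rle_trans; [apply Hy | apply Rmax_l] | apply Rmax_lub_lt; lra].
      * intros i Hi Hu. destruct (Nat.eq_dec i n) as [->|N]; [apply Rmax_r|].
        eapply Rle_trans; [apply IH; auto; lia | apply Rmax_l].
    + exists y. split; auto. intros i Hi Hu. apply IH; auto.
      destruct (Nat.eq_dec i n) as [->|N]; [lra | lia].
Qed.

Lemma is_generator_iff d n X x :
  is_generator d n X x <->
  in_S d n X x /\ forall j, (j < d)%nat -> x j = 0 \/
    exists i, (i < n)%nat /\ X i j = x j /\ forall l, (l < d)%nat -> l <> j -> x l < X i l.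
Proof.
  split.
  - intros [HS Hmin]. split; auto. intros j Hj. apply NNPP. intros N.
    destruct HS as (Hpt & Hr & Hs). pose proof (Hr j Hj).
    assert (Hx : 0 < x j) by (destruct (Rle_lt_or_eq_dec 0 (x j)); auto; try lra; exfalso; apply N; auto).
    destruct (exists_max_below (fun i => X i j) (x j) n Hx) as (y & Hy & Hmax).
    (* Lowering coordinate [j] to [y] leaves the point in the region: an observation exceeding the
       new point would exceed [x] itself or would have [X i j = x j], the case denied by [N].
       Minimality then forces [y = x j], although [y < x j]. *)
    assert (E : upd x j y = x).
    { apply Hmin.
      - split; [|split].
        + intros l Hl. rewrite upd_neq by lia. auto.
        + intros l Hl. destruct (Nat.eq_dec l j) as [->|D]; [rewrite upd_eq; lra | rewrite upd_neq; auto].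
        + intros i Hi Hp. apply N. right. exists i. split; auto.
          assert (HL : forall l, (l < d)%nat -> l <> j -> x l < X i l).
          { intros l Hl D. specialize (Hp l Hl). rewrite upd_neq in Hp; auto. }
          split; auto. specialize (Hp j Hj). rewrite upd_eq in Hp.
          destruct (Rtotal_order (X i j) (x j)) as [L|[L|L]]; auto.
          * specialize (Hmax i Hi L). lra.
          * exfalso. apply (Hs i Hi). intros l Hl. destruct (Nat.eq_dec l j) as [->|D]; auto.
      - intros l Hl. destruct (Nat.eq_dec l j) as [->|D]; [rewrite upd_eq; lra | rewrite upd_neq; auto; lra]. }
    assert (E' : upd x j y j = x j) by (rewrite E; auto). rewrite upd_eq in E'. lra.
  - intros [HS H]. split; auto. intros y Hy Hle. extensionality j.
    destruct (le_lt_dec d j) as [D|D].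
    + rewrite (proj1 HS), (proj1 Hy); auto.
    + apply NNPP. intros N. pose proof (Hle j D). destruct Hy as (_ & Hyr & Hys). pose proof (Hyr j D).
      destruct (H j D) as [E|(i & Hi & E & Hl)]; [lra|].
      apply (Hys i Hi). intros l Hld. destruct (Nat.eq_dec l j) as [->|M]; [lra|].
      pose proof (Hl l Hld M). pose proof (Hle l Hld). lra.
Qed.

(* A tuple of length [d] with entries [<= n] encodes a candidate generator:
   entry [i < n] in position [l] stands for the coordinate [X^(i)_l], entry [n] for [0]. *)
Fixpoint tuples (n d : nat) : list (list nat) :=
  match d with
  | O => [[]]
  | S d' => flat_map (fun o => map (cons o) (tuples n d')) (seq 0 (S n))
  end.

Lemma in_tuples n d c : In c (tuples n d) <-> length c = d /\ forall o, In o c -> (o <= n)%nat.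
Proof.
  revert c. induction d as [|d IH]; intros c; cbn [tuples].
  - simpl. split.
    + intros [<-|[]]. simpl. tauto.
    + intros [H _]. destruct c; [auto | discriminate].
  - rewrite in_flat_map. split.
    + intros (o & Ho & Hc). apply in_map_iff in Hc. destruct Hc as (c' & <- & Hc').
      apply IH in Hc'. apply in_seq in Ho. simpl. split; [lia|].
      intros p [<-|Hp]; [lia | apply Hc'; auto].
    + intros [H1 H2]. destruct c as [|o c]; [discriminate|]. exists o. split.
      * apply in_seq. pose proof (H2 o). simpl in *. lia.
      * apply in_map. apply IH. simpl in *. split; [lia|]. intros; apply H2; auto.
Qed.

Lemma NoDup_flat_map {A B} (f : A -> list B) l : NoDup l -> (forall a, In a l -> NoDup (f a)) ->
  (forall a a' b, In a l -> In a' l -> In b (f a) -> In b (f a') -> a = a') -> NoDup (flat_map f l).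
Proof.
  induction l as [|a l IH]; intros ND H1 H2; simpl; [constructor|].
  inversion ND; subst. apply NoDup_app.
  - apply H1; simpl; auto.
  - apply IH; auto; [intros; apply H1; simpl; auto|].
    intros x y b Hx Hy. apply H2; simpl; auto.
  - intros b Hb Hb'. apply in_flat_map in Hb'. destruct Hb' as (a' & Ha' & Hb').
    assert (a = a') by (apply (H2 a a' b); simpl; auto). congruence.
Qed.

Lemma NoDup_tuples n d : NoDup (tuples n d).
Proof.
  induction d as [|d IH]; cbn [tuples].
  - repeat constructor. auto.
  - apply NoDup_flat_map.
    + apply seq_NoDup.
    + intros o _. apply FinFun.Injective_map_NoDup; auto. intros x y E. congruence.
    + intros a a' b _ _ Ha Ha'. apply in_map_iff in Ha. apply in_map_iff in Ha'.
      destruct Ha as (x & <- & _), Ha' as (y & E & _). congruence.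
Qed.

Section Generators.

Variables d n : nat.

Definition cval (i l : nat) (z : nat -> R) : R := if (i <? n)%nat then z (i * d + l)%nat else 0.

Definition tval (c : list nat) (l : nat) (z : nat -> R) : R := cval (nth l c n) l z.

Definition sample (z : nat -> R) (i j : nat) : R := if (j <? d)%nat then z (i * d + j)%nat else 0.

Definition point (c : list nat) (z : nat -> R) (l : nat) : R := if (l <? d)%nat then tval c l z else 0.

(* When several coordinates tie, only the least index describing each value is retained. *)
Definition canonical (c : list nat) (z : nat -> R) : Prop :=
  forall l, In l (seq 0 d) -> forall i, In i (seq 0 (nth l c n)) -> ~ cval i l z = tval c l z.

(** The characterization of generators with all quantifiers ranging over finite lists and all atoms
    being comparisons of terms, so that the closure rules of [niceP] apply directly. *)
Definition gen_at (c : list nat) (z : nat -> R) : Prop :=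
  (forall l, In l (seq 0 d) -> tval c l z < 1) /\
  (forall i, In i (seq 0 n) -> ~ forall l, In l (seq 0 d) -> tval c l z < cval i l z) /\
  (forall j, In j (seq 0 d) -> tval c j z = 0 \/
     exists i, In i (seq 0 n) /\ (cval i j z = tval c j z /\
       forall l, In l (seq 0 d) -> (l = j) \/ tval c l z < cval i l z)).

Lemma is_term_cval i l : is_term (cval i l).
Proof. unfold cval. destruct (i <? n)%nat; [left | right]; eexists; reflexivity. Qed.

Lemma is_term_tval c l : is_term (tval c l).
Proof. apply is_term_cval. Qed.

Lemma is_term_cst c : is_term (fun _ => c).
Proof. right. eauto. Qed.

Lemma niceP_canonical_gen c : niceP (fun z => canonical c z /\ gen_at c z).
Proof.
  pose proof is_term_cval. pose proof (is_term_tval c). pose proof is_term_cst.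
  apply niceP_and; [|apply niceP_and; [|apply niceP_and]].
  - apply niceP_forall; intros l _. apply niceP_forall; intros i _. apply niceP_not, niceP_eq; auto.
  - apply niceP_forall; intros l _. apply (niceP_lt (tval c l) (fun _ => 1)); auto.
  - apply niceP_forall; intros i _. apply niceP_not, niceP_forall. intros l _. apply niceP_lt; auto.
  - apply niceP_forall; intros j _. apply niceP_or.
    + apply (niceP_eq (tval c j) (fun _ => 0)); auto.
    + apply niceP_exists. intros i _. apply niceP_and; [apply niceP_eq; auto|].
      apply niceP_forall; intros l _. apply niceP_or; [apply niceP_const | apply niceP_lt; auto].
Qed.

Lemma tval_range c l z : cube z -> 0 <= tval c l z <= 1.
Proof. intros Hz. unfold tval, cval. destruct (_ <? n)%nat; [apply Hz | lra]. Qed.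

Lemma sample_cval z i j : (i < n)%nat -> (j < d)%nat -> sample z i j = cval i j z.
Proof.
  intros Hi Hj. unfold sample, cval. apply Nat.ltb_lt in Hi, Hj. rewrite Hi, Hj. auto.
Qed.

Lemma point_tval c z l : (l < d)%nat -> point c z l = tval c l z.
Proof. intros Hl. unfold point. apply Nat.ltb_lt in Hl. rewrite Hl. auto. Qed.

Lemma generator_gen_at c z : cube z -> is_generator d n (sample z) (point c z) <-> gen_at c z.
Proof.
  intros Hz. rewrite is_generator_iff. split.
  - intros [(_ & Hr & Hs) Hg]. split; [|split].
    + intros l Hl. apply in_seq in Hl. rewrite <- point_tval by lia. apply Hr; lia.
    + intros i Hi N. apply in_seq in Hi. apply (Hs i); [lia|]. intros l Hl.
      rewrite point_tval, sample_cval by lia. apply N, in_seq. lia.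
    + intros j Hj. apply in_seq in Hj. destruct (Hg j) as [E|(i & Hi & E & HL)]; [lia| |].
      * left. rewrite <- point_tval by lia. auto.
      * right. exists i. rewrite in_seq. split; [lia|].
        rewrite point_tval, sample_cval in E by lia. split; auto.
        intros l Hl. apply in_seq in Hl. destruct (Nat.eq_dec l j); auto. right.
        rewrite <- point_tval, <- sample_cval by lia. apply HL; auto; lia.
  - intros (H1 & H2 & H3). split; [split; [|split]|].
    + intros j Hj. unfold point. apply Nat.ltb_ge in Hj. rewrite Hj. auto.
    + intros j Hj. rewrite point_tval by lia. split; [apply tval_range; auto | apply H1, in_seq; lia].
    + intros i Hi N. apply (H2 i); [apply in_seq; lia|]. intros l Hl. apply in_seq in Hl.
      rewrite <- point_tval, <- sample_cval by lia. apply N; lia.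
    + intros j Hj. rewrite point_tval by lia.
      destruct (H3 j) as [E|(i & Hi & E & HL)]; [apply in_seq; lia|auto|].
      right. apply in_seq in Hi. exists i. split; [lia|]. rewrite sample_cval by lia. split; auto.
      intros l Hl N. rewrite point_tval, sample_cval by lia.
      destruct (HL l); [apply in_seq; lia | congruence | auto].
Qed.

Lemma canonical_inj c c' z : In c (tuples n d) -> In c' (tuples n d) ->
  canonical c z -> canonical c' z -> point c z = point c' z -> c = c'.
Proof.
  intros Hc Hc' C C' E. apply in_tuples in Hc, Hc'. destruct Hc as [L _], Hc' as [L' _].
  apply nth_ext with n n; [congruence|]. intros l Hl. rewrite L in Hl.
  assert (T : tval c l z = tval c' l z).
  { rewrite <- !point_tval by auto. rewrite E. auto. }
  assert (Hs : In l (seq 0 d)) by (apply in_seq; lia).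
  destruct (Nat.lt_trichotomy (nth l c n) (nth l c' n)) as [D|[D|D]]; auto; exfalso.
  - apply (C' l Hs (nth l c n)); [apply in_seq; lia | exact T].
  - apply (C l Hs (nth l c' n)); [apply in_seq; lia | symmetry; exact T].
Qed.

Lemma least_index (P : nat -> Prop) m : P m -> exists i, (i <= m)%nat /\ P i /\ forall j, (j < i)%nat -> ~ P j.
Proof.
  induction m as [m IH] using lt_wf_ind. intros Hm.
  destruct (classic (exists j, (j < m)%nat /\ P j)) as [(j & Hj & Pj)|N].
  - destruct (IH j Hj Pj) as (i & Hi & H1 & H2). exists i. split; [lia | auto].
  - exists m. split; auto. split; auto. intros j Hj Pj. apply N; eauto.
Qed.

(** Every coordinate of a generator is an observed value or [0], the latter being coded by index
    [n]; taking the least index with the right value at each position gives a canonical tuple. *)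
Lemma generator_canonical z x : cube z -> is_generator d n (sample z) x ->
  exists c, In c (tuples n d) /\ canonical c z /\ x = point c z.
Proof.
  intros Hz Hx. apply is_generator_iff in Hx. destruct Hx as [HS Hx].
  assert (H : forall l, exists i, (l < d)%nat -> (i <= n)%nat /\ cval i l z = x l /\
     forall j, (j < i)%nat -> cval j l z <> x l).
  { intros l. destruct (le_lt_dec d l) as [D|D]; [exists 0%nat; lia|].
    assert (Hm : exists m, (m <= n)%nat /\ cval m l z = x l).
    { destruct (Hx l D) as [E|(i & Hi & E & _)].
      - exists n. split; auto. unfold cval. rewrite Nat.ltb_irrefl. auto.
      - exists i. split; [lia|]. rewrite <- sample_cval; auto. }
    destruct Hm as (m & Hm & Em).
    destruct (least_index (fun i => cval i l z = x l) m Em) as (i & Hi & H1 & H2).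
    exists i. intros _. split; [lia | auto]. }
  apply choice in H. destruct H as [f Hf].
  set (c := map f (seq 0 d)).
  assert (Hn : forall l, (l < d)%nat -> nth l c n = f l).
  { intros l Hl. unfold c. rewrite (nth_indep _ n (f 0%nat)) by (rewrite length_map, length_seq; auto).
    rewrite map_nth, seq_nth; auto. }
  exists c. split; [|split].
  - apply in_tuples. unfold c. rewrite length_map, length_seq. split; auto.
    intros o Ho. apply in_map_iff in Ho. destruct Ho as (l & <- & Hl). apply in_seq in Hl. apply Hf; lia.
  - intros l Hl i Hi. apply in_seq in Hl. rewrite Hn in Hi by lia. apply in_seq in Hi.
    destruct (Hf l) as (_ & E & HL); [lia|]. unfold tval. rewrite Hn, E by lia. apply HL; lia.
  - extensionality l. unfold point. destruct (Nat.ltb_spec l d) as [D|D].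
    + unfold tval. rewrite Hn by auto. symmetry. apply Hf; auto.
    + apply HS; auto.
Qed.

(** * The number of generators as a finite sum of indicators *)

Lemma lsum_indic {A} (P : A -> Prop) l :
  lsum (fun a => indic (P a)) l =
  INR (length (List.filter (fun a => if excluded_middle_informative (P a) then true else false) l)).
Proof.
  induction l as [|a l IH]; [reflexivity|]. cbn [lsum List.filter]. rewrite IH. unfold indic.
  destruct (excluded_middle_informative (P a)); cbn [length]; [rewrite S_INR|]; ring.
Qed.

Lemma gen_count_eq z : cube z ->
  INR (gen_count d n (sample z)) = lsum (fun c => indic (canonical c z /\ gen_at c z)) (tuples n d).
Proof.
  intros Hz. rewrite lsum_indic. f_equal.
  set (F := List.filter _ _). set (L := map (fun c => point c z) F).
  assert (HF : forall c, In c F <-> In c (tuples n d) /\ canonical c z /\ gen_at c z).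
  { intros c. unfold F. rewrite filter_In. destruct excluded_middle_informative; intuition congruence. }
  assert (ND : NoDup L).
  { apply NoDup_map_NoDup_ForallPairs.
    - intros a b Ha Hb E. apply HF in Ha, Hb. apply canonical_inj with z; tauto.
    - apply NoDup_filter, NoDup_tuples. }
  assert (HL : forall x, In x L <-> is_generator d n (sample z) x).
  { intros x. unfold L. rewrite in_map_iff. split.
    - intros (c & <- & Hc). apply HF in Hc. apply generator_gen_at; tauto.
    - intros Hx. destruct (generator_canonical z x Hz Hx) as (c & H1 & H2 & ->).
      exists c. split; auto. apply HF. split; auto. split; auto. apply generator_gen_at; auto. }
  (* The list [L] shows that a cardinality exists, so [epsilon] returns the length of some
     duplicate-free enumeration; any two such enumerations are permutations of each other. *)
  assert (E : exists l : list (nat -> R), NoDup l /\ length l = gen_count d n (sample z) /\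
     (forall x, In x l <-> is_generator d n (sample z) x)).
  { unfold gen_count. apply epsilon_spec. exists (length L), L. auto. }
  destruct E as (l & H1 & <- & H3).
  rewrite <- (length_map (fun c => point c z) F). apply Permutation_length, NoDup_Permutation; auto.
  intros x. rewrite H3. symmetry. apply HL.
Qed.

Definition coords : list nat := rev (seq 0 (d * n)).

Lemma Gdn_lsum : Gdn d n =
  lsum (fun c => ExL coords (fun z => indic (canonical c z /\ gen_at c z)) (fun _ => 0)) (tuples n d).
Proof.
  assert (N : nice (fun z => lsum (fun c => indic (canonical c z /\ gen_at c z)) (tuples n d))).
  { apply (nice_lsum (fun c z => indic (canonical c z /\ gen_at c z))). intros c _. apply niceP_canonical_gen. }
  unfold Gdn. rewrite epsilon_iint.
  - rewrite <- (ExL_lsum coords (fun c z => indic (canonical c z /\ gen_at c z)))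
      by (intros; first [apply niceP_canonical_gen | apply cube_0]).
    apply ExL_ext; [apply cube_0|]. intros z Hz. apply (gen_count_eq z Hz).
  - apply nice_ext with (2 := N). intros z Hz. symmetry. apply (gen_count_eq z Hz).
Qed.

(** * Discarding ties *)

Definition proper (c : list nat) : list nat := List.filter (fun o => o <? n)%nat c.

(** Observation [i] is exempted at the positions where the point takes its coordinate from [i], and
    at the zero coordinates, which are exceeded automatically away from ties. *)
Definition dominates (c : list nat) (i : nat) (z : nat -> R) : Prop :=
  forall l, In l (seq 0 d) -> nth l c n = n \/ nth l c n = i \/ tval c l z < z (i * d + l)%nat.

(** An observation used by the tuple must exceed the point elsewhere; any other one must fail to
    exceed it. Once the selected coordinates are fixed, the condition for [i] involves observation
    [i] alone. *)
Definition block_cond (c : list nat) (i : nat) (z : nat -> R) : Prop :=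
  if in_dec Nat.eq_dec i c then dominates c i z else ~ dominates c i z.

Lemma coord_lt i l : (i < n)%nat -> (l < d)%nat -> (i * d + l < d * n)%nat.
Proof. intros. nia. Qed.

Lemma coord_inj i l i' l' : (l < d)%nat -> (l' < d)%nat ->
  (i * d + l = i' * d + l')%nat -> i = i' /\ l = l'.
Proof.
  intros Hl Hl' E.
  assert (i = i').
  { destruct (Nat.lt_trichotomy i i') as [D|[D|D]]; auto; exfalso; nia. }
  subst. split; auto. lia.
Qed.

Lemma in_coords a : In a coords <-> (a < d * n)%nat.
Proof. unfold coords. rewrite <- in_rev, in_seq. lia. Qed.

Lemma NoDup_proper c : length c = d -> (NoDup (proper c) <->
  forall l l', (l < d)%nat -> (l' < d)%nat -> (nth l c n < n)%nat -> nth l c n = nth l' c n -> l = l').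
Proof.
  intros <-. induction c as [|o c IH]; simpl.
  - split; [intros; lia | constructor].
  - split.
    + intros ND l l' Hl Hl' Ho E.
      assert (NDc : NoDup (proper c)).
      { destruct (o <? n)%nat; auto. inversion ND; auto. }
      assert (HN : forall m, (m < length c)%nat -> (o < n)%nat -> o <> nth m c n).
      { intros m Hm Hon Eo. apply Nat.ltb_lt in Hon. rewrite Hon in ND. inversion ND as [|? ? Hni _]; subst.
        apply Hni. apply filter_In. split; auto. apply nth_In; auto. }
      destruct l as [|l], l' as [|l']; auto.
      * exfalso. apply (HN l'); auto; lia.
      * exfalso. apply (HN l); auto; lia.
      * f_equal. apply IH; auto; lia.
    + intros H.
      assert (NDc : NoDup (proper c)).
      { apply IH. intros l l' Hl Hl' Ho E. specialize (H (S l) (S l') ltac:(lia) ltac:(lia) Ho E). lia. }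
      destruct (Nat.ltb_spec o n) as [D|D]; auto. constructor; auto.
      intros Hi. apply filter_In in Hi. destruct Hi as [Hi _]. apply (In_nth _ _ n) in Hi.
      destruct Hi as (m & Hm & Em). specialize (H 0%nat (S m) ltac:(lia) ltac:(lia) D (eq_sym Em)). lia.
Qed.

(** Away from ties canonicity is automatic, and the observation witnessing position [j] can only be
    the entry of the tuple at [j]. An observation used at two positions would have to be strictly
    larger than the point in a coordinate where it equals it. *)
Lemma generic_gen_at c z : In c (tuples n d) -> cube z -> generic coords z ->
  (canonical c z /\ gen_at c z <->
   NoDup (proper c) /\ forall i, In i (seq 0 n) -> block_cond c i z).
Proof.
  intros Hc Hz [G1 G2]. apply in_tuples in Hc. destruct Hc as [Lc Hc].
  rewrite NoDup_proper by auto.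
  assert (Hcn : forall l, (l < d)%nat -> (nth l c n <= n)%nat).
  { intros l Hl. apply Hc, nth_In. lia. }
  assert (Hpos : forall i l, (i < n)%nat -> (l < d)%nat -> 0 < z (i * d + l)%nat < 1).
  { intros i l Hi Hl. destruct (G1 (i * d + l)%nat); [apply in_coords, coord_lt; auto|].
    pose proof (Hz (i * d + l)%nat). lra. }
  assert (Hdist : forall i i' l, (i < n)%nat -> (i' < n)%nat -> (l < d)%nat ->
     z (i * d + l)%nat = z (i' * d + l)%nat -> i = i').
  { intros i i' l Hi Hi' Hl E. destruct (Nat.eq_dec i i') as [|N]; auto. exfalso.
    apply (G2 (i * d + l)%nat (i' * d + l)%nat); auto; try (apply in_coords, coord_lt; auto).
    intros E'. apply coord_inj in E'; auto. tauto. }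
  assert (Hcv : forall i l, (i < n)%nat -> cval i l z = z (i * d + l)%nat).
  { intros i l Hi. unfold cval. apply Nat.ltb_lt in Hi. rewrite Hi. auto. }
  assert (Htn : forall l, nth l c n = n -> tval c l z = 0).
  { intros l E. unfold tval, cval. rewrite E, Nat.ltb_irrefl. auto. }
  assert (Ht : forall l, (nth l c n < n)%nat -> tval c l z = z (nth l c n * d + l)%nat).
  { intros l E. unfold tval. auto. }
  split.
  - intros (_ & H1 & H2 & H3).
    assert (Key : forall j, (j < d)%nat -> (nth j c n < n)%nat ->
      forall l, (l < d)%nat -> l <> j -> tval c l z < z (nth j c n * d + l)%nat).
    { intros j Hj Hcj l Hl N. rewrite <- Hcv by auto. 
      destruct (H3 j) as [E|(i & Hi & E & HL)]; [apply in_seq; lia| |].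
      - rewrite Ht in E by auto. pose proof (Hpos _ _ Hcj Hj). lra.
      - apply in_seq in Hi. rewrite Hcv, Ht in E by (auto; lia). apply Hdist in E; auto; try lia.
        subst i. destruct (HL l); [apply in_seq; lia | congruence | auto]. }
    split.
    + intros l l' Hl Hl' Hn E. destruct (Nat.eq_dec l l') as [|N]; auto. exfalso.
      specialize (Key l Hl Hn l' Hl' ltac:(auto)). rewrite Ht in Key by lia. rewrite E in Key. lra.
    + intros i Hi. apply in_seq in Hi. unfold block_cond. destruct in_dec as [Hic|Hic].
      * apply (In_nth _ _ n) in Hic. destruct Hic as (j & Hj & Ej). rewrite Lc in Hj.
        intros l Hl. apply in_seq in Hl. destruct (Nat.eq_dec l j) as [->|N]; auto.
        right; right. rewrite <- Ej. apply Key; auto; lia.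
      * intros D. apply (H2 i); [apply in_seq; lia|]. intros l Hl. rewrite Hcv by lia.
        destruct (D l Hl) as [E|[E|E]]; auto; apply in_seq in Hl.
        -- rewrite Htn by auto. apply Hpos; lia.
        -- exfalso. apply Hic. rewrite <- E. apply nth_In. lia.
  - intros (Inj & HB). split; [|split; [|split]].
    + intros l Hl i Hi E. apply in_seq in Hl, Hi. pose proof (Hcn l ltac:(lia)).
      rewrite Hcv in E by lia. destruct (Nat.eq_dec (nth l c n) n) as [En|En].
      * rewrite Htn in E by auto. pose proof (Hpos i l ltac:(lia) ltac:(lia)). lra.
      * rewrite Ht in E by lia. apply Hdist in E; lia.
    + intros l Hl. apply in_seq in Hl. pose proof (Hcn l ltac:(lia)).
      destruct (Nat.eq_dec (nth l c n) n) as [En|En].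
      * rewrite Htn by auto. lra.
      * rewrite Ht by lia. apply Hpos; lia.
    + intros i Hi N. specialize (HB i Hi). unfold block_cond in HB. apply in_seq in Hi.
      destruct in_dec as [Hic|Hic].
      * apply (In_nth _ _ n) in Hic. destruct Hic as (j & Hj & Ej). rewrite Lc in Hj.
        specialize (N j ltac:(apply in_seq; lia)). rewrite Ht, Hcv, Ej in N by lia. lra.
      * apply HB. intros l Hl. right; right. rewrite <- Hcv by lia. auto.
    + intros j Hj. apply in_seq in Hj. pose proof (Hcn j ltac:(lia)).
      destruct (Nat.eq_dec (nth j c n) n) as [En|En]; [left; auto|].
      right. exists (nth j c n). split; [apply in_seq; lia|]. split; [reflexivity|].
      intros l Hl. destruct (Nat.eq_dec l j) as [|N]; auto. right. rewrite Hcv by lia.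
      specialize (HB (nth j c n) ltac:(apply in_seq; lia)). unfold block_cond in HB.
      destruct in_dec as [Hic|Hic].
      * destruct (HB l Hl) as [E|[E|E]]; auto; apply in_seq in Hl.
        -- rewrite Htn by auto. apply Hpos; lia.
        -- exfalso. apply N. apply Inj; auto; lia.
      * exfalso. apply Hic. apply nth_In. lia.
Qed.

End Generators.

(** * The probability that a given tuple is a generator *)

Lemma lprod_mult {A} (f g : A -> R) l : lprod (fun a => f a * g a) l = lprod f l * lprod g l.
Proof. induction l as [|a l IH]; simpl; [ring | rewrite IH; ring]. Qed.

Lemma lprod_pow {A} (f : A -> R) l p : lprod (fun a => f a ^ p) l = lprod f l ^ p.
Proof. induction l as [|a l IH]; simpl; [rewrite pow1; ring | rewrite IH, Rpow_mult_distr; ring]. Qed.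

Lemma lprod_const {A} (c : R) (l : list A) : lprod (fun _ => c) l = c ^ length l.
Proof. induction l as [|a l IH]; simpl; [auto | rewrite IH; auto]. Qed.

Lemma lprod_app {A} (f : A -> R) l m : lprod f (l ++ m) = lprod f l * lprod f m.
Proof. induction l as [|a l IH]; simpl; [ring | rewrite IH; ring]. Qed.

Lemma lprod_swap {A B} (f : A -> B -> R) l m :
  lprod (fun a => lprod (f a) m) l = lprod (fun b => lprod (fun a => f a b) l) m.
Proof.
  induction l as [|a l IH]; simpl.
  - rewrite lprod_const, pow1. auto.
  - rewrite IH, lprod_mult. auto.
Qed.

Lemma lprod_perm {A} (f : A -> R) l m : Permutation l m -> lprod f l = lprod f m.
Proof. intros P. induction P; simpl; try rewrite IHP; try ring; congruence. Qed.

(** The source of the exponent [k - 1]: a selected coordinate must be exceeded by every used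
    observation except the one that supplies it. *)
Lemma lprod_omit (a : nat) (y : R) D : NoDup D -> In a D ->
  lprod (fun i => if (a =? i)%nat then 1 else y) D = y ^ (length D - 1).
Proof.
  intros ND Ha. apply in_split in Ha. destruct Ha as (D1 & D2 & ->).
  rewrite <- (lprod_perm _ _ _ (Permutation_middle D1 D2 a)).
  rewrite <- (Permutation_length (Permutation_middle D1 D2 a)). simpl.
  rewrite Nat.eqb_refl, Nat.sub_0_r, Rmult_1_l.
  rewrite (lprod_ext _ (fun _ => y)); [apply lprod_const|].
  intros i Hi. apply NoDup_remove_2 in ND. destruct (Nat.eqb_spec a i); auto. subst. tauto.
Qed.

Lemma RInt_indic_lt x : 0 <= x <= 1 -> RInt (fun t => indic (x < t)) 0 1 = 1 - x.
Proof.
  intros Hx. apply is_RInt_unique. replace (1 - x) with ((x - 0) * 0 + (1 - x) * 1) by ring.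
  apply is_RInt_glue with (fun _ => 0) (fun _ => 1) x; try apply is_RInt_cst; auto.
  - intros t Ht. apply indic_false. lra.
  - intros t Ht. apply indic_true. lra.
Qed.

Lemma RInt_pow_compl p : RInt (fun t => (1 - t) ^ p) 0 1 = / INR (S p).
Proof.
  apply is_RInt_unique.
  assert (HS : INR (S p) <> 0) by (apply not_0_INR; lia).
  replace (/ INR (S p)) with (minus (- (1 - 1) ^ (S p) / INR (S p)) (- (1 - 0) ^ (S p) / INR (S p))).
  - apply (is_RInt_derive (fun t => - (1 - t) ^ (S p) / INR (S p))).
    + intros x _. auto_derive; auto.
      change (match p with 0%nat => 1 | S _ => INR p + 1 end) with (INR (S p)).
      change (@eq R (- (- (1) * (INR (S p) * (1 + - x) ^ p)) * / INR (S p)) ((1 - x) ^ p)).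
      unfold Rminus. field. auto.
    + intros x _. apply (ex_derive_continuous (fun t => (1 - t) ^ p)). auto_derive. auto.
  - unfold minus, plus, opp; simpl. rewrite Rminus_diag, Rminus_0_r, pow1. field.
    change (INR (S p) <> 0). auto.
Qed.

(** * Integration over the coordinates for a fixed tuple *)

Section Tuple.

Variables (d n : nat) (c : list nat).
Hypothesis Hc : In c (tuples n d).

Notation e l := (nth l c n).

(** The conditional probability that a fresh uniform variable exceeds coordinate [l] of the point.
    The product over [l] is the [Y] of the overview. *)
Definition yval (l : nat) (z : nat -> R) : R := if (e l <? n)%nat then 1 - z (e l * d + l)%nat else 1.

Definition outer : list nat := flat_map (fun l => if (e l <? n)%nat then [e l * d + l]%nat else []) (seq 0 d).

Definition inner (i : nat) : list nat :=
  flat_map (fun l => if (e l =? i)%nat then [] else [i * d + l]%nat) (seq 0 d).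

Lemma entry_le l : (l < d)%nat -> (e l <= n)%nat.
Proof. intros Hl. apply in_tuples in Hc. destruct Hc as [L H]. apply H, nth_In. lia. Qed.

Lemma in_outer a : In a outer <-> exists l, (l < d)%nat /\ (e l < n)%nat /\ a = (e l * d + l)%nat.
Proof.
  unfold outer. rewrite in_flat_map. split.
  - intros (l & Hl & Ha). apply in_seq in Hl. exists l. destruct (Nat.ltb_spec (e l) n); [|destruct Ha].
    destruct Ha as [<-|[]]. repeat split; auto; lia.
  - intros (l & Hl & He & ->). exists l. split; [apply in_seq; lia|].
    apply Nat.ltb_lt in He. rewrite He. simpl; auto.
Qed.

Lemma in_inner i a : In a (inner i) <-> exists l, (l < d)%nat /\ e l <> i /\ a = (i * d + l)%nat.
Proof.
  unfold inner. rewrite in_flat_map. split.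
  - intros (l & Hl & Ha). apply in_seq in Hl. exists l. destruct (Nat.eqb_spec (e l) i); [destruct Ha|].
    destruct Ha as [<-|[]]. repeat split; auto; lia.
  - intros (l & Hl & He & ->). exists l. split; [apply in_seq; lia|].
    apply Nat.eqb_neq in He. rewrite He. simpl; auto.
Qed.

Lemma coords_perm : Permutation (coords d n) (outer ++ flat_map inner (seq 0 n)).
Proof.
  apply NoDup_Permutation.
  - apply NoDup_rev, seq_NoDup.
  - apply NoDup_app.
    + apply NoDup_flat_map.
      * apply seq_NoDup.
      * intros l _. destruct (_ <? _)%nat; repeat constructor; simpl; auto.
      * intros l l' b Hl Hl' Hb Hb'. apply in_seq in Hl, Hl'.
        destruct (_ <? _)%nat; [|destruct Hb]. destruct (_ <? _)%nat; [|destruct Hb'].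
        destruct Hb as [<-|[]], Hb' as [E|[]]. apply coord_inj in E; lia.
    + apply NoDup_flat_map.
      * apply seq_NoDup.
      * intros i _. apply NoDup_flat_map.
        -- apply seq_NoDup.
        -- intros l _. destruct (_ =? _)%nat; repeat constructor; simpl; auto.
        -- intros l l' b Hl Hl' Hb Hb'. apply in_seq in Hl, Hl'.
           destruct (_ =? _)%nat; [destruct Hb|]. destruct (_ =? _)%nat; [destruct Hb'|].
           destruct Hb as [<-|[]], Hb' as [E|[]]. lia.
      * intros i i' b _ _ Hb Hb'. apply in_inner in Hb, Hb'.
        destruct Hb as (l & Hl & _ & ->), Hb' as (l' & Hl' & _ & E). apply coord_inj in E; lia.
    + intros a Ha Hb. apply in_outer in Ha. apply in_flat_map in Hb. destruct Hb as (i & _ & Hb).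
      apply in_inner in Hb. destruct Ha as (l & Hl & He & ->), Hb as (l' & Hl' & Hn & E).
      apply coord_inj in E; auto. destruct E; subst; auto.
  - intros a. rewrite in_coords, in_app_iff, in_outer, in_flat_map. split.
    + intros Ha. assert (Hd : d <> 0%nat) by lia.
      pose proof (Nat.mod_upper_bound a d Hd) as Hm. pose proof (Nat.div_mod a d Hd) as Hdm.
      set (i := (a / d)%nat) in *. set (l := (a mod d)%nat) in *.
      assert (Hi : (i < n)%nat) by nia.
      destruct (Nat.eq_dec (e l) i) as [E|E].
      * left. exists l. rewrite E. repeat split; auto. lia.
      * right. exists i. split; [apply in_seq; lia|]. apply in_inner. exists l. repeat split; auto. lia.
    + intros [(l & Hl & He & ->)|(i & Hi & Ha)].
      * apply coord_lt; auto.
      * apply in_inner in Ha. destruct Ha as (l & Hl & _ & ->). apply in_seq in Hi. apply coord_lt; auto; lia.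
Qed.

Definition dom_factor (i l : nat) (z : nat -> R) : R :=
  indic (e l = n \/ e l = i \/ tval d n c l z < z (i * d + l)%nat).

Lemma nice_dom_factor i l : nice (dom_factor i l).
Proof.
  apply (niceP_or (fun _ => e l = n)); [apply niceP_const|].
  apply (niceP_or (fun _ => e l = i)); [apply niceP_const|].
  apply (niceP_lt (tval d n c l) (fun z => z (i * d + l)%nat)); [apply is_term_tval|].
  left. eauto.
Qed.

Lemma tval_upd l z a t : a <> (e l * d + l)%nat -> tval d n c l (upd z a t) = tval d n c l z.
Proof.
  intros H. unfold tval, cval. destruct (_ <? _)%nat; auto. apply upd_neq. auto.
Qed.

Lemma indep_dom_factor i l a : a <> (e l * d + l)%nat -> a <> (i * d + l)%nat -> indep a (dom_factor i l).
Proof.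
  intros H1 H2 z t _ _. unfold dom_factor. rewrite tval_upd, upd_neq; auto.
Qed.

(** Given the selected coordinates, domination by observation [i] is a conjunction of independent
    events, one for each position not supplied by [i]. *)
Lemma ExL_inner i z : (i < n)%nat -> cube z ->
  ExL (inner i) (fun z => indic (dominates d n c i z)) z =
  lprod (fun l => if (e l =? i)%nat then 1 else yval l z) (seq 0 d).
Proof.
  intros Hi Hz.
  rewrite (ExL_ext _ _ (fun z => lprod (fun l => dom_factor i l z) (seq 0 d)));
    [|auto|intros; apply indic_forall].
  unfold inner. rewrite ExL_flat_map_lprod; auto.
  - apply lprod_ext. intros l Hl. apply in_seq in Hl. destruct (Nat.eqb_spec (e l) i) as [E|E].
    + simpl. apply indic_true. auto.
    + simpl. unfold yval. destruct (Nat.ltb_spec (e l) n) as [L|L].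
      * unfold I1. rewrite <- RInt_indic_lt by apply Hz. apply RInt_ext. intros t _.
        unfold dom_factor. rewrite tval_upd, upd_eq.
        -- unfold tval, cval. apply Nat.ltb_lt in L. rewrite L. apply Nat.ltb_lt in L.
           apply indic_iff. split; auto. intros [F|[F|F]]; auto; lia.
        -- intros F. apply coord_inj in F; lia.
      * pose proof (entry_le l ltac:(lia)).
        rewrite (I1_ext _ _ (fun _ => 1)); auto.
        -- apply (ExL_const [_] 1); auto.
        -- intros. apply indic_true. left. lia.
  - apply seq_NoDup.
  - intros; apply nice_dom_factor.
  - intros l l' Hl Hl' N a Ha. apply in_seq in Hl, Hl'. destruct (Nat.eqb_spec (e l') i); [destruct Ha|].
    destruct Ha as [<-|[]]. apply indep_dom_factor; intros F; apply coord_inj in F; lia.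
Qed.

Lemma nice_dominates i : niceP (dominates d n c i).
Proof.
  apply nice_ext with (fun z => lprod (fun l => dom_factor i l z) (seq 0 d)).
  - intros; symmetry; apply indic_forall.
  - apply nice_lprod. intros; apply nice_dom_factor.
Qed.

Lemma nice_block_cond i : niceP (block_cond d n c i).
Proof.
  unfold block_cond. destruct in_dec; [|apply niceP_not]; apply nice_dominates.
Qed.

Lemma indep_block_cond i j a : i <> j -> In a (inner j) -> indep a (fun z => indic (block_cond d n c i z)).
Proof.
  intros N Ha z t Hz Ht. apply in_inner in Ha. destruct Ha as (l & Hl & He & ->).
  assert (E : dominates d n c i (upd z (j * d + l) t) <-> dominates d n c i z).
  { unfold dominates. assert (Hs : forall l', In l' (seq 0 d) ->
      tval d n c l' (upd z (j * d + l) t) = tval d n c l' z /\ upd z (j * d + l) t (i * d + l')%nat = z (i * d + l')%nat).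
    { intros l' Hl'. apply in_seq in Hl'. split; [apply tval_upd | apply upd_neq];
        intros F; apply coord_inj in F; try lia. destruct F; subst; auto. }
    split; intros H l' Hl'; specialize (H l' Hl'); destruct (Hs l' Hl') as [E1 E2];
      rewrite E1, E2 in *; auto. }
  apply indic_iff. unfold block_cond. destruct in_dec; tauto.
Qed.

Hypothesis HN : NoDup (proper n c).

Lemma in_proper i : In i (proper n c) <-> In i c /\ (i < n)%nat.
Proof. unfold proper. rewrite filter_In, Nat.ltb_lt. tauto. Qed.

(** The observations are conditionally independent. The used ones together contribute every position
    [k - 1] times, with [k] the number of nonzero positions; each of the [n - k] others contributes
    [1 - Y]. *)
Lemma ExL_blocks z : (1 <= n)%nat -> cube z ->
  ExL (flat_map inner (seq 0 n)) (fun z => indic (forall i, In i (seq 0 n) -> block_cond d n c i z)) z =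
  lprod (fun l => yval l z) (seq 0 d) ^ (length (proper n c) - 1) *
  (1 - lprod (fun l => yval l z) (seq 0 d)) ^ (n - length (proper n c)).
Proof.
  intros Hn Hz. set (Y := lprod (fun l => yval l z) (seq 0 d)). set (D := proper n c).
  rewrite (ExL_ext _ _ (fun z => lprod (fun i => indic (block_cond d n c i z)) (seq 0 n)));
    [|auto|intros; apply indic_forall].
  rewrite (ExL_flat_map_lprod inner (fun i z => indic (block_cond d n c i z))); auto using seq_NoDup.
  2:{ intros; apply nice_block_cond. }
  2:{ intros; eapply indep_block_cond; eauto. }
  set (rest := List.filter (fun i => if in_dec Nat.eq_dec i c then false else true) (seq 0 n)).
  assert (P : Permutation (seq 0 n) (D ++ rest)).
  { apply NoDup_Permutation; [apply seq_NoDup| |].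
    - apply NoDup_app; auto.
      + apply NoDup_filter, seq_NoDup.
      + intros i Hi Hr. apply in_proper in Hi. apply filter_In in Hr. destruct in_dec; [destruct Hr; discriminate | tauto].
    - intros i. rewrite in_app_iff. unfold D, rest. rewrite in_proper, filter_In, in_seq.
      destruct (in_dec Nat.eq_dec i c); intuition (try lia; try discriminate). }
  rewrite (lprod_perm _ _ _ P), lprod_app.
  assert (Lr : length rest = (n - length D)%nat).
  { apply Permutation_length in P. rewrite length_app, length_seq in P. lia. }
  f_equal.
  - rewrite (lprod_ext _ (fun i => lprod (fun l => if (e l =? i)%nat then 1 else yval l z) (seq 0 d))).
    (* After exchanging the products, position [l] is counted once for each used observation other
       than its own. *)
    + rewrite lprod_swap. unfold Y. rewrite <- lprod_pow. apply lprod_ext. intros l Hl.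
      apply in_seq in Hl. destruct (Nat.ltb_spec (e l) n) as [L|L].
      * apply lprod_omit; auto. apply in_proper. split; auto. apply nth_In.
        apply in_tuples in Hc. lia.
      * rewrite (lprod_ext _ (fun _ => 1)).
        -- unfold yval. destruct (Nat.ltb_spec (e l) n); [lia|]. rewrite lprod_const, !pow1. auto.
        -- intros i _. unfold yval. destruct (Nat.ltb_spec (e l) n); [lia|]. destruct (_ =? _)%nat; auto.
    + intros i Hi. apply in_proper in Hi. rewrite <- ExL_inner by tauto.
      apply ExL_ext; auto. intros. unfold block_cond. destruct in_dec; tauto.
  - rewrite <- Lr, <- lprod_const. apply lprod_ext. intros i Hi. unfold rest in Hi.
    apply filter_In in Hi. destruct Hi as [Hi Hic]. apply in_seq in Hi.
    destruct (in_dec Nat.eq_dec i c) as [|Hn']; [discriminate|].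
    rewrite (ExL_ext _ _ (fun z => 1 + (-1) * indic (dominates d n c i z))); auto.
    + rewrite ExL_plus, ExL_const, ExL_scal, ExL_inner; auto; try lia.
      * unfold Y. rewrite (lprod_ext _ (fun l => yval l z)); [ring|].
        intros l Hl. apply in_seq in Hl. destruct (Nat.eqb_spec (e l) i) as [E|]; auto.
        exfalso. apply Hn'. rewrite <- E. apply nth_In. apply in_tuples in Hc. lia.
      * apply nice_dominates.
      * apply nice_const.
      * apply nice_mult; [apply nice_const | apply nice_dominates].
    + intros y _. unfold block_cond. destruct in_dec; [tauto|]. apply indic_not.
Qed.

Lemma nice_yval l : nice (yval l).
Proof.
  unfold yval. destruct (_ <? _)%nat; [|apply nice_const].
  apply nice_ext with (fun z => 1 + (-1) * z (e l * d + l)%nat); [intros; ring|].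
  apply nice_plus; [apply nice_const|]. apply nice_mult; [apply nice_const | apply nice_coord].
Qed.

Lemma nice_pow f p : nice f -> nice (fun z => f z ^ p).
Proof. intros Hf. induction p; simpl; [apply nice_const | apply nice_mult; auto]. Qed.

Lemma lprod_proper (r : R) : lprod (fun l => if (e l <? n)%nat then r else 1) (seq 0 d) = r ^ length (proper n c).
Proof.
  apply in_tuples in Hc. destruct Hc as [<- _]. clear.
  induction c as [|o c' IH]; [reflexivity|].
  cbn [length seq lprod nth]. rewrite <- seq_shift.
  assert (E : forall f (l : list nat), lprod f (map S l) = lprod (fun a => f (S a)) l).
  { intros f l. induction l as [|a l IHl]; simpl; congruence. }
  rewrite E. cbn [nth]. rewrite IH.
  unfold proper. simpl. destruct (o <? n)%nat; simpl; ring.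
Qed.

Lemma ExL_outer p z : cube z ->
  ExL outer (fun z => lprod (fun l => yval l z) (seq 0 d) ^ p) z = (/ INR (S p)) ^ length (proper n c).
Proof.
  intros Hz. rewrite <- lprod_proper.
  rewrite (ExL_ext _ _ (fun z => lprod (fun l => yval l z ^ p) (seq 0 d))); auto.
  2:{ intros. symmetry. apply lprod_pow. }
  unfold outer. rewrite (ExL_flat_map_lprod _ (fun l z => yval l z ^ p)); auto using seq_NoDup.
  - apply lprod_ext. intros l Hl. apply in_seq in Hl. destruct (Nat.ltb_spec (e l) n) as [L|L]; cbn [ExL fold_right].
    + unfold I1. rewrite <- RInt_pow_compl. apply RInt_ext. intros t _. unfold yval.
      apply Nat.ltb_lt in L. rewrite L, upd_eq. auto.
    + unfold yval. destruct (Nat.ltb_spec (e l) n); [lia|]. apply pow1.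
  - intros; apply nice_pow, nice_yval.
  - intros l l' Hl Hl' N a Ha y t Hy Ht. apply in_seq in Hl, Hl'. destruct (_ <? _)%nat; [|destruct Ha].
    destruct Ha as [<-|[]]. unfold yval. destruct (_ <? _)%nat; auto. rewrite upd_neq; auto.
    intros F. apply coord_inj in F; lia.
Qed.

End Tuple.

(* The expectation of [Y^(k-1) (1-Y)^(n-k)], by binomial expansion: a product [Y] of [k]
   independent uniforms satisfies [E Y^(k-1+i) = (k+i)^(-k)]. *)
Definition moment (n k : nat) : R :=
  lsum (fun i => Binomial.C (n - k) i * (-1) ^ i * (/ INR (k + i)) ^ k) (seq 0 (S (n - k))).

Lemma lsum_sum_f_R0 (f : nat -> R) m : sum_f_R0 f m = lsum f (seq 0 (S m)).
Proof.
  induction m as [|m IH]; [simpl; ring|].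
  rewrite seq_snoc, lsum_app, <- IH. simpl. ring.
Qed.

Lemma ExL_tuple d n c : (1 <= n)%nat -> In c (tuples n d) ->
  ExL (coords d n) (fun z => indic (canonical d n c z /\ gen_at d n c z)) (fun _ => 0) =
  if (ListDec.NoDup_dec Nat.eq_dec (proper n c)) then
    if (length (proper n c) =? 0)%nat then 0 else moment n (length (proper n c))
  else 0.
Proof.
  intros Hn Hc.
  set (Q := fun z => NoDup (proper n c) /\ forall i, In i (seq 0 n) -> block_cond d n c i z).
  assert (NQ : niceP (fun z => forall i, In i (seq 0 n) -> block_cond d n c i z)).
  { apply niceP_forall. intros; apply nice_block_cond. }
  assert (E : ExL (coords d n) (fun z => indic (canonical d n c z /\ gen_at d n c z)) (fun _ => 0) =
    ExL (coords d n) (fun z => indic (Q z)) (fun _ => 0)).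
  { apply ExL_ext_generic with [].
    - apply niceP_canonical_gen.
    - apply (niceP_and (fun _ => NoDup (proper n c))); auto. apply niceP_const.
    - apply cube_0.
    - rewrite app_nil_r. apply NoDup_rev, seq_NoDup.
    - split; intros a; simpl; tauto.
    - rewrite app_nil_r. intros z Hz G. apply indic_iff, generic_gen_at; auto. }
  rewrite E. destruct ListDec.NoDup_dec as [ND|ND].
  2:{ rewrite (ExL_ext _ _ (fun _ => 0)); [apply ExL_const| |]; try apply cube_0.
      intros; apply indic_false; unfold Q; tauto. }
  rewrite (ExL_ext _ _ (fun z => indic (forall i, In i (seq 0 n) -> block_cond d n c i z))); try apply cube_0.
  2:{ intros; apply indic_iff; unfold Q; tauto. }
  (* The selected coordinates become the outer integrals, so that the inner ones can be computed
     conditionally. *)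
  rewrite (ExL_perm _ _ _ _ (coords_perm d n c) NQ cube_0), ExL_app.
  set (k := length (proper n c)).
  rewrite (ExL_ext _ _ (fun z => lprod (fun l => yval d n c l z) (seq 0 d) ^ (k - 1) *
     (1 - lprod (fun l => yval d n c l z) (seq 0 d)) ^ (n - k))); try apply cube_0.
  2:{ intros z Hz. apply ExL_blocks; auto. }
  (* For [k = 0] the point is the origin, [Y = 1], and the factor [(1 - Y)^n] vanishes because
     [n >= 1]. *)
  destruct (Nat.eqb_spec k 0) as [K|K].
  - rewrite (ExL_ext _ _ (fun _ => 0)); [apply ExL_const; apply cube_0|apply cube_0|].
    intros z Hz. replace (lprod (fun l => yval d n c l z) (seq 0 d)) with 1.
    + rewrite Rminus_diag, pow_i by lia. ring.
    + rewrite <- (pow1 (length (seq 0 d))), <- lprod_const. apply lprod_ext.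
      intros l Hl. unfold yval. destruct (Nat.ltb_spec (nth l c n) n) as [L|L]; auto.
      exfalso. apply length_zero_iff_nil in K.
      assert (F : In (nth l c n) (proper n c)).
      { apply in_proper; auto. split; auto. apply nth_In. apply in_tuples in Hc. apply in_seq in Hl. lia. }
      rewrite K in F. destruct F.
  (* Expanding [(1 - Y)^(n-k)] leaves powers [Y^(k-1+i)], whose expectation factors over the [k]
     selected coordinates. *)
  - rewrite (ExL_ext _ _ (fun z => lsum (fun i => (Binomial.C (n - k) i * (-1) ^ i) *
       lprod (fun l => yval d n c l z) (seq 0 d) ^ (k - 1 + i)) (seq 0 (S (n - k))))); try apply cube_0.
    + rewrite (ExL_lsum _ (fun i z => (Binomial.C (n - k) i * (-1) ^ i) *
       lprod (fun l => yval d n c l z) (seq 0 d) ^ (k - 1 + i))); try apply cube_0.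
      * apply lsum_ext. intros i _. rewrite ExL_scal, ExL_outer; auto; try apply cube_0.
        -- replace (S (k - 1 + i)) with (k + i)%nat by lia. auto.
        -- apply nice_pow, nice_lprod. intros; apply nice_yval.
      * intros i _. apply nice_mult; [apply nice_const|].
        apply nice_pow, nice_lprod. intros; apply nice_yval.
    + intros z _. set (Y := lprod _ _).
      replace (1 - Y) with (- Y + 1) by ring. rewrite Binomial.binomial, lsum_sum_f_R0, <- lsum_scal.
      apply lsum_ext. intros i _. rewrite pow1. replace (- Y) with (-1 * Y) by ring.
      rewrite Rpow_mult_distr, pow_add. ring.
Qed.

(** * Counting tuples *)

Fixpoint falling (n k : nat) : R :=
  match k with O => 1 | S k' => falling n k' * (INR n - INR k') end.

(** Pascal's recursion, with value [0] for [k > d]; [Binomial.C] is nonzero there because its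
    natural subtraction truncates. *)
Fixpoint bin (d k : nat) : R :=
  match d, k with
  | _, O => 1
  | O, S _ => 0
  | S d', S k' => bin d' k' + bin d' k
  end.

Lemma bin_0 d : bin d 0 = 1.
Proof. destruct d; auto. Qed.

Lemma bin_gt d : forall k, (d < k)%nat -> bin d k = 0.
Proof.
  induction d as [|d IH]; intros [|k] Hk; simpl; try lia; auto.
  rewrite !IH by lia. ring.
Qed.

Lemma bin_C d : forall k, (k <= d)%nat -> bin d k = Binomial.C d k.
Proof.
  induction d as [|d IH]; intros [|k] Hk; try lia.
  - simpl. unfold Binomial.C. simpl. field.
  - rewrite bin_0. unfold Binomial.C. rewrite Nat.sub_0_r. simpl (fact 0). simpl INR.
    field. exact (INR_fact_neq_0 (S d)).
  - cbn [bin]. destruct (Nat.eq_dec k d) as [->|N].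
    + rewrite IH, bin_gt by lia. unfold Binomial.C. rewrite !Nat.sub_diag.
      change (INR (fact 0)) with 1. field. split; apply INR_fact_neq_0.
    + rewrite !IH by lia. apply Binomial.pascal. lia.
Qed.

(** Pascal's rule for weighted sums: an additional position either leaves the number [k] of nonzero
    positions unchanged or raises it by one. *)
Lemma lsum_bin_S (psi : nat -> R) d :
  lsum (fun k => bin (S d) k * psi k) (seq 0 (S (S d))) =
  lsum (fun k => bin d k * (psi k + psi (S k))) (seq 0 (S d)).
Proof.
  change (seq 0 (S (S d))) with (0%nat :: seq 1 (S d)). rewrite <- seq_shift.
  cbn [lsum]. rewrite lsum_map.
  rewrite (lsum_ext _ (fun k => bin d k * psi (S k) + bin d (S k) * psi (S k))) by (intros; cbn [bin]; ring).
  rewrite lsum_plus.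
  rewrite (lsum_ext (fun k => bin d k * (psi k + psi (S k))) (fun k => bin d k * psi (S k) + bin d k * psi k)) by (intros; ring).
  rewrite lsum_plus.
  assert (E : bin (S d) 0 * psi 0%nat + lsum (fun k => bin d (S k) * psi (S k)) (seq 0 (S d))
     = lsum (fun k => bin d k * psi k) (seq 0 (S (S d)))).
  { change (seq 0 (S (S d))) with (0%nat :: seq 1 (S d)). rewrite <- (seq_shift (S d)).
    cbn [lsum]. rewrite lsum_map, !bin_0. auto. }
  rewrite (seq_snoc 0 (S d)), lsum_app in E. cbn [lsum] in E. rewrite (bin_gt d (0 + S d)) in E by lia. lra.
Qed.

Lemma lsum_flat_map {A B} (g : A -> list B) (f : B -> R) l :
  lsum f (flat_map g l) = lsum (fun a => lsum f (g a)) l.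
Proof. induction l as [|a l IH]; simpl; [auto | rewrite lsum_app, IH; auto]. Qed.

Lemma lsum_if_in (D : list nat) n (r : R) : NoDup D -> (forall i, In i D -> (i < n)%nat) ->
  lsum (fun i => if in_dec Nat.eq_dec i D then 0 else r) (seq 0 n) = (INR n - INR (length D)) * r.
Proof.
  intros ND HD.
  assert (G : forall l, NoDup l -> (forall i, In i l -> (i < n)%nat) ->
    lsum (fun i => if in_dec Nat.eq_dec i l then 1 else 0) (seq 0 n) = INR (length l)).
  { induction l as [|a l IH]; intros NDl Hl.
    - rewrite (lsum_ext _ (fun _ => 0)); [rewrite lsum_const; simpl; ring|]. intros; destruct in_dec; simpl in *; tauto.
    - inversion NDl; subst. cbn [length]. rewrite S_INR, <- IH by (auto; intros; apply Hl; simpl; auto).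
      rewrite (lsum_ext _ (fun i => (if in_dec Nat.eq_dec i l then 1 else 0) + (if Nat.eqb a i then 1 else 0))).
      + rewrite lsum_plus. f_equal.
        assert (Ha : In a (seq 0 n)) by (apply in_seq; specialize (Hl a (or_introl eq_refl)); lia).
        generalize (seq_NoDup n 0). revert Ha. generalize (seq 0 n). induction l0 as [|b l0 IHl]; intros Ha NDb; [destruct Ha|].
        inversion NDb; subst. simpl. destruct (Nat.eqb_spec a b) as [->|Nab].
        * rewrite (lsum_ext _ (fun _ => 0)); [rewrite lsum_const; ring|].
          intros i Hi. destruct (Nat.eqb_spec b i); auto. subst; tauto.
        * rewrite IHl; auto; [ring|]. destruct Ha; [congruence | auto].
      + intros i _. destruct (Nat.eqb_spec a i) as [->|Na].
        * destruct (in_dec Nat.eq_dec i (i :: l)) as [|F]; [|exfalso; apply F; simpl; auto].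
          destruct (in_dec Nat.eq_dec i l); [tauto|]. ring.
        * destruct (in_dec Nat.eq_dec i (a :: l)) as [F|F], (in_dec Nat.eq_dec i l) as [F'|F']; simpl in F; try ring; exfalso; intuition. }
  rewrite (lsum_ext _ (fun i => r + (- r) * (if in_dec Nat.eq_dec i D then 1 else 0))).
  - rewrite lsum_plus, lsum_scal, G, lsum_const, length_seq by auto. ring.
  - intros i _. destruct in_dec; ring.
Qed.

Lemma proper_cons_eq n c : proper n (n :: c) = proper n c.
Proof. unfold proper. simpl. rewrite Nat.ltb_irrefl. auto. Qed.

Lemma proper_cons_lt n o c : (o < n)%nat -> proper n (o :: c) = o :: proper n c.
Proof. intros H. unfold proper. simpl. apply Nat.ltb_lt in H. rewrite H. auto. Qed.

(** Induction on the length, for all weights [phi] at once. A new head entry is [n], which keeps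
    [k], or one of the [n - k] indices not yet used, which raises it to [k + 1]. *)
Lemma lsum_tuples n d (phi : nat -> R) :
  lsum (fun c => if ListDec.NoDup_dec Nat.eq_dec (proper n c) then phi (length (proper n c)) else 0) (tuples n d)
  = lsum (fun k => bin d k * (falling n k * phi k)) (seq 0 (S d)).
Proof.
  revert phi. induction d as [|d IH]; intros phi.
  - cbn [tuples lsum seq bin falling]. destruct ListDec.NoDup_dec as [|F].
    + simpl. ring.
    + exfalso. apply F. constructor.
  - cbn [tuples]. rewrite lsum_flat_map.
    rewrite (lsum_ext _ (fun o => lsum (fun c => if ListDec.NoDup_dec Nat.eq_dec (proper n (o :: c)) then phi (length (proper n (o :: c))) else 0) (tuples n d)))
      by (intros; apply lsum_map).
    rewrite lsum_swap, lsum_bin_S.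
    rewrite (lsum_ext (fun k => bin d k * (falling n k * phi k + falling n (S k) * phi (S k)))
      (fun k => bin d k * (falling n k * (phi k + (INR n - INR k) * phi (S k))))) by (intros; cbn [falling]; ring).
    (* The modified weight already contains the sum over all choices of the head entry. *)
    rewrite <- (IH (fun k => phi k + (INR n - INR k) * phi (S k))).
    apply lsum_ext. intros c Hc. rewrite seq_snoc, lsum_app. cbn [lsum].
    rewrite (lsum_ext _ (fun o => if in_dec Nat.eq_dec o (proper n c) then 0 else
       (if ListDec.NoDup_dec Nat.eq_dec (proper n c) then phi (S (length (proper n c))) else 0))).
    + destruct (ListDec.NoDup_dec Nat.eq_dec (proper n c)) as [ND|ND].
      * rewrite lsum_if_in; auto.
        -- rewrite Nat.add_0_l, proper_cons_eq.
           destruct ListDec.NoDup_dec; [ring | tauto].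
        -- intros i Hi. apply filter_In in Hi. apply Nat.ltb_lt. tauto.
      * rewrite (lsum_ext _ (fun _ => 0)) by (intros; destruct in_dec; auto).
        rewrite lsum_const.
        rewrite Nat.add_0_l, proper_cons_eq.
        destruct ListDec.NoDup_dec; [tauto | ring].
    + intros o Ho. apply in_seq in Ho. rewrite proper_cons_lt by lia. cbn [length].
      destruct (in_dec Nat.eq_dec o (proper n c)) as [I|I], (ListDec.NoDup_dec Nat.eq_dec (o :: proper n c)) as [J|J],
        (ListDec.NoDup_dec Nat.eq_dec (proper n c)) as [K|K]; auto; exfalso.
      * inversion J; tauto.
      * inversion J; tauto.
      * inversion J; tauto.
      * apply J. constructor; auto.
Qed.

Theorem Gdn_exact d n : (1 <= n)%nat ->
  Gdn d n = lsum (fun k => bin d k * (falling n k * moment n k)) (seq 1 d).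
Proof.
  intros Hn. rewrite Gdn_lsum.
  set (phi := fun k => if (k =? 0)%nat then 0 else moment n k).
  rewrite (lsum_ext _ (fun c => if ListDec.NoDup_dec Nat.eq_dec (proper n c) then phi (length (proper n c)) else 0))
    by (intros c Hc; apply ExL_tuple; auto).
  rewrite lsum_tuples. change (seq 0 (S d)) with (0%nat :: seq 1 d). cbn [lsum].
  change (phi 0%nat) with 0. rewrite !Rmult_0_r, Rplus_0_l. apply lsum_ext.
  intros k Hk. apply in_seq in Hk. destruct k; [lia|]. reflexivity.
Qed.

(** * Integrals over the real line *)

Definition cont (f : R -> R) : Prop := forall u, continuous f u.

Definition dominated (K : R) (f : R -> R) : Prop := forall u, Rabs (f u) <= K / (1 + u ^ 2).

Definition isI (f : R -> R) (l : R) : Prop :=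
  forall eps, 0 < eps -> exists A, forall a b, a <= - A -> A <= b -> Rabs (RInt f a b - l) < eps.

Lemma cont_ex_RInt f a b : cont f -> ex_RInt f a b.
Proof. intros H. apply (ex_RInt_continuous (V := R_CompleteNormedModule)). intros; apply H. Qed.

Lemma cont_plus f g : cont f -> cont g -> cont (fun u => f u + g u).
Proof. intros Hf Hg u. apply (continuous_plus (V := R_NormedModule) f g); auto. Qed.

Lemma cont_mult f g : cont f -> cont g -> cont (fun u => f u * g u).
Proof. intros Hf Hg u. apply (continuous_mult f g); auto. Qed.

Lemma cont_const c : cont (fun _ => c).
Proof. intros u. apply continuous_const. Qed.

Lemma cont_lsum {A} (f : A -> R -> R) l : (forall i, cont (f i)) -> cont (fun u => lsum (fun i => f i u) l).
Proof. intros H. induction l; simpl; [apply cont_const | apply cont_plus; auto]. Qed.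

Lemma cont_pow f p : cont f -> cont (fun u => f u ^ p).
Proof. intros H. induction p; simpl; [apply cont_const | apply cont_mult; auto]. Qed.

Lemma dominated_nonneg K f : dominated K f -> 0 <= K.
Proof.
  intros H. specialize (H 0). pose proof (Rabs_pos (f 0)).
  replace (K / (1 + 0 ^ 2)) with K in H by (simpl; field). lra.
Qed.

(** Comparison with [K / u^2], whose antiderivative is [- K / u]. *)
Lemma RInt_tail K f p q A : cont f -> dominated K f -> 0 < A -> p <= q -> (A <= p \/ q <= - A) ->
  Rabs (RInt f p q) <= K / A.
Proof.
  intros Hc Hd HA Hpq Hs. pose proof (dominated_nonneg _ _ Hd) as HK.
  assert (Hne : forall u, p <= u <= q -> 0 < u ^ 2) by (intros u Hu; apply pow2_gt_0; lra).
  assert (I : is_RInt (fun u => K / u ^ 2) p q (minus (- K / q) (- K / p))).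
  { apply (is_RInt_derive (fun u => - K / u)); rewrite Rmin_left, Rmax_right by lra.
    - intros u Hu. auto_derive; [lra|].
      match goal with |- ?a = ?b => change (@eq R a b) end. field. lra.
    - intros u Hu. apply (ex_derive_continuous (fun u => K / u ^ 2)). auto_derive.
      specialize (Hne u Hu). simpl in Hne. lra. }
  apply Rle_trans with (RInt (fun u => K / u ^ 2) p q).
  - eapply Rle_trans; [apply abs_RInt_le; auto; apply cont_ex_RInt; auto|].
    apply RInt_le; auto.
    + apply (ex_RInt_norm f). apply cont_ex_RInt; auto.
    + eexists; exact I.
    + intros u Hu. eapply Rle_trans; [apply Hd|]. specialize (Hne u ltac:(lra)).
      apply Rmult_le_compat_l; auto. apply Rinv_le_contravar; lra.
  - rewrite (is_RInt_unique _ _ _ _ I). unfold minus, plus, opp; simpl.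
    assert (Hinv : 0 <= K / A) by (apply Rdiv_le_0_compat; auto).
    destruct Hs as [Hs|Hs].
    + assert (0 <= K / q) by (apply Rdiv_le_0_compat; lra).
      assert (K / p <= K / A) by (apply Rmult_le_compat_l; auto; apply Rinv_le_contravar; lra).
      unfold Rdiv in *. lra.
    + assert (0 <= K / - p) by (apply Rdiv_le_0_compat; lra).
      assert (K / - q <= K / A) by (apply Rmult_le_compat_l; auto; apply Rinv_le_contravar; lra).
      unfold Rdiv in *. rewrite Rinv_opp in *. lra.
Qed.

Lemma RInt_tails K f A a b : cont f -> dominated K f -> 0 < A -> a <= - A -> A <= b ->
  Rabs (RInt f a b - RInt f (- A) A) <= 2 * K / A.
Proof.
  intros Hc Hd HA Ha Hb.
  rewrite <- (RInt_Chasles (V := R_CompleteNormedModule) f a (- A) b) by (apply cont_ex_RInt; auto).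
  rewrite <- (RInt_Chasles (V := R_CompleteNormedModule) f (- A) A b) by (apply cont_ex_RInt; auto).
  pose proof (RInt_tail K f a (- A) A Hc Hd HA Ha ltac:(lra)) as T1.
  pose proof (RInt_tail K f A b A Hc Hd HA Hb ltac:(lra)) as T2.
  unfold plus; simpl. apply Rabs_le_between in T1. apply Rabs_le_between in T2. apply Rabs_le.
  unfold Rdiv in *. lra.
Qed.

Lemma isI_exists K f : cont f -> dominated K f -> exists l, isI f l.
Proof.
  intros Hc Hd. pose proof (dominated_nonneg _ _ Hd) as HK.
  set (x := fun n => RInt f (- INR (S n)) (INR (S n))).
  assert (P : forall n, 0 < INR (S n)) by (intros; apply lt_0_INR; lia).
  assert (Q : forall eps, 0 < eps -> exists N, forall n, (N <= n)%nat -> 2 * K / INR (S n) < eps).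
  { intros eps He. destruct (archimed_cor1 (eps / (2 * K + 1))) as (N & HN & HN0).
    { apply Rdiv_lt_0_compat; lra. }
    exists N. intros n Hn. assert (0 < INR N) by (apply lt_0_INR; lia).
    assert (/ INR (S n) <= / INR N) by (apply Rinv_le_contravar; auto; apply le_INR; lia).
    apply Rle_lt_trans with (2 * K * / INR N); [apply Rmult_le_compat_l; lra|].
    apply Rmult_lt_compat_l with (r := 2 * K + 1) in HN; [|lra].
    replace ((2 * K + 1) * (eps / (2 * K + 1))) with eps in HN by (field; lra).
    assert (0 < / INR N) by (apply Rinv_0_lt_compat; auto). lra. }
  assert (C : Cauchy_crit x).
  { intros eps He. destruct (Q (eps / 2)) as [N HN]; [lra|]. exists N. intros n m Hn Hm.
    assert (H : forall n, (N <= n)%nat -> Rabs (x n - x N) < eps / 2).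
    { intros k Hk. eapply Rle_lt_trans; [|apply (HN N); lia].
      apply RInt_tails; auto; [apply Ropp_le_contravar|]; apply le_INR; lia. }
    pose proof (H n Hn) as A1. pose proof (H m Hm) as A2. unfold Rdist.
    apply Rabs_def2 in A1. apply Rabs_def2 in A2. apply Rabs_def1; lra. }
  destruct (Rcomplete.R_complete x C) as [l Hl]. exists l. intros eps He.
  destruct (Hl (eps / 2) ltac:(lra)) as [N1 H1]. destruct (Q (eps / 2)) as [N2 H2]; [lra|].
  set (N := max N1 N2). exists (INR (S N)). intros a b Ha Hb.
  specialize (H1 N ltac:(lia)). specialize (H2 N ltac:(lia)). unfold Rdist in H1.
  pose proof (RInt_tails K f _ a b Hc Hd (P N) Ha Hb) as T. fold (x N) in T.
  apply Rabs_def2 in H1. apply Rabs_le_between in T. apply Rabs_def1; lra.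
Qed.

Lemma isI_unique f l l' : isI f l -> isI f l' -> l = l'.
Proof.
  intros H H'. destruct (Req_dec l l') as [|N]; auto. exfalso.
  assert (P : 0 < Rabs (l - l') / 2) by (assert (0 < Rabs (l - l')) by (apply Rabs_pos_lt; lra); lra).
  destruct (H _ P) as [A HA], (H' _ P) as [B HB]. set (M := Rmax A B).
  pose proof (Rmax_l A B). pose proof (Rmax_r A B). fold M in H0, H1.
  specialize (HA (- M) M ltac:(lra) ltac:(lra)). specialize (HB (- M) M ltac:(lra) ltac:(lra)).
  pose proof (Rabs_triang (RInt f (- M) M - l') (- (RInt f (- M) M - l))) as T.
  rewrite Rabs_Ropp in T. replace (RInt f (- M) M - l' + - (RInt f (- M) M - l)) with (l - l') in T by ring. lra.
Qed.

Lemma isI_ext f g l : (forall u, f u = g u) -> isI f l -> isI g l.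
Proof.
  intros E H eps He. destruct (H eps He) as [A HA]. exists A. intros a b Ha Hb.
  rewrite (RInt_ext g f); auto.
Qed.

Lemma isI_plus f g l m : cont f -> cont g -> isI f l -> isI g m -> isI (fun u => f u + g u) (l + m).
Proof.
  intros Cf Cg Hf Hg eps He.
  destruct (Hf (eps / 2)) as [A HA]; [lra|]. destruct (Hg (eps / 2)) as [B HB]; [lra|].
  exists (Rmax A B). intros a b Ha Hb. pose proof (Rmax_l A B). pose proof (Rmax_r A B).
  specialize (HA a b ltac:(lra) ltac:(lra)). specialize (HB a b ltac:(lra) ltac:(lra)).
  replace (RInt (fun u => f u + g u) a b) with (RInt f a b + RInt g a b).
  - apply Rabs_def2 in HA. apply Rabs_def2 in HB. apply Rabs_def1; lra.
  - symmetry. apply (RInt_plus (V := R_CompleteNormedModule) f g); apply cont_ex_RInt; auto.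
Qed.

Lemma isI_scal f c l : cont f -> isI f l -> isI (fun u => c * f u) (c * l).
Proof.
  intros Cf Hf eps He. pose proof (Rabs_pos c).
  destruct (Hf (eps / (Rabs c + 1))) as [A HA]; [apply Rdiv_lt_0_compat; lra|].
  exists A. intros a b Ha Hb. specialize (HA a b Ha Hb).
  replace (RInt (fun u => c * f u) a b) with (c * RInt f a b).
  - rewrite <- Rmult_minus_distr_l, Rabs_mult.
    apply Rmult_lt_compat_l with (r := Rabs c + 1) in HA; [|lra].
    replace ((Rabs c + 1) * (eps / (Rabs c + 1))) with eps in HA by (field; lra).
    pose proof (Rabs_pos (RInt f a b - l)). lra.
  - symmetry. apply (RInt_scal (V := R_CompleteNormedModule) f); apply cont_ex_RInt; auto.
Qed.

Lemma isI_0 : isI (fun _ => 0) 0.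
Proof.
  intros eps He. exists 0. intros a b _ _. rewrite RInt_const. unfold scal; simpl; unfold mult; simpl.
  rewrite Rmult_0_r, Rminus_diag, Rabs_R0. auto.
Qed.

Lemma isI_lsum {A} (f : A -> R -> R) (v : A -> R) l : (forall i, cont (f i)) ->
  (forall i, In i l -> isI (f i) (v i)) -> isI (fun u => lsum (fun i => f i u) l) (lsum v l).
Proof.
  intros C. induction l as [|i l IH]; intros H; simpl.
  - apply isI_0.
  - apply isI_plus; auto.
    + apply cont_lsum; auto.
    + apply H; simpl; auto.
    + apply IH; intros; apply H; simpl; auto.
Qed.

(** The interval [[-1,1]] contributes at most [2 K], and each of the two tails at most [K]. *)
Lemma isI_bound K f l : cont f -> dominated K f -> isI f l -> Rabs l <= 4 * K.
Proof.
  intros Hc Hd H. pose proof (dominated_nonneg _ _ Hd) as HK. apply le_epsilon. intros eps He.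
  destruct (H eps He) as [A HA]. pose proof (Rmax_l A 1). pose proof (Rmax_r A 1).
  specialize (HA (- Rmax A 1) (Rmax A 1) ltac:(lra) ltac:(lra)).
  pose proof (RInt_tails K f 1 (- Rmax A 1) (Rmax A 1) Hc Hd ltac:(lra) ltac:(lra) ltac:(lra)) as T.
  assert (B : Rabs (RInt f (- (1)) 1) <= (1 - - (1)) * K).
  { apply abs_RInt_le_const; [lra|apply cont_ex_RInt; auto|].
    intros t _. eapply Rle_trans; [apply Hd|]. pose proof (pow2_ge_0 t).
    rewrite <- (Rmult_1_r K) at 2. apply Rmult_le_compat_l; auto.
    rewrite <- Rinv_1. apply Rinv_le_contravar; lra. }
  apply Rabs_def2 in HA. apply Rabs_le_between in T. apply Rabs_le_between in B. apply Rabs_le. lra.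
Qed.

Lemma isI_primitive h f lm lp : cont f -> (forall u, is_derive h u (f u)) ->
  (forall eps, 0 < eps -> exists A, forall a b, a <= - A -> A <= b ->
     Rabs (h a - lm) < eps /\ Rabs (h b - lp) < eps) ->
  isI f (lp - lm).
Proof.
  intros C D H eps He. destruct (H (eps / 2)) as [A HA]; [lra|]. exists A. intros a b Ha Hb.
  destruct (HA a b Ha Hb) as [H1 H2].
  assert (I : is_RInt f a b (minus (h b) (h a))).
  { apply (is_RInt_derive h); auto. }
  rewrite (is_RInt_unique _ _ _ _ I). unfold minus, plus, opp; simpl.
  apply Rabs_def2 in H1. apply Rabs_def2 in H2. apply Rabs_def1; lra.
Qed.

(** * Domination *)

Lemma exp_pow_nat x n : exp x ^ n = exp (INR n * x).
Proof.
  induction n as [|n IH]; [simpl; rewrite Rmult_0_l, exp_0; auto|].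
  rewrite S_INR, Rmult_plus_distr_r, exp_plus, <- IH, Rmult_1_l. simpl. ring.
Qed.

(** The [N]-th power of [x <= (N / s) exp (s x / N)], which follows from [y <= exp y]. *)
Lemma pow_le_exp N s x : 0 < s -> 0 <= x -> x ^ N <= (INR N / s) ^ N * exp (s * x).
Proof.
  intros Hs Hx. destruct N as [|N].
  - simpl. assert (1 <= exp (s * x)); [|lra].
    pose proof (exp_ineq1_le (s * x)). assert (0 <= s * x) by (apply Rmult_le_pos; lra). lra.
  - assert (P : 0 < INR (S N)) by (apply lt_0_INR; lia). set (M := INR (S N)) in *.
    replace (exp (s * x)) with (exp (s * x / M) ^ (S N)).
    + rewrite <- Rpow_mult_distr. apply pow_incr. split; auto.
      apply Rle_trans with (M / s * (s * x / M)).
      * right. field. lra.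
      * apply Rmult_le_compat_l; [apply Rdiv_le_0_compat; lra|].
        pose proof (exp_ineq1_le (s * x / M)). lra.
    + rewrite exp_pow_nat. f_equal. fold M. field. lra.
Qed.

(** For [u <= 0] the factor [exp (s u)] absorbs the polynomial; for [u > 0] the double exponential
    does. Two extra powers of [1 + |u|] pay for the denominator [1 + u^2]. *)
Lemma weight_dominated m s c : 0 < s -> 0 < c -> exists K, 0 <= K /\
  forall u, (1 + Rabs u) ^ m * exp (s * u) * exp (- (c * exp u)) <= K / (1 + u ^ 2).
Proof.
  intros Hs Hc. set (M := S (S m)).
  (* For [u > 0] the power [exp (N u)] has to cover [exp (s u)] and one more [exp u], which bounds
     the polynomial. *)
  destruct (INR_unbounded (s + 1)) as [N HN].
  set (K1 := (INR M / s) ^ M * exp s).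
  set (K2 := (INR M / 1) ^ M * exp 1 * (INR N / c) ^ N).
  assert (P1 : 0 <= K1).
  { apply Rmult_le_pos; [apply pow_le, Rdiv_le_0_compat; auto; apply pos_INR | left; apply exp_pos]. }
  assert (P2 : 0 <= K2).
  { apply Rmult_le_pos; [apply Rmult_le_pos; [|left; apply exp_pos]|];
      apply pow_le, Rdiv_le_0_compat; try lra; apply pos_INR. }
  exists (K1 + K2). split; [lra|]. intros u.
  pose proof (Rabs_pos u) as Hu0. pose proof (pow2_ge_0 u) as Hu2.
  apply Rmult_le_reg_r with (1 + u ^ 2); [lra|].
  replace ((K1 + K2) / (1 + u ^ 2) * (1 + u ^ 2)) with (K1 + K2) by (field; lra).
  apply Rle_trans with ((1 + Rabs u) ^ M * exp (s * u) * exp (- (c * exp u))).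
  - assert (1 + u ^ 2 <= (1 + Rabs u) ^ 2).
    { rewrite <- (pow2_abs u). simpl. nra. }
    unfold M. replace ((1 + Rabs u) ^ S (S m)) with ((1 + Rabs u) ^ m * (1 + Rabs u) ^ 2) by (simpl; ring).
    set (E := exp (s * u) * exp (- (c * exp u))).
    assert (0 <= (1 + Rabs u) ^ m * E).
    { apply Rmult_le_pos; [apply pow_le; lra|]. unfold E. left. apply Rmult_lt_0_compat; apply exp_pos. }
    unfold E in *. nra.
  - pose proof (exp_pos (s * u)). pose proof (exp_pos (- (c * exp u))). pose proof (exp_pos u).
    destruct (Rle_dec u 0) as [L|L].
    + apply Rle_trans with K1; [|lra].
      assert (exp (- (c * exp u)) <= 1).
      { rewrite <- exp_0. left. apply exp_increasing. assert (0 < c * exp u) by (apply Rmult_lt_0_compat; auto). lra. }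
      rewrite Rabs_left1 by auto.
      pose proof (pow_le_exp M s (1 + - u) Hs ltac:(lra)) as Q.
      replace (s * (1 + - u)) with (s + - (s * u)) in Q by ring. rewrite exp_plus, exp_Ropp in Q.
      assert (0 <= (1 + - u) ^ M) by (apply pow_le; lra).
      apply Rle_trans with ((1 + - u) ^ M * exp (s * u) * 1).
      * apply Rmult_le_compat_l; auto. apply Rmult_le_pos; lra.
      * rewrite Rmult_1_r. apply Rmult_le_compat_r with (r := exp (s * u)) in Q; [|lra].
        eapply Rle_trans; [exact Q|]. unfold K1. right. field. lra.
    + apply Rle_trans with K2; [|lra].
      rewrite Rabs_pos_eq by lra.
      pose proof (pow_le_exp M 1 (1 + u) ltac:(lra) ltac:(lra)) as Q.
      rewrite Rmult_1_l, exp_plus in Q.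
      pose proof (pow_le_exp N c (exp u) Hc ltac:(lra)) as Q'.
      rewrite exp_pow_nat in Q'.
      set (A := (INR M / 1) ^ M) in *. set (B := (INR N / c) ^ N) in *.
      assert (PA : 0 <= A) by (apply pow_le, Rdiv_le_0_compat; try lra; apply pos_INR).
      assert (F : exp u * exp (s * u) <= exp (INR N * u)).
      { rewrite <- exp_plus. destruct (Req_dec (u + s * u) (INR N * u)) as [->|Ne]; [lra|].
        left. apply exp_increasing. nra. }
      pose proof (exp_pos 1) as E1.
      apply Rle_trans with (A * exp 1 * (exp (INR N * u) * exp (- (c * exp u)))).
      * apply Rle_trans with (A * (exp 1 * exp u) * (exp (s * u) * exp (- (c * exp u)))).
        -- rewrite Rmult_assoc. apply Rmult_le_compat_r; auto. apply Rmult_le_pos; lra.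
        -- replace (A * (exp 1 * exp u) * (exp (s * u) * exp (- (c * exp u))))
             with (A * exp 1 * ((exp u * exp (s * u)) * exp (- (c * exp u)))) by ring.
           apply Rmult_le_compat_l; [apply Rmult_le_pos; lra|]. apply Rmult_le_compat_r; lra.
      * unfold K2. fold A. fold B. apply Rmult_le_compat_l; [apply Rmult_le_pos; lra|].
        apply Rmult_le_reg_r with (exp (c * exp u)); [apply exp_pos|].
        rewrite Rmult_assoc, <- exp_plus. rewrite Rplus_opp_l, exp_0, Rmult_1_r.
        exact Q'.
Qed.

(** * Derivatives of the Gamma function *)

Definition gweight (m : nat) (s u : R) : R := u ^ m * (exp (s * u) * exp (- exp u)).

(* With [t = exp u], this is the integral of [t^(s-1) (ln t)^m exp(-t)] over [t > 0]. *)
Definition GI (m : nat) (s : R) : R := epsilon (inhabits 0) (isI (gweight m s)).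

Lemma cont_diff (f : R -> R) : (forall u, ex_derive f u) -> cont f.
Proof. intros H u. apply (ex_derive_continuous f); auto. Qed.

Lemma cont_gweight m s : cont (gweight m s).
Proof. apply cont_diff. intros u. unfold gweight. auto_derive. auto. Qed.

Lemma gweight_dominated m s : 0 < s -> exists K, dominated K (gweight m s).
Proof.
  intros Hs. destruct (weight_dominated m s 1 Hs ltac:(lra)) as (K & _ & HK). exists K.
  intros u. unfold gweight. eapply Rle_trans; [|apply HK]. rewrite Rmult_1_l.
  pose proof (exp_pos (s * u)). pose proof (exp_pos (- exp u)).
  rewrite !Rabs_mult, (Rabs_pos_eq (exp (s * u))), (Rabs_pos_eq (exp (- exp u))), <- RPow_abs, Rmult_assoc by lra.
  apply Rmult_le_compat_r; [left; apply Rmult_lt_0_compat; auto|].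
  apply pow_incr. pose proof (Rabs_pos u). lra.
Qed.

Lemma isI_GI m s : 0 < s -> isI (gweight m s) (GI m s).
Proof.
  intros Hs. unfold GI. apply epsilon_spec.
  destruct (gweight_dominated m s Hs) as [K HK]. apply isI_exists with K; auto. apply cont_gweight.
Qed.

Lemma improper_int_unique f v w : improper_int_0_inf f v -> improper_int_0_inf f w -> v = w.
Proof.
  intros Hv Hw. destruct (Req_dec v w) as [|N]; auto. exfalso.
  assert (P : 0 < Rabs (v - w) / 2) by (assert (0 < Rabs (v - w)) by (apply Rabs_pos_lt; lra); lra).
  destruct (Hv _ P) as (a1 & b1 & Ha1 & H1), (Hw _ P) as (a2 & b2 & Ha2 & H2).
  set (a := Rmin a1 a2). set (b := Rmax b1 b2).
  assert (0 < a <= a1 /\ a <= a2) as [Ea Ea'].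
  { unfold a. pose proof (Rmin_l a1 a2). pose proof (Rmin_r a1 a2). pose proof (Rmin_glb_lt a1 a2 0). lra. }
  destruct (H1 a b Ea (Rmax_l _ _)) as [p1 Q1]. destruct (H2 a b ltac:(lra) (Rmax_r _ _)) as [p2 Q2].
  rewrite (RiemannInt_P5 p2 p1) in Q2.
  pose proof (Rabs_triang (- (RiemannInt p1 - v)) (RiemannInt p1 - w)) as T. rewrite Rabs_Ropp in T.
  replace (- (RiemannInt p1 - v) + (RiemannInt p1 - w)) with (v - w) in T by ring. lra.
Qed.

(** The substitution [t = exp u] carries [(0, oo)] to the real line; the limits [- A] and [A] become
    [exp (- A)] and [exp A]. *)
Lemma Gamma_GI s : 0 < s -> Gamma s = GI 0 s.
Proof.
  intros Hs. set (f := fun t => Rpower t (s - 1) * exp (- t)).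
  assert (H : improper_int_0_inf f (GI 0 s)).
  { intros eps He. destruct (isI_GI 0 s Hs eps He) as [A HA].
    exists (exp (- A)), (exp A). split; [apply exp_pos|]. intros a b [Ha0 Ha] Hb.
    assert (Hb0 : 0 < b) by (pose proof (exp_pos A); lra).
    assert (La : ln a <= - A) by (rewrite <- (ln_exp (- A)); apply ln_le; auto).
    assert (Lb : A <= ln b) by (rewrite <- (ln_exp A); apply ln_le; auto; apply exp_pos).
    specialize (HA _ _ La Lb).
    assert (Cf : forall t, 0 < t -> continuous f t).
    { intros t Ht. apply (ex_derive_continuous f). unfold f, Rpower. auto_derive. auto. }
    assert (Ex : ex_RInt f a b).
    { apply (ex_RInt_continuous (V := R_CompleteNormedModule)). intros t [Ht _]. apply Cf.
      pose proof (Rmin_glb_lt a b 0 Ha0 Hb0). lra. }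
    exists (ex_RInt_Reals_0 _ _ _ Ex). rewrite <- RInt_Reals.
    rewrite <- (exp_ln a), <- (exp_ln b) by auto.
    rewrite <- (RInt_comp (V := R_CompleteNormedModule) f exp exp).
    - rewrite (RInt_ext _ (gweight 0 s)); auto. intros u _. unfold gweight, f, Rpower.
      rewrite ln_exp. unfold scal; simpl; unfold mult; simpl. rewrite Rmult_1_l, <- Rmult_assoc, <- exp_plus.
      do 2 f_equal. ring.
    - intros u _. apply Cf, exp_pos.
    - intros u _. split; [apply is_derive_Reals, derivable_pt_lim_exp|].
      apply (ex_derive_continuous exp). auto_derive. auto. }
  apply (improper_int_unique f); auto.
  change (improper_int_0_inf f (epsilon (inhabits 0) (improper_int_0_inf f))).
  apply epsilon_spec. eauto.
Qed.

Lemma exp_taylor1 x : Rabs (exp x - 1 - x) <= x ^ 2 * exp (Rabs x).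
Proof.
  pose proof (exp_ineq1_le x) as E1. pose proof (exp_ineq1_le (- x)) as E2.
  assert (E3 : exp x * exp (- x) = 1) by (rewrite <- exp_plus, Rplus_opp_r; apply exp_0).
  pose proof (exp_pos x) as P1. pose proof (exp_pos (- x)) as P2.
  (* This is [1 - x <= exp (- x)] multiplied by [exp x]. *)
  assert (U : exp x - 1 <= x * exp x) by nra.
  rewrite Rabs_pos_eq by lra. destruct (Rle_dec 0 x) as [L|L].
  - rewrite Rabs_pos_eq by auto. simpl. nra.
  - rewrite Rabs_left by lra. assert (exp x - 1 - x <= x ^ 2) by nra.
    assert (1 <= exp (- x)) by lra. pose proof (pow2_ge_0 x). nra.
Qed.

(** Differentiation under the integral sign, quantitatively: the second-order remainder of
    [exp (h u)] makes the difference quotient minus the derivative an integral dominated with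
    constant [|h| K]. *)
Lemma GI_derive m y : 0 < y -> derivable_pt_lim (GI m) y (GI (S m) y).
Proof.
  intros Hy.
  (* With [|h| <= y / 2] the remainder brings in [u^2] and [exp (y |u| / 2)]; bounding the latter by
     [exp (y u / 2) + exp (- y u / 2)] turns the exponent [y] into [3 y / 2] and [y / 2]. *)
  destruct (weight_dominated (S (S m)) (3 * y / 2) 1 ltac:(lra) ltac:(lra)) as (K1 & P1 & HK1).
  destruct (weight_dominated (S (S m)) (y / 2) 1 ltac:(lra) ltac:(lra)) as (K2 & P2 & HK2).
  set (K := K1 + K2).
  assert (Q : forall h, h <> 0 -> Rabs h <= y / 2 ->
    Rabs ((GI m (y + h) - GI m y) / h - GI (S m) y) <= Rabs h * (4 * K)).
  { intros h Hh Hhy. assert (Hyh : 0 < y + h) by (apply Rabs_le_between in Hhy; lra).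
    pose proof (Rabs_pos_lt h Hh) as Hh0.
    set (f := fun u => / h * (gweight m (y + h) u + (-1) * gweight m y u) + (-1) * gweight (S m) y u).
    assert (C1 : cont (fun u => gweight m (y + h) u + (-1) * gweight m y u)).
    { apply cont_plus; [apply cont_gweight | apply cont_mult; [apply cont_const | apply cont_gweight]]. }
    assert (C2 : cont f).
    { apply cont_plus; apply cont_mult; try apply cont_const; auto. apply cont_gweight. }
    assert (If : isI f (/ h * (GI m (y + h) + (-1) * GI m y) + (-1) * GI (S m) y)).
    { apply isI_plus.
      - apply cont_mult; auto. apply cont_const.
      - apply cont_mult; [apply cont_const | apply cont_gweight].
      - apply isI_scal; auto. apply isI_plus; try apply cont_gweight.
        + apply cont_mult; [apply cont_const | apply cont_gweight].
        + apply isI_GI; auto.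
        + apply isI_scal; [apply cont_gweight | apply isI_GI; auto].
      - apply isI_scal; [apply cont_gweight | apply isI_GI; auto]. }
    replace ((GI m (y + h) - GI m y) / h - GI (S m) y)
      with (/ h * (GI m (y + h) + (-1) * GI m y) + (-1) * GI (S m) y) by (field; auto).
    replace (Rabs h * (4 * K)) with (4 * (Rabs h * K)) by ring.
    apply isI_bound with f; auto. intros u.
    set (W := exp (y * u) * exp (- exp u)).
    assert (PW : 0 < W) by (apply Rmult_lt_0_compat; apply exp_pos).
    assert (Ef : f u = u ^ m * W * ((exp (h * u) - 1 - h * u) / h)).
    { unfold f, gweight, W. replace ((y + h) * u) with (y * u + h * u) by ring.
      rewrite exp_plus. simpl. field. auto. }
    rewrite Ef, !Rabs_mult, (Rabs_pos_eq W) by lra.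
    assert (B : Rabs ((exp (h * u) - 1 - h * u) / h) <= Rabs h * (u ^ 2 * exp (y / 2 * Rabs u))).
    { unfold Rdiv. rewrite Rabs_mult, Rabs_inv.
      apply Rmult_le_reg_r with (Rabs h); auto. rewrite Rmult_assoc, Rinv_l, Rmult_1_r by lra.
      eapply Rle_trans; [apply exp_taylor1|].
      apply Rle_trans with ((h * u) ^ 2 * exp (y / 2 * Rabs u)).
      - apply Rmult_le_compat_l; [apply pow2_ge_0|].
        assert (Rabs (h * u) <= y / 2 * Rabs u).
        { rewrite Rabs_mult. apply Rmult_le_compat_r; auto. apply Rabs_pos. }
        destruct (Req_dec (Rabs (h * u)) (y / 2 * Rabs u)) as [->|]; [lra|].
        left. apply exp_increasing. lra.
      - right. rewrite Rpow_mult_distr, <- (pow2_abs h). simpl. unfold Rdiv. ring. }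
    assert (Ex : exp (y / 2 * Rabs u) <= exp (y / 2 * u) + exp (- (y / 2 * u))).
    { pose proof (exp_pos (y / 2 * u)). pose proof (exp_pos (- (y / 2 * u))).
      unfold Rabs. destruct (Rcase_abs u); [replace (y / 2 * - u) with (- (y / 2 * u)) by ring|]; lra. }
    set (V := (1 + Rabs u) ^ S (S m)).
    assert (HV : Rabs (u ^ m) * u ^ 2 <= V).
    { rewrite <- (pow2_abs u), <- RPow_abs, <- pow_add. replace (m + 2)%nat with (S (S m)) by lia.
      apply pow_incr. pose proof (Rabs_pos u). lra. }
    assert (PV : 0 <= V) by (apply pow_le; pose proof (Rabs_pos u); lra).
    apply Rle_trans with (Rabs h * (V * exp (3 * y / 2 * u) * exp (- (1 * exp u)) + V * exp (y / 2 * u) * exp (- (1 * exp u)))).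
    - apply Rle_trans with (Rabs (u ^ m) * W * (Rabs h * (u ^ 2 * exp (y / 2 * Rabs u)))).
      + apply Rmult_le_compat_l; auto. apply Rmult_le_pos; [apply Rabs_pos | lra].
      + replace (Rabs (u ^ m) * W * (Rabs h * (u ^ 2 * exp (y / 2 * Rabs u))))
          with (Rabs h * ((Rabs (u ^ m) * u ^ 2) * (W * exp (y / 2 * Rabs u)))) by ring.
        apply Rmult_le_compat_l; [lra|].
        apply Rle_trans with (V * (W * (exp (y / 2 * u) + exp (- (y / 2 * u))))).
        * apply Rmult_le_compat; auto.
          -- apply Rmult_le_pos; [apply Rabs_pos | apply pow2_ge_0].
          -- apply Rmult_le_pos; [lra | left; apply exp_pos].
          -- apply Rmult_le_compat_l; lra.
        * right. unfold W. rewrite Rmult_1_l.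
          replace (3 * y / 2 * u) with (y * u + y / 2 * u) by field.
          replace (y / 2 * u) with (y * u + - (y / 2 * u)) at 4 by field.
          rewrite !exp_plus. ring.
    - replace (Rabs h * K / (1 + u ^ 2)) with (Rabs h * (K1 / (1 + u ^ 2) + K2 / (1 + u ^ 2)))
        by (unfold K, Rdiv; ring).
      apply Rmult_le_compat_l; [lra|]. apply Rplus_le_compat; [apply HK1 | apply HK2]. }
  intros eps He. assert (PK : 0 <= K) by (unfold K; lra).
  assert (Pd : 0 < Rmin (y / 2) (eps / (4 * K + 1))).
  { apply Rmin_glb_lt; [lra | apply Rdiv_lt_0_compat; lra]. }
  exists (mkposreal _ Pd). intros h Hh Hd. simpl in Hd.
  pose proof (Rmin_l (y / 2) (eps / (4 * K + 1))). pose proof (Rmin_r (y / 2) (eps / (4 * K + 1))).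
  eapply Rle_lt_trans; [apply Q; auto; lra|].
  assert (Hd' : Rabs h < eps / (4 * K + 1)) by lra.
  apply Rmult_lt_compat_r with (r := 4 * K + 1) in Hd'; [|lra].
  replace (eps / (4 * K + 1) * (4 * K + 1)) with eps in Hd' by (field; lra).
  pose proof (Rabs_pos_lt h Hh). lra.
Qed.

Lemma derivable_pt_lim_ext_pos f g y l : 0 < y -> (forall x, 0 < x -> f x = g x) ->
  derivable_pt_lim f y l -> derivable_pt_lim g y l.
Proof.
  intros Hy E H. apply is_derive_Reals. apply is_derive_Reals in H.
  apply is_derive_ext_loc with f; auto.
  exists (mkposreal y Hy). intros x Hx. apply E.
  apply Rabs_def2 in Hx. unfold minus, plus, opp in Hx; simpl in Hx. lra.
Qed.

(** An equivalence, since [epsilon] needs existence and uniqueness. The function [f] is known only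
    on the positive axis, and so are the intermediate derivatives [g] in [kth_deriv_pos], so the
    induction is over all functions agreeing with [GI m] there. *)
Lemma kth_deriv_GI k : forall m f x v, 0 < x -> (forall y, 0 < y -> f y = GI m y) ->
  kth_deriv_pos k f x v <-> v = GI (m + k) x.
Proof.
  induction k as [|k IH]; intros m f x v Hx Hf; simpl.
  - rewrite Nat.add_0_r, Hf by auto. tauto.
  - replace (m + S k)%nat with (S m + k)%nat by lia. split.
    + intros (g & Hg & H). apply (IH (S m) g) in H; auto. intros y Hy.
      apply (uniqueness_limite (GI m) y); [|apply GI_derive; auto].
      apply derivable_pt_lim_ext_pos with f; auto.
    + intros ->. exists (GI (S m)). split.
      * intros y Hy. apply derivable_pt_lim_ext_pos with (GI m); auto.
        -- intros; symmetry; auto.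
        -- apply GI_derive; auto.
      * apply (IH (S m)); auto.
Qed.

Lemma Gamma_deriv_GI k s : 0 < s -> Gamma_deriv k s = GI k s.
Proof.
  intros Hs. apply (kth_deriv_GI k 0 Gamma s); auto using Gamma_GI.
  unfold Gamma_deriv. apply epsilon_spec. exists (GI k s).
  apply (kth_deriv_GI k 0 Gamma s); auto using Gamma_GI.
Qed.

Lemma GI_0_1 : GI 0 1 = 1.
Proof.
  apply isI_unique with (gweight 0 1); [apply isI_GI; lra|].
  replace 1 with (0 - - 1) at 2 by ring.
  apply isI_primitive with (fun u => - exp (- exp u)).
  - apply cont_gweight.
  - intros u. unfold gweight. auto_derive; auto.
    match goal with |- ?a = ?b => change (@eq R a b) end. simpl. rewrite (Rmult_1_l u). ring.
  - intros eps He. exists (1 + / eps). intros a b Ha Hb.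
    assert (Pe : 0 < / eps) by (apply Rinv_0_lt_compat; auto).
    assert (Small : forall x, 1 + / eps <= x -> exp (- x) < eps).
    { intros x Hx. rewrite exp_Ropp. pose proof (exp_ineq1_le x).
      rewrite <- (Rinv_inv eps) at 1. apply Rinv_lt_contravar; [apply Rmult_lt_0_compat; [auto|apply exp_pos]|]. lra. }
    split.
    + replace (- exp (- exp a) - -1) with (1 - exp (- exp a)) by ring.
      pose proof (exp_ineq1_le (- exp a)). specialize (Small (- a) ltac:(lra)). rewrite Ropp_involutive in Small.
      assert (exp (- exp a) <= 1).
      { rewrite <- exp_0. left. apply exp_increasing. pose proof (exp_pos a). lra. }
      rewrite Rabs_pos_eq; lra.
    + rewrite Rminus_0_r, Rabs_Ropp, Rabs_pos_eq by (left; apply exp_pos).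
      apply Small. pose proof (exp_ineq1_le b). lra.
Qed.

(** [gweight 0 s] is an antiderivative of [s gweight 0 s - gweight 0 (s + 1)] and tends to [0] at
    both ends. *)
Lemma GI_0_S s : 0 < s -> GI 0 (s + 1) = s * GI 0 s.
Proof.
  intros Hs. apply Rminus_diag_uniq.
  destruct (gweight_dominated 0 s Hs) as [K HK]. pose proof (dominated_nonneg _ _ HK) as PK.
  assert (I : isI (fun u => s * gweight 0 s u + (-1) * gweight 0 (s + 1) u) (0 - 0)).
  { apply isI_primitive with (gweight 0 s).
    - apply cont_plus; apply cont_mult; try apply cont_const; apply cont_gweight.
    - intros u. unfold gweight. auto_derive; auto.
      match goal with |- ?a = ?b => change (@eq R a b) end.
      replace ((s + 1) * u) with (s * u + u) by ring. rewrite exp_plus. simpl. ring.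
    - intros eps He. exists (1 + K / eps). intros a b Ha Hb.
      assert (0 <= K / eps) by (apply Rdiv_le_0_compat; auto).
      assert (Small : forall x, 1 + K / eps <= Rabs x -> Rabs (gweight 0 s x - 0) < eps).
      { intros x Hx. rewrite Rminus_0_r. eapply Rle_lt_trans; [apply HK|].
        rewrite <- (pow2_abs x). set (X := Rabs x) in *.
        apply Rmult_lt_reg_r with (1 + X ^ 2); [pose proof (pow2_ge_0 X); lra|].
        unfold Rdiv. rewrite Rmult_assoc, Rinv_l, Rmult_1_r by (pose proof (pow2_ge_0 X); lra).
        apply Rmult_le_compat_l with (r := eps) in Hx; [|lra].
        replace (eps * (1 + K / eps)) with (eps + K) in Hx by (field; lra).
        assert (X <= 1 + X ^ 2) by (simpl; nra). nra. }
      split; apply Small.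
      + rewrite Rabs_left1; lra.
      + rewrite Rabs_pos_eq; lra. }
  rewrite Rminus_diag in I.
  assert (I' : isI (fun u => s * gweight 0 s u + (-1) * gweight 0 (s + 1) u) (s * GI 0 s + (-1) * GI 0 (s + 1))).
  { apply isI_plus; try (apply cont_mult; try apply cont_const; apply cont_gweight);
      apply isI_scal; try apply cont_gweight; apply isI_GI; lra. }
  pose proof (isI_unique _ _ _ I I'). lra.
Qed.

Lemma GI_0_fact n : GI 0 (INR (S n)) = INR (fact n).
Proof.
  induction n as [|n IH]; [simpl; apply GI_0_1|].
  rewrite S_INR, GI_0_S by (apply lt_0_INR; lia). rewrite IH, <- mult_INR. reflexivity.
Qed.

(** * Integral representation of the moments *)

(** The antiderivative of [exp (c u) (L - u)^m] given by repeated integration by parts. *)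
Fixpoint Phi (c L : R) (m : nat) (u : R) : R :=
  match m with
  | O => / c * exp (c * u)
  | S m' => / c * (exp (c * u) * (L - u) ^ S m' + INR (S m') * Phi c L m' u)
  end.

Lemma Phi_derive c L m u : c <> 0 -> is_derive (Phi c L m) u (exp (c * u) * (L - u) ^ m).
Proof.
  intros Hc. induction m as [|m IH].
  - cbn [Phi]. auto_derive; auto. match goal with |- ?a = ?b => change (@eq R a b) end. simpl. field. auto.
  - cbn [Phi].
    assert (D : is_derive (fun u => exp (c * u) * (L - u) ^ S m) u
      (c * exp (c * u) * (L - u) ^ S m - exp (c * u) * (INR (S m) * (L - u) ^ m))).
    { auto_derive; auto. change (match m with 0%nat => 1 | S _ => INR m + 1 end) with (INR (S m)).
      match goal with |- ?a = ?b => change (@eq R a b) end. simpl pow. unfold Rminus. ring. }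
    pose proof (is_derive_scal _ _ (INR (S m)) _ IH) as D2.
    pose proof (is_derive_plus (V := R_NormedModule) _ _ _ _ _ D D2) as D3.
    pose proof (is_derive_scal _ _ (/ c) _ D3) as D4.
    eapply is_derive_ext; [|eapply (eq_ind _ (is_derive _ u) D4)].
    + intros t. reflexivity.
    + match goal with |- ?a = ?b => change (@eq R a b) end. unfold plus; simpl plus.
      change (/ c * (c * exp (c * u) * (L - u) ^ S m - exp (c * u) * (INR (S m) * (L - u) ^ m) + INR (S m) * (exp (c * u) * (L - u) ^ m)) = exp (c * u) * (L - u) ^ S m).
      field. auto.
Qed.

Lemma Phi_L c L m : c <> 0 -> Phi c L m L = exp (c * L) * INR (fact m) / c ^ S m.
Proof.
  intros Hc. induction m as [|m IH].
  - simpl. field. auto.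
  - cbn [Phi]. rewrite IH, Rminus_diag, pow_i by lia.
    change (fact (S m)) with (S m * fact m)%nat. rewrite mult_INR. simpl pow. field.
    split; auto. apply pow_nonzero; auto.
Qed.

(** One more factor [L - u >= - u] is still absorbed by the exponential, because
    [exp (c u) exp (c (L - u))] is the constant [exp (c L)]. *)
Lemma Phi_bound c L m : 0 < c -> 0 <= L -> exists K, 0 <= K /\ forall u, u < 0 -> Rabs (Phi c L m u) <= K / - u.
Proof.
  intros Hc HL. pose proof (Rinv_0_lt_compat c Hc) as Hi.
  assert (E : forall m u, u < 0 -> Rabs (exp (c * u) * (L - u) ^ m) <= (INR (S m) / c) ^ S m * exp (c * L) / - u).
  { intros p u Hu. pose proof (exp_pos (c * u)).
    rewrite Rabs_pos_eq by (apply Rmult_le_pos; [lra | apply pow_le; lra]).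
    set (X := (INR (S p) / c) ^ S p * exp (c * L)).
    apply Rmult_le_reg_r with (- u); [lra|]. replace (X / - u * - u) with X by (field; lra).
    apply Rle_trans with (exp (c * u) * (L - u) ^ S p).
    - rewrite Rmult_assoc. apply Rmult_le_compat_l; [lra|]. simpl. rewrite Rmult_comm.
      apply Rmult_le_compat_r; [apply pow_le; lra | lra].
    - pose proof (pow_le_exp (S p) c (L - u) Hc ltac:(lra)) as Q.
      apply Rmult_le_compat_l with (r := exp (c * u)) in Q; [|lra].
      eapply Rle_trans; [exact Q|]. right. unfold X.
      replace (c * L) with (c * u + c * (L - u)) by ring. rewrite exp_plus. ring. }
  induction m as [|m (K & PK & IH)].
  - exists (/ c * ((INR 1 / c) ^ 1 * exp (c * L))). split.
    + apply Rmult_le_pos; [lra|]. apply Rmult_le_pos; [|left; apply exp_pos].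
      apply pow_le, Rdiv_le_0_compat; auto. apply pos_INR.
    + intros u Hu. specialize (E 0%nat u Hu). rewrite pow_O, Rmult_1_r in E. cbn [Phi].
      rewrite Rabs_mult, (Rabs_pos_eq (/ c)) by lra. unfold Rdiv at 1. rewrite Rmult_assoc.
      apply Rmult_le_compat_l; [lra|]. exact E.
  - set (K0 := (INR (S (S m)) / c) ^ S (S m) * exp (c * L)).
    assert (P0 : 0 <= K0).
    { apply Rmult_le_pos; [|left; apply exp_pos]. apply pow_le, Rdiv_le_0_compat; auto. apply pos_INR. }
    pose proof (pos_INR (S m)) as PS.
    exists (/ c * (K0 + INR (S m) * K)). split.
    + apply Rmult_le_pos; [lra|]. assert (0 <= INR (S m) * K) by (apply Rmult_le_pos; auto). lra.
    + intros u Hu. specialize (E (S m) u Hu). specialize (IH u Hu). cbn [Phi].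
      rewrite Rabs_mult, (Rabs_pos_eq (/ c)) by lra.
      replace (/ c * (K0 + INR (S m) * K) / - u) with (/ c * (K0 / - u + INR (S m) * (K / - u))) by (field; lra).
      apply Rmult_le_compat_l; [lra|]. eapply Rle_trans; [apply Rabs_triang|].
      apply Rplus_le_compat; [exact E|]. rewrite Rabs_mult, (Rabs_pos_eq (INR (S m))) by auto.
      apply Rmult_le_compat_l; auto.
Qed.

Definition pospart (x : R) : R := (x + Rabs x) / 2.

(** [n^k p^(k-1) (1-p)^(n-k) (- ln p)^(k-1) dp] after [p = exp u / n]. The positive part replaces
    the upper limit [p = 1] by an integrand that vanishes for [u >= ln n] and stays continuous when
    [k < n]. *)
Definition mweight (n k : nat) (u : R) : R :=
  exp (INR k * u) * pospart (1 - exp u / INR n) ^ (n - k) * (ln (INR n) - u) ^ (k - 1).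

Lemma cont_mweight n k : cont (mweight n k).
Proof.
  assert (C1 : cont (fun u => 1 - exp u / INR n)).
  { apply cont_diff. intros u. auto_derive. auto. }
  unfold mweight. apply cont_mult; [apply cont_mult|].
  - apply cont_diff. intros u. auto_derive. auto.
  - apply cont_pow. unfold pospart, Rdiv. apply cont_mult; [|apply cont_const].
    apply cont_plus; auto. intros u. apply (continuous_comp (fun u => 1 - exp u / INR n) Rabs); auto.
    apply continuous_Rabs.
  - apply cont_diff. intros u. auto_derive. auto.
Qed.

Lemma is_derive_lsum {A} (f : A -> R -> R) (df : A -> R) l u :
  (forall i, In i l -> is_derive (f i) u (df i)) ->
  is_derive (fun u => lsum (fun i => f i u) l) u (lsum df l).
Proof.
  induction l as [|i l IH]; intros H; simpl.
  - apply (is_derive_const 0 u).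
  - apply (is_derive_plus (V := R_NormedModule) (f i)); [apply H; simpl; auto | apply IH; intros; apply H; simpl; auto].
Qed.

(** On [u <= ln n] the power of [1 - exp u / n] is expanded, and each term has an antiderivative
    [Phi] tending to [0] at minus infinity. The values at [ln n] reproduce the sum defining
    [moment], since the integral of [p^(k+i-1) (- ln p)^(k-1)] over [[0,1]] is
    [(k-1)! / (k+i)^k]. *)
Lemma isI_mweight n k : (1 <= k)%nat -> (k < n)%nat ->
  isI (mweight n k) (INR n ^ k * INR (fact (k - 1)) * moment n k).
Proof.
  intros Hk Hkn. set (L := ln (INR n)).
  assert (Pn : 0 < INR n) by (apply lt_0_INR; lia).
  assert (EL : exp L = INR n) by (apply exp_ln; auto).
  assert (HL : 0 <= L).
  { unfold L. rewrite <- ln_1. apply ln_le; [lra|]. apply (le_INR 1). lia. }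
  set (coef := fun i => Binomial.C (n - k) i * (-1) ^ i * (/ INR n) ^ i).
  set (s := seq 0 (S (n - k))).
  set (T := fun u => lsum (fun i => coef i * Phi (INR (k + i)) L (k - 1) u) s).
  assert (Pc : forall i, 0 < INR (k + i)) by (intros; apply lt_0_INR; lia).
  assert (E1 : forall u, u <= L -> mweight n k u = lsum (fun i => coef i * (exp (INR (k + i) * u) * (L - u) ^ (k - 1))) s).
  { intros u Hu. unfold mweight. fold L.
    assert (Pp : 0 <= 1 - exp u / INR n).
    { assert (exp u <= INR n).
      { rewrite <- EL. destruct (Req_dec u L) as [->|]; [lra|]. left. apply exp_increasing. lra. }
      apply Rmult_le_reg_r with (INR n); auto. rewrite Rmult_0_l. unfold Rdiv.
      replace ((1 - exp u * / INR n) * INR n) with (INR n - exp u) by (field; lra). lra. }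
    unfold pospart. rewrite Rabs_pos_eq by auto.
    replace ((1 - exp u / INR n + (1 - exp u / INR n)) / 2) with (- (exp u / INR n) + 1) by (field; lra).
    rewrite Binomial.binomial, lsum_sum_f_R0. fold s.
    rewrite Rmult_comm, <- Rmult_assoc, <- lsum_scal. apply lsum_ext. intros i _.
    rewrite pow1. unfold coef. replace (- (exp u / INR n)) with (-1 * (exp u * / INR n)) by (unfold Rdiv; ring).
    rewrite !Rpow_mult_distr, exp_pow_nat, plus_INR, Rmult_plus_distr_r, exp_plus. ring. }
  assert (D : forall u, is_derive T u (lsum (fun i => coef i * (exp (INR (k + i) * u) * (L - u) ^ (k - 1))) s)).
  { intros u. apply (is_derive_lsum (fun i u => coef i * Phi (INR (k + i)) L (k - 1) u)).
    intros i _. apply is_derive_scal, Phi_derive. specialize (Pc i). lra. }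
  assert (TL : T L = INR n ^ k * INR (fact (k - 1)) * moment n k).
  { unfold T, moment. fold s. rewrite <- lsum_scal. apply lsum_ext. intros i _.
    rewrite Phi_L by (specialize (Pc i); lra). replace (S (k - 1)) with k by lia.
    rewrite <- exp_pow_nat, EL, pow_add. unfold coef. rewrite !pow_inv. specialize (Pc i).
    field. split; apply pow_nonzero; lra. }
  assert (B : exists K, 0 <= K /\ forall u, u < 0 -> Rabs (T u) <= K / - u).
  { unfold T. generalize s as l. induction l as [|i l (K & PK & IH)].
    - exists 0. split; [lra|]. intros u Hu. simpl. rewrite Rabs_R0. unfold Rdiv. lra.
    - destruct (Phi_bound (INR (k + i)) L (k - 1) (Pc i) HL) as (K1 & P1 & H1).
      exists (Rabs (coef i) * K1 + K). split.
      + assert (0 <= Rabs (coef i) * K1) by (apply Rmult_le_pos; auto using Rabs_pos). lra.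
      + intros u Hu. cbn [lsum]. eapply Rle_trans; [apply Rabs_triang|].
        replace ((Rabs (coef i) * K1 + K) / - u) with (Rabs (coef i) * (K1 / - u) + K / - u) by (field; lra).
        apply Rplus_le_compat; auto. rewrite Rabs_mult. apply Rmult_le_compat_l; auto using Rabs_pos. }
  destruct B as (K & PK & HB).
  (* The threshold puts [b] beyond [L] and makes [K / - a] smaller than [eps]. *)
  intros eps He. exists (1 + L + K / eps). intros a b Ha Hb.
  assert (PKe : 0 <= K / eps) by (apply Rdiv_le_0_compat; auto).
  assert (I : is_RInt (mweight n k) a b (minus (T L) (T a) + (b - L) * 0)).
  { apply is_RInt_glue with (fun u => lsum (fun i => coef i * (exp (INR (k + i) * u) * (L - u) ^ (k - 1))) s) (fun _ => 0) L.
    - lra.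
    - apply (is_RInt_derive T).
      + intros; apply D.
      + intros u _. apply cont_lsum. intros i. apply cont_mult; [apply cont_const|].
        apply cont_diff. intros v. auto_derive. auto.
    - apply is_RInt_cst.
    - intros u Hu. apply E1. lra.
    - intros u Hu. unfold mweight.
      assert (INR n < exp u) by (rewrite <- EL; apply exp_increasing; lra).
      assert (1 - exp u / INR n < 0).
      { apply Rmult_lt_reg_r with (INR n); auto. rewrite Rmult_0_l.
        replace ((1 - exp u / INR n) * INR n) with (INR n - exp u) by (field; lra). lra. }
      unfold pospart. rewrite Rabs_left by auto.
      replace ((1 - exp u / INR n + - (1 - exp u / INR n)) / 2) with 0 by (field; lra).
      rewrite pow_i by lia. ring. }
  rewrite (is_RInt_unique _ _ _ _ I), <- TL. unfold minus, plus, opp; simpl.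
  replace (T L + - T a + (b - L) * 0 - T L) with (- T a) by ring. rewrite Rabs_Ropp.
  eapply Rle_lt_trans; [apply HB; lra|].
  apply Rmult_lt_reg_r with (- a); [lra|]. replace (K / - a * - a) with K by (field; lra).
  assert (H : 1 + K / eps <= - a) by lra.
  apply Rmult_le_compat_l with (r := eps) in H; [|lra].
  replace (eps * (1 + K / eps)) with (eps + K) in H by (field; lra). lra.
Qed.

(** * Asymptotics *)

Lemma exp_le x y : x <= y -> exp x <= exp y.
Proof. intros [H| ->]; [left; apply exp_increasing; auto | lra]. Qed.

Lemma bernoulli x n : 0 <= 1 + x -> 1 + INR n * x <= (1 + x) ^ n.
Proof.
  intros Hx. induction n as [|n IH]; [simpl; lra|].
  rewrite S_INR. simpl. pose proof (pos_INR n).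
  apply Rmult_le_compat_l with (r := 1 + x) in IH; auto.
  assert (0 <= INR n * (x * x)) by (apply Rmult_le_pos; auto; apply Rle_0_sqr). nra.
Qed.

(** The upper estimate comes from [1 - x <= exp (- x)], the lower one from Bernoulli's inequality.
    The hypothesis [2 k <= n] gives [k t / n <= t / 2], so [exp (- t / 2)] survives and keeps the
    error integrable. *)
Lemma cutoff_approx n k t : (1 <= k)%nat -> (2 * k <= n)%nat -> 0 < t ->
  Rabs (pospart (1 - t / INR n) ^ (n - k) - exp (- t)) <= (t ^ 2 + INR k * t) / INR n * exp (- (t / 2)).
Proof.
  intros Hk Hn Ht.
  assert (Pn : 0 < INR n) by (apply lt_0_INR; lia).
  assert (Pk : 1 <= INR k) by (apply (le_INR 1); lia).
  assert (Hkn : 2 * INR k <= INR n) by (rewrite <- (mult_INR 2); apply le_INR; lia).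
  assert (Pi : 0 < / INR n) by (apply Rinv_0_lt_compat; auto).
  assert (Eh : exp (- t) <= exp (- (t / 2))) by (apply exp_le; lra).
  pose proof (exp_pos (- t)) as P1. pose proof (exp_pos (- (t / 2))) as P2.
  unfold pospart. destruct (Rle_dec t (INR n)) as [L|L].
  - set (x := 1 - t / INR n).
    assert (Htn : 0 <= t / INR n <= 1).
    { split; [apply Rdiv_le_0_compat; lra|]. apply Rmult_le_reg_r with (INR n); auto.
      unfold Rdiv. rewrite Rmult_assoc, Rinv_l; lra. }
    assert (Hx : 0 <= x <= 1) by (unfold x; lra).
    rewrite (Rabs_pos_eq x) by lra. replace ((x + x) / 2) with x by field.
    assert (Up : x ^ (n - k) <= exp (- t) + INR k * t / INR n * exp (- (t / 2))).
    { apply Rle_trans with (exp (- t + INR k * t / INR n)).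
      - replace (- t + INR k * t / INR n) with (INR (n - k) * (- (t / INR n))) by (rewrite minus_INR by lia; field; lra).
        rewrite <- exp_pow_nat. apply pow_incr. split; [lra|]. pose proof (exp_ineq1_le (- (t / INR n))). unfold x. lra.
      - set (y := INR k * t / INR n).
        assert (Hy : 0 <= y <= t / 2).
        { unfold y. split; [apply Rdiv_le_0_compat; nra|]. apply Rmult_le_reg_r with (INR n); auto.
          unfold Rdiv. rewrite Rmult_assoc, Rinv_l by lra. nra. }
        assert (Ey : exp (- t + y) <= exp (- (t / 2))) by (apply exp_le; lra).
        (* [exp (-t) = exp (-t+y) exp (-y) >= exp (-t+y) (1 - y)] *)
        pose proof (exp_ineq1_le (- y)) as E.
        replace (exp (- t)) with (exp (- t + y) * exp (- y)) by (rewrite <- exp_plus; f_equal; ring).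
        pose proof (exp_pos (- t + y)). nra. }
    assert (Lo : exp (- t) - t ^ 2 / INR n * exp (- (t / 2)) <= x ^ (n - k)).
    { apply Rle_trans with (x ^ n).
      (* [1 + w = (1 - t/n) (1 + t/n)] is at most [x exp (t/n)], so its [n]-th power is at most
         [x^n exp t]. *)
      - set (w := - (t / INR n) ^ 2).
        assert (Hw : 0 <= 1 + w) by (unfold w; nra).
        pose proof (bernoulli w n Hw) as B.
        assert (F : (1 + w) ^ n <= x ^ n * exp t).
        { replace t with (INR n * (t / INR n)) at 1 by (field; lra).
          rewrite <- exp_pow_nat, <- Rpow_mult_distr. apply pow_incr. split; auto.
          pose proof (exp_ineq1_le (t / INR n)). unfold w, x. nra. }
        assert (G : INR n * w = - (t ^ 2 / INR n)) by (unfold w; field; lra).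
        rewrite G in B.
        assert (H : (1 + - (t ^ 2 / INR n)) * exp (- t) <= x ^ n).
        { replace (x ^ n) with (x ^ n * exp t * exp (- t)).
          - apply Rmult_le_compat_r; lra.
          - rewrite Rmult_assoc, <- exp_plus, Rplus_opp_r, exp_0. ring. }
        assert (0 <= t ^ 2 / INR n) by (apply Rdiv_le_0_compat; auto; apply pow2_ge_0).
        nra.
      - replace n with ((n - k) + k)%nat at 1 by lia. rewrite pow_add.
        assert (0 <= x ^ (n - k)) by (apply pow_le; lra).
        assert (x ^ k <= 1) by (rewrite <- (pow1 k); apply pow_incr; lra).
        nra. }
    assert (0 <= INR k * t / INR n * exp (- (t / 2))).
    { apply Rmult_le_pos; [apply Rdiv_le_0_compat; nra | lra]. }
    assert (0 <= t ^ 2 / INR n * exp (- (t / 2))).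
    { apply Rmult_le_pos; [apply Rdiv_le_0_compat; nra | lra]. }
    replace ((t ^ 2 + INR k * t) / INR n * exp (- (t / 2)))
      with (t ^ 2 / INR n * exp (- (t / 2)) + INR k * t / INR n * exp (- (t / 2))) by (field; lra).
    apply Rabs_le. lra.
  (* Beyond the cutoff the power is [0], and the polynomial factor of the bound is at least [1]. *)
  - assert (1 < t / INR n).
    { apply Rmult_lt_reg_r with (INR n); auto. unfold Rdiv. rewrite Rmult_assoc, Rinv_l; lra. }
    rewrite (Rabs_left (1 - t / INR n)) by lra.
    replace ((1 - t / INR n + - (1 - t / INR n)) / 2) with 0 by (field; lra).
    rewrite pow_i by lia. rewrite Rminus_0_l, Rabs_Ropp, Rabs_pos_eq by lra.
    apply Rle_trans with (1 * exp (- (t / 2))); [lra|]. apply Rmult_le_compat_r; [lra|].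
    apply Rmult_le_reg_r with (INR n); auto. unfold Rdiv. rewrite Rmult_assoc, Rinv_l by lra. nra.
Qed.

Definition main_term (k n : nat) : R :=
  lsum (fun m => Binomial.C (k - 1) m * (-1) ^ m * ln (INR n) ^ (k - 1 - m) * GI m (INR k)) (seq 0 k).

Lemma ln_ge_1 n : (3 <= n)%nat -> 1 <= ln (INR n).
Proof.
  intros Hn. rewrite <- (ln_exp 1). apply ln_le; [apply exp_pos|].
  apply Rle_trans with 3; [apply exp_le_3|]. apply (le_INR 3) in Hn. simpl in Hn. lra.
Qed.

Lemma isI_main_term k n : (1 <= k)%nat ->
  isI (fun u => exp (INR k * u) * exp (- exp u) * (ln (INR n) - u) ^ (k - 1)) (main_term k n).
Proof.
  intros Hk. set (L := ln (INR n)).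
  apply isI_ext with (fun u => lsum (fun m => (Binomial.C (k - 1) m * (-1) ^ m * L ^ (k - 1 - m)) * gweight m (INR k) u) (seq 0 k)).
  - intros u. replace (L - u) with (- u + L) by ring. rewrite Binomial.binomial, lsum_sum_f_R0, <- lsum_scal.
    replace (S (k - 1)) with k by lia. apply lsum_ext. intros m _.
    replace (- u) with (-1 * u) by ring. rewrite Rpow_mult_distr. unfold gweight. ring.
  - apply isI_lsum.
    + intros m. apply cont_mult; [apply cont_const | apply cont_gweight].
    + intros m _. apply isI_scal; [apply cont_gweight|]. apply isI_GI, lt_0_INR. lia.
Qed.

Lemma moment_approx k : (1 <= k)%nat -> exists K, 0 <= K /\ forall n, (2 * k <= n)%nat -> (3 <= n)%nat ->
  Rabs (INR n ^ k * INR (fact (k - 1)) * moment n k - main_term k n) <= K * (/ INR n * ln (INR n) ^ (k - 1)).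
Proof.
  intros Hk. assert (Pk : 0 < INR k) by (apply lt_0_INR; lia).
  (* With [t = exp u], the error terms [t^2] and [k t] shift the exponent [k] to [k + 2] and
     [k + 1]; the constant [1/2] comes from [exp (- t / 2)]. *)
  destruct (weight_dominated (k - 1) (INR k + 2) (1 / 2) ltac:(lra) ltac:(lra)) as (K1 & P1 & H1).
  destruct (weight_dominated (k - 1) (INR k + 1) (1 / 2) ltac:(lra) ltac:(lra)) as (K2 & P2 & H2).
  exists (4 * (K1 + INR k * K2)).
  assert (0 <= INR k * K2) by (apply Rmult_le_pos; lra).
  split; [lra|]. intros n Hn Hn3.
  pose proof (ln_ge_1 n Hn3) as HL. set (L := ln (INR n)) in *.
  assert (Pn : 0 < INR n) by (apply lt_0_INR; lia).
  assert (Pi : 0 < / INR n) by (apply Rinv_0_lt_compat; auto).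
  assert (PL : 0 < L ^ (k - 1)) by (apply pow_lt; lra).
  pose proof (isI_mweight n k Hk ltac:(lia)) as I1.
  pose proof (isI_main_term k n Hk) as I2. fold L in I2.
  assert (C2 : cont (fun u => exp (INR k * u) * exp (- exp u) * (L - u) ^ (k - 1))).
  { apply cont_diff. intros u. auto_derive. auto. }
  pose proof (isI_plus _ _ _ _ (cont_mweight n k) (cont_mult _ _ (cont_const (-1)) C2) I1 (isI_scal _ (-1) _ C2 I2)) as I.
  replace (INR n ^ k * INR (fact (k - 1)) * moment n k - main_term k n)
    with (INR n ^ k * INR (fact (k - 1)) * moment n k + -1 * main_term k n) by ring.
  replace (4 * (K1 + INR k * K2) * (/ INR n * L ^ (k - 1)))
    with (4 * ((/ INR n * L ^ (k - 1)) * (K1 + INR k * K2))) by ring.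
  eapply isI_bound; [|..|exact I].
  - apply cont_plus; [apply cont_mweight | apply cont_mult; [apply cont_const | exact C2]].
  - intros u. unfold mweight. fold L.
    set (t := exp u). assert (Pt : 0 < t) by apply exp_pos.
    pose proof (cutoff_approx n k t Hk Hn Pt) as CA.
    set (X := pospart (1 - t / INR n) ^ (n - k)) in *.
    replace (exp (INR k * u) * X * (L - u) ^ (k - 1) + -1 * (exp (INR k * u) * exp (- t) * (L - u) ^ (k - 1)))
      with (exp (INR k * u) * ((L - u) ^ (k - 1) * (X - exp (- t)))) by ring.
    pose proof (exp_pos (INR k * u)) as Pe. pose proof (Rabs_pos u) as Pu.
    rewrite !Rabs_mult, (Rabs_pos_eq (exp (INR k * u))), <- RPow_abs by lra.
    (* Since [L >= 1], [|L - u| <= L + |u| <= L (1 + |u|)]; this separates the power of [ln n] from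
       the integral. *)
    assert (HLu : Rabs (L - u) ^ (k - 1) <= L ^ (k - 1) * (1 + Rabs u) ^ (k - 1)).
    { rewrite <- Rpow_mult_distr. apply pow_incr. split; [apply Rabs_pos|].
      pose proof (Rabs_triang L (- u)) as T. rewrite Rabs_Ropp, (Rabs_pos_eq L) in T by lra.
      unfold Rminus. nra. }
    set (V := (1 + Rabs u) ^ (k - 1)) in *.
    apply Rle_trans with (exp (INR k * u) * (L ^ (k - 1) * V * ((t ^ 2 + INR k * t) / INR n * exp (- (t / 2))))).
    { apply Rmult_le_compat_l; [lra|]. apply Rmult_le_compat; auto using Rabs_pos. apply pow_le, Rabs_pos. }
    replace (exp (INR k * u) * (L ^ (k - 1) * V * ((t ^ 2 + INR k * t) / INR n * exp (- (t / 2)))))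
      with (/ INR n * L ^ (k - 1) * (V * exp ((INR k + 2) * u) * exp (- (1 / 2 * exp u)) +
              INR k * (V * exp ((INR k + 1) * u) * exp (- (1 / 2 * exp u))))).
    + replace (/ INR n * L ^ (k - 1) * (K1 + INR k * K2) / (1 + u ^ 2))
        with (/ INR n * L ^ (k - 1) * (K1 / (1 + u ^ 2) + INR k * (K2 / (1 + u ^ 2)))) by (unfold Rdiv; ring).
      apply Rmult_le_compat_l; [apply Rmult_le_pos; lra|].
      apply Rplus_le_compat; [apply H1|]. apply Rmult_le_compat_l; [lra | apply H2].
    + fold t. replace (1 / 2 * t) with (t / 2) by field.
      replace ((INR k + 2) * u) with (INR k * u + u + u) by ring.
      replace ((INR k + 1) * u) with (INR k * u + u) by ring.
      rewrite !exp_plus. fold t. field. lra.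
Qed.

Lemma falling_ratio k : exists K, 0 <= K /\ forall n, (1 <= n)%nat ->
  Rabs (falling n k / INR n ^ k - 1) <= K / INR n.
Proof.
  induction k as [|k (K & PK & IH)].
  - exists 0. split; [lra|]. intros n Hn. simpl. replace (1 / 1 - 1) with 0 by field. rewrite Rabs_R0.
    unfold Rdiv. lra.
  - pose proof (pos_INR k). exists (K + (1 + K) * INR k).
    assert (0 <= (1 + K) * INR k) by (apply Rmult_le_pos; lra).
    split; [lra|]. intros n Hn. specialize (IH n Hn).
    assert (Pn : 1 <= INR n) by (apply (le_INR 1); auto).
    set (r := falling n k / INR n ^ k) in *.
    replace (falling n (S k) / INR n ^ S k - 1) with ((r - 1) + - (r * (INR k / INR n))).
    2:{ unfold r. cbn [falling pow]. field. split; [apply pow_nonzero|]; lra. }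
    assert (Hr : Rabs r <= 1 + K).
    { replace r with ((r - 1) + 1) by ring. eapply Rle_trans; [apply Rabs_triang|]. rewrite Rabs_R1.
      assert (K / INR n <= K).
      { apply Rmult_le_reg_r with (INR n); [lra|]. unfold Rdiv. rewrite Rmult_assoc, Rinv_l by lra. nra. }
      lra. }
    eapply Rle_trans; [apply Rabs_triang|].
    replace ((K + (1 + K) * INR k) / INR n) with (K / INR n + (1 + K) * (INR k / INR n)) by (field; lra).
    apply Rplus_le_compat; auto.
    assert (0 <= INR k / INR n) by (apply Rdiv_le_0_compat; lra).
    rewrite Rabs_Ropp, Rabs_mult, (Rabs_pos_eq (INR k / INR n)) by auto.
    apply Rmult_le_compat_r; auto.
Qed.

Lemma main_term_bound k : exists K, 0 <= K /\ forall n, (3 <= n)%nat ->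
  Rabs (main_term k n) <= K * ln (INR n) ^ (k - 1).
Proof.
  exists (lsum (fun m => Rabs (Binomial.C (k - 1) m * (-1) ^ m * GI m (INR k))) (seq 0 k)). split.
  - eapply Rle_trans; [|apply lsum_abs]. apply Rabs_pos.
  - intros n Hn. pose proof (ln_ge_1 n Hn) as HL. eapply Rle_trans; [apply lsum_abs|].
    rewrite Rmult_comm, <- lsum_scal. apply lsum_le. intros m Hm. apply in_seq in Hm.
    replace (Binomial.C (k - 1) m * (-1) ^ m * ln (INR n) ^ (k - 1 - m) * GI m (INR k))
      with (ln (INR n) ^ (k - 1 - m) * (Binomial.C (k - 1) m * (-1) ^ m * GI m (INR k))) by ring.
    rewrite Rabs_mult, (Rabs_pos_eq (ln (INR n) ^ (k - 1 - m))) by (apply pow_le; lra).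
    apply Rmult_le_compat_r; [apply Rabs_pos|]. apply Rle_pow; auto. lia.
Qed.

Lemma term_approx d k : (1 <= k <= d)%nat -> exists K N, forall n, (N <= n)%nat ->
  Rabs (bin d k * (falling n k * moment n k) - bin d k * (main_term k n / INR (fact (k - 1))))
    <= K * (/ INR n * ln (INR n) ^ (d - 1)).
Proof.
  intros Hk.
  destruct (moment_approx k ltac:(lia)) as (K1 & P1 & H1).
  destruct (falling_ratio k) as (K2 & P2 & H2).
  destruct (main_term_bound k) as (K3 & P3 & H3).
  exists (Rabs (bin d k) * ((1 + K2) * K1 + K2 * K3)), (2 * k + 3)%nat. intros n Hn.
  specialize (H1 n ltac:(lia) ltac:(lia)). specialize (H2 n ltac:(lia)). specialize (H3 n ltac:(lia)).
  pose proof (ln_ge_1 n ltac:(lia)) as HL. set (L := ln (INR n)) in *.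
  assert (Pn : 1 <= INR n) by (apply (le_INR 1); lia).
  assert (Pi : 0 < / INR n) by (apply Rinv_0_lt_compat; lra).
  assert (LL : 0 < L ^ (k - 1) <= L ^ (d - 1)) by (split; [apply pow_lt; lra | apply Rle_pow; [auto | lia]]).
  rewrite <- Rmult_minus_distr_l, Rabs_mult, Rmult_assoc. apply Rmult_le_compat_l; [apply Rabs_pos|].
  set (f := INR (fact (k - 1))) in *.
  assert (Pf : 1 <= f) by (apply (le_INR 1), lt_O_fact).
  set (J := INR n ^ k * f * moment n k) in *. set (M := main_term k n) in *.
  set (r := falling n k / INR n ^ k) in *.
  assert (Pnk : INR n ^ k <> 0) by (apply pow_nonzero; lra).
  (* The two errors are separated: [J - M] from the exponential approximation, [r - 1] from
     replacing [n_(k)] by [n^k]. *)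
  replace (falling n k * moment n k - M / f) with ((r * (J - M) + (r - 1) * M) * / f)
    by (unfold r, J; field; lra).
  set (Z := / INR n * L ^ (k - 1)) in *.
  assert (PZ : 0 <= Z) by (unfold Z; apply Rmult_le_pos; lra).
  assert (Hr : Rabs r <= 1 + K2).
  { replace r with ((r - 1) + 1) by ring. eapply Rle_trans; [apply Rabs_triang|]. rewrite Rabs_R1.
    assert (K2 / INR n <= K2).
    { apply Rmult_le_reg_r with (INR n); [lra|]. unfold Rdiv. rewrite Rmult_assoc, Rinv_l by lra. nra. }
    lra. }
  assert (B : Rabs (r * (J - M) + (r - 1) * M) <= ((1 + K2) * K1 + K2 * K3) * Z).
  { eapply Rle_trans; [apply Rabs_triang|]. rewrite !Rabs_mult.
    apply Rle_trans with ((1 + K2) * (K1 * Z) + (K2 / INR n) * (K3 * L ^ (k - 1))).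
    - apply Rplus_le_compat; apply Rmult_le_compat; auto using Rabs_pos.
    - right. unfold Z, Rdiv. ring. }
  assert (PK : 0 <= (1 + K2) * K1 + K2 * K3).
  { assert (0 <= (1 + K2) * K1) by (apply Rmult_le_pos; lra). assert (0 <= K2 * K3) by (apply Rmult_le_pos; lra). lra. }
  assert (Hf : 0 < / f <= 1).
  { split; [apply Rinv_0_lt_compat; lra|]. rewrite <- Rinv_1. apply Rinv_le_contravar; lra. }
  rewrite Rabs_mult, (Rabs_pos_eq (/ f)) by lra.
  apply Rle_trans with (((1 + K2) * K1 + K2 * K3) * Z).
  - pose proof (Rabs_pos (r * (J - M) + (r - 1) * M)). nra.
  - apply Rmult_le_compat_l; auto. unfold Z. apply Rmult_le_compat_l; lra.
Qed.

Lemma lsum_approx {A} (f g : A -> nat -> R) (e : nat -> R) l :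
  (forall a, In a l -> exists K N, forall n, (N <= n)%nat -> Rabs (f a n - g a n) <= K * e n) ->
  exists K N, forall n, (N <= n)%nat -> Rabs (lsum (fun a => f a n) l - lsum (fun a => g a n) l) <= K * e n.
Proof.
  induction l as [|a l IH]; intros H.
  - exists 0, 0%nat. intros n _. simpl. rewrite Rminus_diag, Rabs_R0. lra.
  - destruct (H a) as (K1 & N1 & H1); [simpl; auto|].
    destruct IH as (K2 & N2 & H2); [intros; apply H; simpl; auto|].
    exists (K1 + K2), (max N1 N2). intros n Hn. specialize (H1 n ltac:(lia)). specialize (H2 n ltac:(lia)).
    cbn [lsum].
    replace (f a n + lsum (fun a => f a n) l - (g a n + lsum (fun a => g a n) l))
      with ((f a n - g a n) + (lsum (fun a => f a n) l - lsum (fun a => g a n) l)) by ring.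
    eapply Rle_trans; [apply Rabs_triang|]. lra.
Qed.

(** * Rearrangement of the main term *)

Lemma lsum_seq_rev (f : nat -> R) n : lsum f (seq 0 n) = lsum (fun i => f (n - 1 - i)%nat) (seq 0 n).
Proof.
  revert f. induction n as [|n IH]; intros f; [reflexivity|].
  rewrite (seq_snoc 0 n) at 2. rewrite lsum_app. cbn [seq lsum].
  rewrite <- seq_shift, lsum_map, (IH (fun i => f (S i))).
  replace (S n - 1 - (0 + n))%nat with 0%nat by lia.
  rewrite (lsum_ext (fun i => f (S (n - 1 - i))) (fun i => f (S n - 1 - i)%nat)).
  - ring.
  - intros i Hi. apply in_seq in Hi. f_equal. lia.
Qed.

Lemma lsum_triangle (F : nat -> nat -> R) D :
  lsum (fun q => lsum (fun m => F m (q - m)%nat) (seq 0 (S q))) (seq 0 D) =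
  lsum (fun r => lsum (fun m => F m r) (seq 0 (D - r))) (seq 0 D).
Proof.
  induction D as [|D IH]; [reflexivity|].
  rewrite seq_snoc, lsum_app, IH, lsum_app. cbn [lsum]. rewrite Nat.add_0_l.
  replace (S D - D)%nat with 1%nat by lia. change (lsum (fun m => F m D) (seq 0 1)) with (F 0%nat D + 0).
  rewrite (lsum_ext (fun r => lsum (fun m => F m r) (seq 0 (S D - r)))
    (fun r => lsum (fun m => F m r) (seq 0 (D - r)) + F (D - r)%nat r)).
  - rewrite lsum_plus, (lsum_seq_rev (fun m => F m (D - m)%nat)), seq_snoc, lsum_app.
    cbn [lsum]. rewrite Nat.add_0_l.
    replace (S D - 1 - D)%nat with 0%nat by lia. rewrite Nat.sub_0_r.
    rewrite (lsum_ext (fun i => F (S D - 1 - i)%nat (D - (S D - 1 - i))%nat) (fun r => F (D - r)%nat r)); [ring|].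
    intros i Hi. apply in_seq in Hi. f_equal; lia.
  - intros r Hr. apply in_seq in Hr. replace (S D - r)%nat with (S (D - r)) by lia.
    rewrite seq_snoc, lsum_app. cbn [lsum]. rewrite Nat.add_0_l. ring.
Qed.

(** Both sides sum the same [F m r], where [r = d - 1 - j] is the power of [ln n], [m] the order of
    the derivative, and [k = m + r + 1]. The right side groups by [m + r], the left by [r], and
    [C (k-1) m / (k-1)!] is [1 / (m! r!)]. *)
Lemma main_sum d n : (1 <= d)%nat -> ln (INR n) <> 0 ->
  ln (INR n) ^ (d - 1) * sum_f_R0 (fun j => a_coef d j * / ln (INR n) ^ j) (d - 1)
  = lsum (fun k => bin d k * (main_term k n / INR (fact (k - 1)))) (seq 1 d).
Proof.
  intros Hd HL. set (L := ln (INR n)) in *.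
  set (F := fun m r => bin d (m + r + 1) * (-1) ^ m * GI m (INR (m + r + 1)) * L ^ r / (INR (fact m) * INR (fact r))).
  transitivity (lsum (fun q => lsum (fun m => F m (q - m)%nat) (seq 0 (S q))) (seq 0 d)).
  - rewrite lsum_triangle, lsum_seq_rev, lsum_sum_f_R0, <- lsum_scal.
    replace (S (d - 1)) with d by lia. apply lsum_ext. intros j Hj. apply in_seq in Hj.
    replace (d - (d - 1 - j))%nat with (S j) by lia.
    unfold a_coef. rewrite lsum_sum_f_R0, (Rmult_comm (lsum _ _)), <- Rmult_assoc, <- lsum_scal.
    apply lsum_ext. intros m Hm. apply in_seq in Hm. unfold F.
    replace (d - j + m)%nat with (m + (d - 1 - j) + 1)%nat by lia.
    rewrite Gamma_deriv_GI by (apply lt_0_INR; lia). rewrite bin_C by lia.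
    replace (L ^ (d - 1)) with (L ^ (d - 1 - j) * L ^ j) by (rewrite <- pow_add; f_equal; lia).
    field. repeat split; try apply INR_fact_neq_0. apply pow_nonzero; auto.
  - rewrite <- seq_shift, lsum_map. apply lsum_ext. intros q Hq. apply in_seq in Hq.
    unfold main_term. fold L. replace (S q - 1)%nat with q by lia.
    unfold Rdiv. rewrite (Rmult_comm (lsum _ _)), <- Rmult_assoc, <- lsum_scal. apply lsum_ext. intros m Hm. apply in_seq in Hm.
    unfold F, Binomial.C. replace (m + (q - m) + 1)%nat with (S q) by lia.
    field. repeat split; apply INR_fact_neq_0.
Qed.

Theorem theoremT (d : nat) (hd : (1 <= d)%nat) :
  (exists K : R, exists N : nat, forall n : nat, (N <= n)%nat ->
     Rabs (Gdn d n
           - (ln (INR n)) ^ (d - 1)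
             * sum_f_R0 (fun j => a_coef d j * / (ln (INR n)) ^ j) (d - 1))
     <= K * (/ INR n * (ln (INR n)) ^ (d - 1)))
  /\ a_coef d 0 = 1.
Proof.
  split.
  - destruct (lsum_approx (fun k n => bin d k * (falling n k * moment n k))
      (fun k n => bin d k * (main_term k n / INR (fact (k - 1))))
      (fun n => / INR n * ln (INR n) ^ (d - 1)) (seq 1 d)) as (K & N & H).
    { intros k Hk. apply in_seq in Hk. apply term_approx. lia. }
    (* From [n >= 3] on, [ln n >= 1], so the division by powers of [ln n] is legitimate. *)
    exists K, (max N 3). intros n Hn.
    assert (L1 : 1 <= ln (INR n)) by (apply ln_ge_1; lia).
    rewrite main_sum, Gdn_exact by (auto; try lia; lra).
    apply H. lia.
  - unfold a_coef. cbn [sum_f_R0]. rewrite Nat.add_0_r, !Nat.sub_0_r.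
    destruct d as [|d']; [lia|]. replace (S d' - 1)%nat with d' by lia.
    (* Only [k = 0] remains, and [Gamma d = (d-1)!] cancels the denominator. *)
    rewrite Gamma_deriv_GI by (apply lt_0_INR; lia). rewrite GI_0_fact. unfold Binomial.C. rewrite Nat.sub_diag. simpl (fact 0). simpl pow. simpl (INR 1).
    field. split; apply INR_fact_neq_0.
Qed.
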